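(* Let $L$ be an honest time satisfying condition $(\mathbf{A})$: $\mathbb{P}[L=T]=0$ for every $(\mathcal{F}_t)$-stopping time $T$. Write $A=A^L$. Let $\varphi:\mathbb{R}_+\to\mathbb{R}$ be continuous with $\int_0^\infty|\varphi(x)|e^{-x}\,dx<\infty$ and $\int_0^\infty x|\varphi(x)|e^{-x}\,dx<\infty$, and let $M^\varphi_t=\mathbb{E}[\varphi(A_\infty)\mid\mathcal{F}_t]$. Then $$M^\varphi_L=e^{A_L}\int_{A_L}^\infty e^{-x}\varphi(x)\,dx=\int_0^\infty e^{-x}\varphi(A_L+x)\,dx=\widehat{\varphi}(A_L)$$ and $$\mathbb{E}[\varphi(A_\infty)\mid\mathcal{F}_L]=\varphi(A_L),$$ where $\widehat{\varphi}(x)=e^{x}\int_x^\infty e^{-y}\varphi(y)\,dy$.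
   Context: $(\Omega,\mathcal{F},(\mathcal{F}_t)_{t\ge0},\mathbb{P})$ is a filtered probability space satisfying the usual hypotheses; martingales are taken càdlàg. An honest time is a random time $L:\Omega\to\mathbb{R}_+$ which is the end of an $(\mathcal{F}_t)$-optional set $\Gamma$, $L=\sup\{t:(t,\omega)\in\Gamma\}$; it is assumed that $\mathbb{P}[L=0]=\mathbb{P}[L=\infty]=0$. $A^L$ is the $(\mathcal{F}_t)$ dual optional projection of $1_{\{L\le t\}}$ (the increasing right-continuous adapted process with $\mathbb{E}[\int_0^\infty H_s\,dA^L_s]=\mathbb{E}[H_L]$ for all bounded optional $H$). $\mathcal{F}_L=\sigma\{z_L:\ z\text{ any }(\mathcal{F}_t)\text{-optional process}\}$. Equalities hold almost surely. *)

(* Defs.v *)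
From HB Require Import structures.
From mathcomp Require Import all_boot all_order all_algebra.
From mathcomp Require Import all_classical all_reals all_analysis.
From mathcomp Require Import measurable_realfun.

Set Implicit Arguments.
Unset Strict Implicit.
Unset Printing Implicit Defensive.

Import Order.TTheory GRing.Theory Num.Theory.
Import numFieldNormedType.Exports.

Local Open Scope classical_set_scope.
Local Open Scope ring_scope.

(* Time is the half-line [0, +oo[ of R.  Filtrations, processes and paths are
   total functions of a real parameter, but only their values at parameters
   t >= 0 are ever constrained or used. *)

(* The condition usual_null makes the probability space complete, since each
   F t consists of measurable sets. *)
Record usual_filtration {d} {Omega : measurableType d} {R : realType}
    (P : probability Omega R) (F : R -> set (set Omega)) : Prop := {
  usual_sigma : forall t, 0 <= t -> sigma_algebra setT (F t) ;
  usual_sub : forall t, 0 <= t -> F t `<=` measurable ;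
  usual_nondecreasing : forall s t, 0 <= s -> s <= t -> F s `<=` F t ;
  usual_right_continuous : forall t, 0 <= t ->
    F t = \bigcap_(s in [set s | t < s]) F s ;
  usual_null : forall N, P.-negligible N -> F 0 N }.

Definition measurable_for {Omega : Type} {R : realType}
    (G : set (set Omega)) (X : Omega -> R) : Prop :=
  forall B : set R, measurable B -> G (X @^-1` B).

Definition adapted {Omega : Type} {R : realType}
    (F : R -> set (set Omega)) (X : R -> Omega -> R) : Prop :=
  forall t, 0 <= t -> measurable_for (F t) (X t).

Definition cadlag {R : realType} (x : R -> R) : Prop :=
  (forall t, 0 <= t -> x s @[s --> t^'+] --> x t) /\
  (forall t, 0 < t -> cvg (x s @[s --> t^'-])).

Definition stopping_time {Omega : Type} {R : realType}
    (F : R -> set (set Omega)) (T : Omega -> \bar R) : Prop :=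
  (forall w, (0 <= T w)%E) /\
  (forall t, 0 <= t -> F t [set w | (T w <= t%:E)%E]).

Definition time_space {R : realType} {Omega : Type} : set (R * Omega) :=
  [set tw | 0 <= tw.1].

(* The optional sigma-algebra on [0, +oo[ x Omega, generated by the adapted
   processes all of whose paths are cadlag. *)
Definition optional_set {Omega : Type} {R : realType}
    (F : R -> set (set Omega)) : set (set (R * Omega)) :=
  <<s time_space,
    [set E | exists (X : R -> Omega -> R) (B : set R),
      [/\ adapted F X, (forall w, cadlag (X ^~ w)), measurable B &
          E = time_space `&` [set tw | B (X tw.1 tw.2)]]] >>.

Definition optional_process {Omega : Type} {R : realType}
    (F : R -> set (set Omega)) (z : R -> Omega -> R) : Prop :=
  forall B : set R, measurable B ->
    optional_set F (time_space `&` [set tw | B (z tw.1 tw.2)]).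

(* The value z_L of a process at a random time.  Random times take values in
   [0, +oo]; where L = +oo, this is z_0, an immaterial choice since
   P[L = +oo] = 0 for the random times considered. *)
Definition at_time {Omega : Type} {R : realType}
    (z : R -> Omega -> R) (L : Omega -> \bar R) : Omega -> R :=
  fun w => z (fine (L w)) w.

(* The set 0%E is added so that the supremum is taken in [0, +oo]: an empty
   section of Gamma has supremum 0 (and not -oo). *)
Definition end_of {Omega : Type} {R : realType}
    (Gamma : set (R * Omega)) (L : Omega -> \bar R) : Prop :=
  forall w, L w =
    ereal_sup ([set 0%E] `|` EFin @` [set t | Gamma (t, w)]).

Record honest_time {d} {Omega : measurableType d} {R : realType}
    (P : probability Omega R) (F : R -> set (set Omega))
    (L : Omega -> \bar R) : Prop := {
  honest_measurable : measurable_fun setT L ;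
  honest_end : exists2 Gamma, optional_set F Gamma & end_of Gamma L ;
  honest_neq0 : P [set w | L w = 0%E] = 0%E ;
  honest_neqy : P [set w | L w = +oo%E] = 0%E }.

Definition condition_A {d} {Omega : measurableType d} {R : realType}
    (P : probability Omega R) (F : R -> set (set Omega))
    (L : Omega -> \bar R) : Prop :=
  forall T, stopping_time F T -> P [set w | L w = T w] = 0%E.

(* Every path of A is nondecreasing and right-continuous by typing.  Vanishing
   at negative times is the convention A_{0-} = 0: the Stieltjes measure dA
   has mass A_0 at 0, and is carried by [0, +oo[. *)
Record dual_optional_projection {d} {Omega : measurableType d} {R : realType}
    (P : probability Omega R) (F : R -> set (set Omega))
    (L : Omega -> \bar R) (A : Omega -> cumulative R R) : Prop := {
  dual_adapted : adapted F (fun t w => A w t) ;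
  dual_lt0 : forall w (t : R), t < 0 -> A w t = 0 ;
  dual_integral : forall H : R -> Omega -> R, optional_process F H ->
    (exists K : R, forall t w, 0 <= t -> `|H t w| <= K) ->
    (\int[P]_w \int[lebesgue_stieltjes_measure (A w)]_(t in `[0%R, +oo[)
       (H t w)%:E)%E = ('E_P[at_time H L])%E }.

(* The limit is taken in \bar R, where it always exists. *)
Definition A_infty {Omega : Type} {R : realType}
    (A : Omega -> cumulative R R) : Omega -> R :=
  fun w => fine (lim ((A w t)%:E @[t --> +oo])).

Definition sigma_at {Omega : Type} {R : realType}
    (F : R -> set (set Omega)) (L : Omega -> \bar R) : set (set Omega) :=
  <<s [set E | exists (z : R -> Omega -> R) (B : set R),
      [/\ optional_process F z, measurable B & E = at_time z L @^-1` B]] >>.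

(* Y is a version of E[X | G]. *)
Record cond_expectation {d} {Omega : measurableType d} {R : realType}
    (P : probability Omega R) (G : set (set Omega)) (X Y : Omega -> R)
    : Prop := {
  cond_integrable : P.-integrable setT (EFin \o X) ;
  cond_measurable : measurable_for G Y ;
  cond_integrable_version : P.-integrable setT (EFin \o Y) ;
  cond_integral : forall E, G E ->
    (\int[P]_(w in E) (Y w)%:E = \int[P]_(w in E) (X w)%:E)%E }.

Definition phi_hat {R : realType} (phi : R -> R) (x : R) : R :=
  expR x * \int[lebesgue_measure]_(y in `[x, +oo[) (expR (- y) * phi y).

(* Main.v *)
Require Import Defs.
From HB Require Import structures.
From mathcomp Require Import all_boot all_order all_algebra.
From mathcomp Require Import all_classical all_reals all_analysis.
From mathcomp Require Import measurable_realfun ring lra.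
Import Order.TTheory GRing.Theory Num.Theory.
Import numFieldNormedType.Exports.
Local Open Scope classical_set_scope.
Local Open Scope ring_scope.
Set Implicit Arguments.
Unset Strict Implicit.
Unset Printing Implicit Defensive.

(** The path [A w] stops growing at [L w] and has no jumps. Let [L] be the end
of the optional set [Gamma]. The times that neither belong to [Gamma] nor are
limits from the left of points of [Gamma] form an optional set
([optional_left_isolated]) which contains every time after [L] but not [L]
itself. By the duality between [dA] and [L], [dA] does not charge this set, and
[A_infty = A_L] ([total_mass_honest]). Its optionality rests on the
measurability, for the complete sigma-algebra [F q], of the event that [Gamma]
has a point at a time between [p] and [q]; this is the projection theorem, obtained
from the stability of complete sigma-algebras under the Suslin operation
([souslin_closed], [measurable_projection]). As for the jumps, one of them would
put mass on the graph of the first passage of [A] over a level, a stopping time,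
and [L] avoids stopping times by condition (A) ([dual_gapless]).

Fix [t], an event [B] of [F t], and let [Y = A_infty - A_t] be the remaining
growth. Put [g x = E[(Y - x)^+ ; B]]. As [A] is continuous, [dA] charges
[{s : A_s - A_t >= x}] with [(Y - x)^+]. Duality applied to the optional set
[{(s, w) : t <= s, w in B, A_s - A_t >= x}] therefore gives
[g x = P[A_L - A_t >= x ; B] = P[Y >= x ; B]] for [x > 0]. But the derivative of
[g] is [- P[Y >= x ; B]], so [g' = - g] and
[P[Y >= x ; B] = exp(-x) P[Y > 0 ; B]] ([remaining_growth_exponential]): on the
event that it does not vanish, [Y] has an exponential law and is independent of
[F t]. Since [phi_hat phi a] is the mean of [phi (a + Z)] for a standard
exponential [Z], the variables [phi A_infty] and [phi_hat phi A_t] have the same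
integral over [B] intersected with [{Y > 0}]; on [{Y = 0}], [A_infty = A_t].
Hence the integral of [M_t - phi_hat phi A_t] over [B] is at most a constant
times [P[Y = 0 ; B]] as soon as [A_t] is bounded on [B]
([cond_expectation_growing]).

It remains to pass from fixed times to [L]. Let [H] be the process
[|M - phi_hat phi A|], capped at 1 and cut off where [A] is large. Its values at
the times of a grid, weighted by the increments of [A] between these times, are
controlled in mean by the preceding estimate. In the limit, the mean of the
integral of [H] against [dA] is at most a constant times that of the indicator
of [{s : A_s = A_infty}], which is zero because [A] is continuous. By duality
[E[H_L] = 0], that is [M_L = phi_hat phi A_L] ([martingale_at_honest]). The
formula for [E[phi A_infty | F_L]] follows from [A_infty = A_L], as [A_L] is
measurable for [F_L]. *)

(** * The Suslin operation and measurable projections *)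

Section souslin.
Context d (Omega : measurableType d) (R : realType).
Variables (P : probability Omega R) (G : set (set Omega)).
Hypotheses (sG : sigma_algebra setT G) (GM : G `<=` measurable)
  (GN : forall N, P.-negligible N -> G N).

Let G0 : G set0. Proof. by case: sG. Qed.
Let GC A : G A -> G (~` A).
Proof. by case: sG => _ + _ => /[apply]; rewrite setTD. Qed.
Let GU (A : (set Omega)^nat) : (forall n, G (A n)) -> G (\bigcup_n A n).
Proof. by case: sG => _ _; exact. Qed.
Let GT : G setT. Proof. by rewrite -setC0; exact: GC. Qed.
Let GI (A : (set Omega)^nat) : (forall n, G (A n)) -> G (\bigcap_n A n).
Proof.
move=> GA; rewrite -[X in G X]setCK setC_bigcap; apply: GC; apply: GU => n.
exact: GC.
Qed.
Let GI2 A B : G A -> G B -> G (A `&` B).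
Proof.
by move=> GA GB; rewrite -bigcap2E; apply: GI => -[//|[//|n]] /=.
Qed.
Let GD A B : G A -> G B -> G (A `\` B).
Proof. by move=> GA GB; rewrite setDE; apply: GI2 => //; exact: GC. Qed.

(** A minimizing sequence of members of [G] above [E] has an intersection that
attains the infimum of their probabilities. *)
Lemma measurable_hull (E : set Omega) : exists H, [/\ G H, E `<=` H &
  forall B, G B -> E `<=` B -> P (H `\` B) = 0%E].
Proof.
pose S := [set P B | B in [set B | G B /\ E `<=` B]].
pose m := ereal_inf S.
have m0 : (0 <= m)%E by apply: le_ereal_inf_tmp => _ [B _ <-].
have m1 : (m <= 1)%E.
  by rewrite -(probability_setT P); apply: ereal_inf_lbound; exists setT.
have mfin : m \is a fin_num.
  by rewrite ge0_fin_numE// (le_lt_trans m1)// ltry.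
have /choice[B HB] : forall n : nat, exists B, [/\ G B, E `<=` B & (P B <= m + (n.+1%:R^-1)%:E)%E].
  move=> n; have n0 : 0 < n.+1%:R^-1 :> R by rewrite invr_gt0.
  have [_ [B [GB EB] <-] h] := lb_ereal_inf_adherent n0 mfin.
  by exists B; split=> //; exact: ltW.
exists (\bigcap_n B n); split.
- by apply: GI => n; case: (HB n).
- by move=> w Ew n _; case: (HB n) => _ + _; exact.
move=> D GD' ED; set H := \bigcap_n B n.
have GH : G H by apply: GI => n; case: (HB n).
have PH : (P H <= m)%E.
  apply/lee_addgt0Pr => e e0.
  near \oo => n.
  apply: (@le_trans _ _ (P (B n))).
    apply: le_measure; rewrite ?inE; [exact: GM|apply: GM; by case: (HB n)|].
    exact: bigcap_inf.
  case: (HB n) => _ _ /le_trans; apply; rewrite leeD2l// lee_fin ltW//.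
  by near: n; exact: near_infty_natSinv_lt (PosNum e0).
have mHD : (m <= P (H `&` D))%E.
  apply: ereal_inf_lbound; exists (H `&` D) => //; split; first exact: GI2.
  by move=> w Ew; split; [move=> n _; case: (HB n) => _ + _; exact|exact: ED].
have eH : (P (H `\` D) + P (H `&` D))%E = P H by rewrite -(measureDI P (GM GH) (GM GD')).
have fH := fineK (fin_num_measure P H (GM GH)).
have fHD := fineK (fin_num_measure P (H `&` D) (GM (GI2 GH GD'))).
have fD := fineK (fin_num_measure P (H `\` D) (GM (GD GH GD'))).
have : (0 <= P (H `\` D))%E by [].
move: PH mHD eH; rewrite -fH -fHD -fD -(fineK mfin) -EFinD !lee_fin.
by move=> h1 h2 [h3] h4; congr EFin; lra.
Unshelve. all: by end_near. Qed.

(** A Suslin scheme: [K n f] depends on finitely many values of [f] only. Their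
number may vary with [f], which makes recoding of branches painless. *)
Definition continuous_scheme {X : Type} (K : nat -> (nat -> nat) -> X) :=
  forall n f, exists N, forall g, (forall i, (i < N)%N -> g i = f i) -> K n g = K n f.

(** Let [Es s] be the set of the points admitting a branch that extends the finite
sequence [s], and [H s] a hull of it. As [Es s] is the union of the
[Es (rcons s k)], almost every point of [H s] lies in some [H (rcons s k)]. There
are countably many finite sequences, so outside a null set a point of [H [::]]
can be followed along an infinite branch, all of whose sets contain it. Hence
[E] differs from its hull by a null set. *)
Lemma souslin_closed (K : nat -> (nat -> nat) -> set Omega) :
  (forall n f, G (K n f)) -> continuous_scheme K ->
  G [set w | exists f, forall n, K n f w].
Proof.
move=> GK cK; set E := [set w | _].
pose extends (f : nat -> nat) (s : seq nat) :=
  forall i, (i < size s)%N -> f i = nth 0%N s i.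
pose Es s := [set w | exists f, extends f s /\ forall n, K n f w].
have /choice[H HP] := fun s => measurable_hull (Es s).
pose decides s n := forall f, extends f s -> K n f = K n (nth 0%N s).
(* A point of [H s] is exceptional if no extension of [s] by one value keeps it,
   or if it misses a set of the scheme that [s] already determines. *)
pose bad1 s := H s `\` \bigcup_k H (rcons s k).
pose bad2 s n := if `[< decides s n >] then H s `\` K n (nth 0%N s) else set0.
pose dec n := odflt [::] (unpickle n) : seq nat.
pose Bad := (\bigcup_n bad1 (dec n)) `|` (\bigcup_n \bigcup_m bad2 (dec n) m).
have nb1 s : P.-negligible (bad1 s).
  have [GHs EHs HHs] := HP s.
  exists (bad1 s); split=> //.
    by apply: GM; apply: GD => //; apply: GU => k; case: (HP (rcons s k)).
  apply: HHs; first by apply: GU => k; case: (HP (rcons s k)).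
  move=> w [f [fs Kf]]; exists (f (size s)) => //.
  case: (HP (rcons s (f (size s)))) => _ + _; apply; exists f; split=> //.
  move=> i; rewrite size_rcons ltnS leq_eqVlt => /orP[/eqP->|iN].
    by rewrite nth_rcons ltnn eqxx.
  by rewrite nth_rcons iN fs.
have nb2 s n : P.-negligible (bad2 s n).
  rewrite /bad2; case: asboolP => [sn|_]; last exact: negligible_set0.
  have [GHs EHs HHs] := HP s.
  exists (H s `\` K n (nth 0%N s)); split=> //.
    by apply: GM; apply: GD.
  apply: HHs => // w [f [fs Kf]]; rewrite -(sn f)//.
have nBad : P.-negligible Bad.
  apply: negligibleU; apply: negligible_bigcup => k //.
  exact: negligible_bigcup.
have sub : H [::] `\` E `<=` Bad.
  move=> w [Hw nEw]; apply: contrapT => nB; apply: nEw.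
  have decE s : dec (pickle s) = s by rewrite /dec pickleK.
  have /choice[nx nxP] : forall s, exists k, H s w -> H (rcons s k) w.
    move=> s; have [Hs|nHs] := pselect (H s w); last by exists 0%N.
    apply: contrapT => /forallNP h; apply: nB; left; exists (pickle s) => //.
    rewrite decE; split=> // -[k _ Hk]; exact: (h k).
  pose pre n := iter n (fun s => rcons s (nx s)) [::].
  have size_pre n : size (pre n) = n.
    by elim: n => //= n IH; rewrite size_rcons IH.
  pose f n := nx (pre n).
  have preE n i : (i < n)%N -> nth 0%N (pre n) i = f i.
    elim: n => //= n IH; rewrite ltnS leq_eqVlt nth_rcons size_pre.
    by move=> /orP[/eqP->|iN]; [rewrite ltnn eqxx|rewrite iN IH].
  have Hpre n : H (pre n) w by elim: n => //= n IH; exact: nxP.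
  exists f => n; have [N hN] := cK n f.
  have ext : extends f (pre N) by move=> i; rewrite size_pre => iN; rewrite preE.
  have dn : decides (pre N) n.
    move=> g gN; rewrite (hN g); last first.
      by move=> i iN; rewrite gN ?size_pre// preE.
    by rewrite (hN (nth 0%N (pre N)))// => i iN; rewrite preE.
  apply: contrapT => nK; apply: nB; right.
  exists (pickle (pre N)) => //; exists n => //.
  rewrite decE /bad2; case: asboolP => // _; split=> //.
  by rewrite -(dn f).
have [GH0 EH0 _] := HP [::].
have -> : E = H [::] `\` (H [::] `\` E).
  rewrite setDD; apply/seteqP; split=> [w Ew|w []//]; split=> //.
  by apply: EH0; case: Ew => f fw; exists f.
by apply: GD => //; apply: GN; exact: negligibleS nBad.
Qed.

(** Results of the Suslin operation on rectangles. Closed time sections are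
imposed so that projections along time can use compactness. *)
Definition souslin_rect (E : set (R * Omega)) :=
  exists K : nat -> (nat -> nat) -> set R * set Omega,
  [/\ forall n f, closed (K n f).1 /\ G (K n f).2, continuous_scheme K &
   E = [set tw | exists f, forall n, (K n f).1 tw.1 /\ (K n f).2 tw.2]].

Lemma souslin_rectX C B : closed C -> G B -> souslin_rect (C `*` B).
Proof.
move=> cC GB; exists (fun _ _ => (C, B)); split=> //.
- by move=> n f; exists 0%N.
- by apply/seteqP; split=> [tw CBtw|tw [f /(_ 0%N)]//]; exists id.
Qed.

(** The first value of a branch selects the member of the union. *)
Lemma souslin_rect_bigcup (E : (set (R * Omega))^nat) :
  (forall n, souslin_rect (E n)) -> souslin_rect (\bigcup_n E n).
Proof.
move=> /choice[K KP]; exists (fun n f => K (f 0%N) n (f \o succn)); split.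
- by move=> n f; have [+ _ _] := KP (f 0%N); exact.
- move=> n f; have [_ /(_ n (f \o succn))[N hN] _] := KP (f 0%N).
  exists N.+1 => g gf; rewrite gf//; apply: hN => i iN /=; exact: gf.
- apply/seteqP; split=> tw.
    move=> [m _]; have [_ _ ->] := KP m => -[f hf].
    by exists (fun n => if n is n'.+1 then f n' else m) => n; exact: hf.
  move=> [f hf]; exists (f 0%N) => //; have [_ _ ->] := KP (f 0%N).
  by exists (f \o succn).
Qed.

(** One branch codes countably many, one for each member of the intersection. *)
Lemma souslin_rect_bigcap (E : (set (R * Omega))^nat) :
  (forall n, souslin_rect (E n)) -> souslin_rect (\bigcap_n E n).
Proof.
move=> /choice[K KP].
pose up n := odflt (0, 0)%N (unpickle n) : nat * nat.
have upE (m : nat * nat) : up (pickle m) = m by rewrite /up pickleK.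
pose sub (m : nat) (f : nat -> nat) (i : nat) := f (pickle (m, i)).
exists (fun n f => K (up n).1 (up n).2 (sub (up n).1 f)); split.
- by move=> n f; have [+ _ _] := KP (up n).1; exact.
- move=> n f; have [_ /(_ (up n).2 (sub (up n).1 f))[N hN] _] := KP (up n).1.
  exists (\max_(i < N) (pickle ((up n).1, i : nat)).+1)%N => g gf.
  apply: hN => i iN; apply: gf.
  exact: (@leq_bigmax _ (fun i : 'I_N => (pickle ((up n).1, i : nat)).+1) (Ordinal iN)).
- apply/seteqP; split=> tw.
    move=> Etw.
    have /choice[f fP] : forall m, exists f, forall n, (K m n f).1 tw.1 /\ (K m n f).2 tw.2.
      by move=> m; have := Etw m Logic.I; have [_ _ ->] := KP m.
    exists (fun n => f (up n).1 (up n).2) => n.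
    rewrite (_ : sub _ _ = f (up n).1); first exact: fP.
    by apply/funext => i; rewrite /sub upE.
  move=> [f hf] m _; have [_ _ ->] := KP m; exists (sub m f) => n.
  by have := hf (pickle (m, n)); rewrite upE.
Qed.

Lemma souslin_rect_fst (A : set R) : measurable A ->
  souslin_rect (A `*` setT) /\ souslin_rect (~` A `*` setT).
Proof.
pose S := [set A : set R | souslin_rect (A `*` setT) /\ souslin_rect (~` A `*` setT)].
have S_sub : @measurable _ R `<=` S.
  rewrite -[X in X `<=` _]/(@measurable _ (measurableTypeR R)).
  rewrite RGenCInfty.measurableE; apply: smallest_sub; first split.
  - by split; apply: souslin_rectX => //; [exact: closed0|rewrite setC0; exact: closedT].
  - by move=> B [SB SBC]; rewrite setTD; split=> //; rewrite setCK.
  - move=> B SB; split.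
      rewrite (_ : _ `*` _ = \bigcup_n (B n `*` setT)).
        by apply: souslin_rect_bigcup => n; case: (SB n).
      apply/seteqP; split=> -[t w] /=; first by move=> [[n _ Bn] _]; exists n.
      by move=> [n _ [Bn _]]; split=> //; exists n.
    rewrite (_ : _ `*` _ = \bigcap_n (~` B n `*` setT)).
      by apply: souslin_rect_bigcap => n; case: (SB n).
    apply/seteqP; split=> -[t w] /=.
      by move=> [nB _] n _; split=> // Bn; apply: nB; exists n.
    by move=> h; split=> // -[n _ Bn]; have [] := h n Logic.I.
  - move=> _ [x ->]; split.
      by apply: souslin_rectX => //; exact: interval_closed.
    rewrite (_ : ~` _ `*` _ = \bigcup_n (`]-oo, x - n.+1%:R^-1] `*` setT)).
      by apply: souslin_rect_bigcup => n; apply: souslin_rectX => //; exact: interval_closed.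
    apply/seteqP; split=> -[t w] /=; rewrite in_itv/= andbT.
      move=> [/negP]; rewrite -ltNge => tx _.
      near \oo => n; exists n => //; split=> //=; rewrite in_itv/= lerBrDl -lerBrDr ltW//.
      near: n; apply: (near_infty_natSinv_lt (PosNum (_ : 0 < x - t))).
      by rewrite subr_gt0.
    move=> [n _ [/=]]; rewrite in_itv/= => h _; split=> //; apply/negP.
    by rewrite -ltNge (le_lt_trans h)// ltrBlDr ltrDl invr_gt0.
exact: S_sub.
Unshelve. all: by end_near. Qed.

(** The class is closed under countable unions and intersections but not under
complements, so the sets that belong to it together with their complements are
considered. *)
Lemma souslin_rect_measurable (E : set (R * g_sigma_algebraType G)) : measurable E ->
  souslin_rect E.
Proof.
pose S := [set E | souslin_rect E /\ souslin_rect (~` E)].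
suff S_sub : @measurable _ (R * g_sigma_algebraType G)%type `<=` S.
  by move=> /S_sub[].
apply: smallest_sub; first split.
- split.
    rewrite (_ : set0 = setT `*` set0 :> set (R * Omega)); last by rewrite setX0.
    by apply: souslin_rectX => //; exact: closedT.
  rewrite setC0 (_ : setT = setT `*` setT :> set (R * Omega)); last by rewrite setXTT.
  by apply: souslin_rectX => //; exact: closedT.
- by move=> B [SB SBC]; rewrite setTD; split=> //; rewrite setCK.
- move=> B SB; split.
    by apply: souslin_rect_bigcup => n; case: (SB n).
  by rewrite setC_bigcup; apply: souslin_rect_bigcap => n; case: (SB n).
- rewrite subUset; split=> _ [A mA <-].
    rewrite setTI (_ : _ @^-1` _ = A `*` setT); last first.
      by apply/seteqP; split=> -[t w]//= [].
    split; first by have [] := souslin_rect_fst mA.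
    rewrite (_ : ~` _ = ~` A `*` setT); first by have [] := souslin_rect_fst mA.
    by apply/seteqP; split=> -[t w]/= => [nA|[nA _ [//]]]; split=> // At; exact: nA.
  move: mA; rewrite measurable_g_measurableTypeE// => GA.
  rewrite setTI (_ : _ @^-1` _ = setT `*` A); last first.
    by apply/seteqP; split=> -[t w]//= [].
  split; first by apply: souslin_rectX => //; exact: closedT.
  rewrite (_ : ~` _ = setT `*` ~` A).
    by apply: souslin_rectX; [exact: closedT|exact: GC].
  by apply/seteqP; split=> -[t w]/= => [nA|[_ nA [//]]]; split=> // At; exact: nA.
Qed.

(** By compactness of [[a, b]], the closed time sections along a branch have a
common point there as soon as any finitely many of them do; that condition does
not depend on [w], and the projection is a Suslin operation on sets of [G]. *)
Lemma souslin_rect_proj_segment (E : set (R * Omega)) (a b : R) : souslin_rect E ->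
  G [set w | exists2 t, t \in `[a, b] & E (t, w)].
Proof.
move=> [K [cK KC ->]].
pose ne n f := exists2 t, t \in `[a, b] & forall i, (i <= n)%N -> (K i f).1 t.
pose K' n f := if `[< ne n f >] then (\bigcap_i (if (i <= n)%N then (K i f).2 else setT)) else set0.
rewrite (_ : [set w | _] = [set w | exists f, forall n, K' n f w]); last first.
  apply/seteqP; split=> w.
    move=> [t tab [f hf]]; exists f => n; rewrite /K' ifT.
      by move=> i _; case: ifP => // _; have [] := hf i.
    by apply/asboolP; exists t => // i _; have [] := hf i.
  move=> [f hf].
  have nef n : ne n f by have := hf n; rewrite /K'; case: asboolP.
  have hK n i : (i <= n)%N -> (K i f).2 w.
    move=> ni; have := hf n; rewrite /K'; case: asboolP => // _ /(_ i Logic.I).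
    by rewrite ni.
  have /choice[u uP] : forall n, exists t, t \in `[a, b] /\ forall i, (i <= n)%N -> (K i f).1 t.
    by move=> n; have [t ? ?] := nef n; exists t.
  have uab : (u @ \oo) [set` `[a, b]] by exists 0%N => // n _; have [] := uP n.
  have [t [tab clt]] := @segment_compact R a b (u @ \oo) _ uab.
  exists t => //; exists f => n; split; last exact: (hK n).
  have [cKn _] := cK n f.
  rewrite (closure_id (K n f).1).1// => B tB.
  have : (u @ \oo) (K n f).1.
    by exists n => // m /= nm; have [_] := uP m; exact.
  by move=> /clt/(_ tB)[z]; exists z.
apply: souslin_closed.
- move=> n f; rewrite /K'; case: asboolP => // _; apply: GI => i.
  by case: ifP => // _; have [] := cK i f.
- move=> n f; have /choice[N hN] := fun n => KC n f.
  exists (\max_(i < n.+1) N i)%N => g gf.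
  have KE i : (i <= n)%N -> K i g = K i f.
    move=> ni; apply: hN => j jN; apply: gf; apply: (leq_trans jN).
    exact: (@leq_bigmax _ (fun i : 'I_n.+1 => N i) (Ordinal (ni : (i < n.+1)%N))).
  rewrite /K' (_ : ne n g = ne n f); last first.
    apply/propext; split=> -[t tab h]; exists t => // i ni; have := h i ni; by rewrite KE.
  case: asboolP => // _; apply: eq_bigcapr => i _; case: ifP => // ni; by rewrite KE.
Qed.

(** The open interval is a countable union of segments. *)
Lemma measurable_projection (E : set (R * g_sigma_algebraType G)) (a b : R) : measurable E ->
  G [set w | exists2 t, a < t < b & E (t, w)].
Proof.
move=> mE.
rewrite (_ : [set w | _] = \bigcup_n
  [set w | exists2 t, t \in `[a + n.+1%:R^-1, b - n.+1%:R^-1] & E (t, w)]).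
  by apply: GU => n; apply: souslin_rect_proj_segment; exact: souslin_rect_measurable.
apply/seteqP; split=> w.
  move=> [t /andP[at_ tb] Etw].
  have ta0 : 0 < t - a by rewrite subr_gt0.
  have bt0 : 0 < b - t by rewrite subr_gt0.
  near \oo => n; exists n => //; exists t => //; rewrite in_itv/=; apply/andP; split.
    rewrite -lerBrDl ltW//; near: n; exact: (near_infty_natSinv_lt (PosNum ta0)).
  rewrite lerBrDl -lerBrDr ltW//; near: n; exact: (near_infty_natSinv_lt (PosNum bt0)).
move=> [n _ [t]]; rewrite in_itv/= => /andP[h1 h2] Etw; exists t => //.
have n0 : 0 < n.+1%:R^-1 :> R by rewrite invr_gt0.
by rewrite (lt_le_trans _ h1) ?ltrDl// (le_lt_trans h2)// ltrBlDr ltrDl.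
Unshelve. all: by end_near. Qed.

End souslin.

(** * Discretization of time *)

Section grid.
Context {R : realType}.

(** Times are rounded up to a multiple of [n.+1%:R^-1]: the approximation is from
the right, the side on which cadlag paths are continuous. *)
Definition grid_index (n : nat) (t : R) : nat := `|Num.ceil (t * n.+1%:R)|%N.
Definition grid (n : nat) (t : R) : R := (grid_index n t)%:R / n.+1%:R.

Lemma grid_indexE n k t : 0 <= t ->
  (grid_index n t == k) = ((k%:R - 1) / n.+1%:R < t <= k%:R / n.+1%:R).
Proof.
move=> t0; rewrite /grid_index; set x := t * n.+1%:R.
have x0 : 0 <= x by rewrite mulr_ge0.
have n0 : 0 < n.+1%:R :> R by [].
rewrite ltr_pdivrMr// ler_pdivlMr// -/x.
have c0 : (0 <= Num.ceil x) by rewrite ceil_ge0 (lt_le_trans _ x0)// ltrN10.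
apply/eqP/idP.
  move=> <-; rewrite -[_%:R]/((`|Num.ceil x|%N : int)%:~R) gez0_abs//.
  by have := ceil_itv x; rewrite intrB.
move=> h; apply/eqP; rewrite -eqz_nat gez0_abs//; apply/eqP.
by apply/ceil_def; rewrite intrB.
Qed.

Lemma grid_ge n t : 0 <= t -> t <= grid n t.
Proof. by move=> t0; have := eqxx (grid_index n t); rewrite grid_indexE// => /andP[]. Qed.

Lemma grid_lt n t : 0 <= t -> grid n t < t + n.+1%:R^-1.
Proof.
move=> t0; have := eqxx (grid_index n t); rewrite grid_indexE// => /andP[+ _].
by rewrite mulrBl mul1r ltrBlDr.
Qed.

Lemma cvg_grid (x : R -> R) t : 0 <= t -> x s @[s --> t^'+] --> x t ->
  x (grid n t) @[n --> \oo] --> x t.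
Proof.
move=> t0 /cvg_at_right_within xt.
apply: cvg_comp xt => A.
rewrite /within/= => /nbhs_ballP[e e0 eA].
near=> n; apply: eA; last exact: grid_ge.
rewrite /ball/= distrC ger0_norm ?subr_ge0 ?grid_ge//.
rewrite ltrBlDl (lt_trans (grid_lt _ t0))// ltrD2l.
by near: n; exact: (near_infty_natSinv_lt (PosNum e0)).
Unshelve. all: by end_near. Qed.

End grid.

Section joint_measurability.
Context {R : realType} d (T : measurableType d).

Lemma measurable_time_space : measurable (time_space : set (R * T)).
Proof.
rewrite (_ : time_space = `[0, +oo[ `*` setT); first exact: measurableX.
by apply/seteqP; split=> -[t w]; rewrite /time_space/= in_itv/= andbT// => -[].
Qed.

(** Between two consecutive grid times the discretized process is constant in
time; it converges to [X] by right-continuity. *)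
Lemma jointly_measurable (X : R -> T -> R) :
  (forall t, 0 <= t -> measurable_fun setT (X t)) ->
  (forall w t, 0 <= t -> X s w @[s --> t^'+] --> X t w) ->
  measurable_fun (time_space : set (R * T)) (fun tw => X tw.1 tw.2).
Proof.
move=> mX rX.
apply: (@measurable_fun_cvg _ _ _ _ (fun n tw => X (grid n tw.1) tw.2)); last first.
  by move=> -[t w] /= t0; exact: (cvg_grid (x := X ^~ w)) (rX w t t0).
move=> n mD B mB.
rewrite (_ : _ `&` _ = \bigcup_k ((`[0, +oo[ `&` `](k%:R - 1) / n.+1%:R, k%:R / n.+1%:R]) `*`
   (X (k%:R / n.+1%:R) @^-1` B))).
  apply: bigcup_measurable => k _; apply: measurableX.
    exact: measurableI.
  by rewrite -[X in measurable X]setTI; apply: mX => //; rewrite divr_ge0.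
apply/seteqP; split=> -[t w]; rewrite /time_space/=.
  move=> [t0 BX]; exists (grid_index n t) => //=; split=> //=.
  by rewrite !in_itv/= andbT t0 -grid_indexE.
move=> [k _ [[/=]]]; rewrite !in_itv/= andbT => t0.
by rewrite -grid_indexE// => /eqP <-.
Qed.

End joint_measurability.

(** * Optional sets and processes *)

Section cadlag.
Context {R : realType}.

Lemma cadlag_step (q c : R) : cadlag (fun t => if q <= t then c else 0).
Proof.
split=> t t0.
  have [qt|tq] := leP q t.
    apply: cvg_near_cst; near=> s; rewrite ifT// (le_trans qt)// ltW//.
  apply: cvg_near_cst; near=> s; rewrite ifF//; apply/negbTE; rewrite -ltNge.
  by near: s; exact: nbhs_right_lt.
have [qt|tq] := ltP q t.
  have h : (fun s => if q <= s then c else 0) s @[s --> t^'-] --> c.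
    apply: cvg_near_cst; near=> s; rewrite ifT//; apply: ltW.
    by near: s; exact: nbhs_left_gt.
  exact: cvgP h.
have h : (fun s => if q <= s then c else 0) s @[s --> t^'-] --> (0 : R).
  apply: cvg_near_cst; near=> s; rewrite ifF//; apply/negbTE.
  by rewrite -ltNge (lt_le_trans _ tq).
exact: cvgP h.
Unshelve. all: by end_near. Qed.

Lemma cadlag_cumulative (f : cumulative R R) : cadlag f.
Proof.
split=> t t0; first exact: (cumulative_is_right_continuous f).
apply: nondecreasing_at_left_is_cvgr.
  by apply: nearW => s x y _ _ xy; exact: (cumulative_is_nondecreasing f).
apply: nearW => s; exists (f t) => _ [y ys <-].
apply: (cumulative_is_nondecreasing f).
by move: ys; rewrite /= in_itv/= => /andP[_ /ltW].
Qed.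

End cadlag.

Section optional.
Context d (Omega : measurableType d) (R : realType) (P : probability Omega R).
Variable (F : R -> set (set Omega)).
Hypothesis hF : usual_filtration P F.
Implicit Types (E : set (R * Omega)) (X z : R -> Omega -> R).

Let D : set (R * Omega) := time_space.

(** A sigma-algebra on the whole product is what turns optional processes into
measurable functions on a type; [optional_set F] is one on [time_space] only. *)
Definition optional_trace : set (set (R * Omega)) :=
  [set E | optional_set F (time_space `&` E)].

Lemma sigma_algebra_optional : sigma_algebra D (optional_set F).
Proof. exact: smallest_sigma_algebra. Qed.

Lemma sigma_algebra_optional_trace : sigma_algebra setT optional_trace.
Proof.
have [mt0 mtC mtU] := sigma_algebra_optional; split.
- by rewrite /optional_trace/= setI0.
- move=> E OE; rewrite /optional_trace/= setTD.
  rewrite (_ : _ `&` _ = D `\` (D `&` E)); first exact: mtC.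
  by rewrite setDIr setDv set0U -setDE.
- by move=> E OE; rewrite /optional_trace/= setI_bigcupr; exact: mtU.
Qed.

Lemma optional_set_time E : optional_set F E -> D `&` E = E.
Proof.
have S_sub : optional_set F `<=` [set E | D `&` E = E].
  apply: smallest_sub; first split.
  - by rewrite /= setI0.
  - by move=> B /= _; rewrite setIDA setIid.
  - by move=> B SB; rewrite /= setI_bigcupr; apply: eq_bigcupr => n _; exact: SB.
  - by move=> _ [X [B [_ _ _ ->]]]; rewrite /= setIA setIid.
exact: S_sub.
Qed.

Lemma optional_traceE E : optional_set F E -> optional_trace E.
Proof. by move=> /[dup] OE /optional_set_time ED; rewrite /optional_trace/= ED. Qed.

Local Notation OT := (g_sigma_algebraType optional_trace).

Lemma measurable_OTE E : measurable (E : set OT) = optional_set F (D `&` E).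
Proof.
by rewrite measurable_g_measurableTypeE//; exact: sigma_algebra_optional_trace.
Qed.

Lemma optional_processP z :
  optional_process F z <-> measurable_fun setT (fun tw : OT => z tw.1 tw.2).
Proof.
split=> [oz _ B mB|mz B mB].
  by rewrite measurable_OTE setTI; exact: oz.
by have := mz measurableT B mB; rewrite measurable_OTE setTI.
Qed.

Lemma optional_cadlag X : adapted F X -> (forall w, cadlag (X ^~ w)) ->
  optional_process F X.
Proof. by move=> aX cX B mB; apply: sub_sigma_algebra; exists X, B. Qed.

Lemma filtrationT t : 0 <= t -> F t setT.
Proof. by move=> t0; have [? + _] := usual_sigma hF t0 => /(_ set0); rewrite setD0; exact. Qed.

Lemma measurable_filtrationE t (A : set (g_sigma_algebraType (F t))) : 0 <= t ->
  measurable A = F t A.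
Proof. by move=> t0; rewrite measurable_g_measurableTypeE//; exact: (usual_sigma hF). Qed.

Lemma measurable_forP t (Z : Omega -> R) : 0 <= t -> measurable_for (F t) Z <->
  measurable_fun setT (Z : g_sigma_algebraType (F t) -> R).
Proof.
move=> t0; split=> [mZ _ B mB|mZ B mB].
  by rewrite measurable_filtrationE// setTI; exact: mZ.
by have := mZ measurableT B mB; rewrite measurable_filtrationE// setTI.
Qed.

Lemma measurable_for_measurable t (Z : Omega -> R) : 0 <= t ->
  measurable_for (F t) Z -> measurable_fun setT Z.
Proof. by move=> t0 mZ _ B mB; rewrite setTI; apply: (usual_sub hF t0); exact: mZ. Qed.

Lemma measurable_for_le s t (Z : Omega -> R) : 0 <= s -> s <= t ->
  measurable_for (F s) Z -> measurable_for (F t) Z.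
Proof. by move=> s0 st mZ B mB; apply: (usual_nondecreasing hF s0 st); exact: mZ. Qed.

Lemma optional_step (q : R) (Z : Omega -> R) : 0 <= q -> measurable_for (F q) Z ->
  optional_process F (fun t w => if q <= t then Z w else 0).
Proof.
move=> q0 mZ; apply: optional_cadlag => [t t0|w]; last exact: cadlag_step.
case: (leP q t) => [qt|tq]; first exact: measurable_for_le mZ.
by apply/measurable_forP => //; exact: measurable_cst.
Qed.

Lemma optional_set_step (q : R) (B : set Omega) : 0 <= q -> F q B ->
  measurable ([set tw | q <= tw.1 /\ B tw.2] : set OT).
Proof.
move=> q0 FB.
have : optional_process F (fun t w => if q <= t then \1_B w else 0).
  apply: optional_step => //; apply/measurable_forP => //.
  by apply: measurable_indic; rewrite measurable_filtrationE.
move=> /optional_processP /(_ measurableT [set 1]) /(_ (measurable_set1 _)).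
congr measurable; rewrite setTI; apply/seteqP; split=> -[t w] /=.
  case: ifPn => [qt|_ /eqP]; last by rewrite (eq_sym 0) oner_eq0.
  rewrite indicE; case: (boolP (w \in B)) => [/set_mem//|_ /eqP].
  by rewrite (eq_sym 0) oner_eq0.
by move=> [-> Bw]; rewrite indicE mem_set.
Qed.

Lemma optional_set_gt (p : R) (B : set Omega) : 0 <= p -> F p B ->
  measurable ([set tw | p < tw.1 /\ B tw.2] : set OT).
Proof.
move=> p0 FB.
rewrite (_ : [set _ | _] = \bigcup_n [set tw | p + n.+1%:R^-1 <= tw.1 /\ B tw.2]).
  apply: bigcup_measurable => n _; apply: optional_set_step; first by rewrite addr_ge0.
  by apply: (usual_nondecreasing hF p0) => //; rewrite lerDl.
apply/seteqP; split=> -[t w] /=.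
  move=> [pt Bw]; have tp0 : 0 < t - p by rewrite subr_gt0.
  near \oo => n; exists n => //=; split=> //.
  by rewrite -lerBrDl ltW//; near: n; exact: (near_infty_natSinv_lt (PosNum tp0)).
by move=> [n _ /= [h Bw]]; split=> //; apply: lt_le_trans h; rewrite ltrDl.
Unshelve. all: by end_near. Qed.

(** For a generator given by a cadlag adapted [X], the process stopped at [s]
agrees with [X] up to [s] and is jointly measurable for [F s]. It is progressive
measurability that puts projections over [[0, s]] in [F s]. *)
Lemma optional_progressive E s : 0 <= s -> optional_set F E ->
  measurable ((`[0, s] `*` setT) `&` E : set (R * g_sigma_algebraType (F s))).
Proof.
move=> s0; set I : set (R * Omega) := _ `*` _.
have mI : measurable (I : set (R * g_sigma_algebraType (F s))) by exact: measurableX.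
have ID : I `<=` D by move=> -[t w] [/=]; rewrite in_itv/= => /andP[].
have S_sub : optional_set F `<=`
    [set E | measurable (I `&` E : set (R * g_sigma_algebraType (F s)))].
  apply: smallest_sub; first split.
  - by rewrite /= setI0.
  - move=> B /= mB; rewrite (_ : _ `&` _ = I `\` (I `&` B)); first exact: measurableD.
    by rewrite setIDA setDIr setDv set0U; congr (_ `\` _); apply/setIidl.
  - by move=> B SB; rewrite /= setI_bigcupr; apply: bigcup_measurable => n _; exact: SB.
  move=> _ [X [B [aX cX mB ->]]] /=.
  have mX : measurable_fun time_space
      (fun tw : R * g_sigma_algebraType (F s) => X (Num.min tw.1 s) tw.2).
    apply: (@jointly_measurable _ _ (g_sigma_algebraType (F s)) (fun t w => X (Num.min t s) w)).
      move=> t t0; apply/measurable_forP => //.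
      have ms0 : 0 <= Num.min t s by rewrite le_min t0.
      by apply: measurable_for_le (aX _ ms0) => //; rewrite ge_min lexx orbT.
    move=> w t t0; have [ts|st] := ltP t s.
      rewrite /=; apply: cvg_trans ((cX w).1 t t0).
      apply: near_eq_cvg; near=> u; congr (X _ w).
      by apply/esym/min_idPl; rewrite ltW//; near: u; exact: nbhs_right_lt.
    apply: cvg_near_cst; near=> u; congr (X _ w).
    by apply/min_idPr; rewrite (le_trans st)// ltW//; near: u; exact: nbhs_right_gt.
  have mts := @measurable_time_space R _ (g_sigma_algebraType (F s)).
  have := measurableI _ _ mI (mX mts _ mB); congr measurable.
  apply/seteqP; split=> -[t w] /=; rewrite /I/= in_itv/= => -[[/andP[t0 ts] _] [_ Bt]].
    split; first by rewrite t0 ts.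
    by split=> //; rewrite -(min_idPl ts).
  by split; [rewrite t0 ts|split=> //; rewrite (min_idPl ts)].
exact: S_sub.
Unshelve. all: by end_near. Qed.

Lemma optional_measurable E : optional_set F E -> measurable (E : set (R * Omega)).
Proof.
move=> OE; rewrite -(optional_set_time OE).
rewrite (_ : D `&` E = \bigcup_n ((`[0, n%:R] `*` setT) `&` E)).
  apply: bigcup_measurable => n _.
  have mE := optional_progressive (ler0n _ n) OE.
  have : preimage_set_system setT (@fst R (g_sigma_algebraType (F n%:R))) measurable `|`
      preimage_set_system setT (@snd R (g_sigma_algebraType (F n%:R))) measurable `<=`
      (@measurable _ (R * Omega)%type).
    rewrite subUset; split=> _ [A mA <-]; rewrite setTI.
      by rewrite -[X in measurable X]setTI; exact: (@measurable_fst _ _ R Omega).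
    rewrite measurable_filtrationE// in mA.
    rewrite -[X in measurable X]setTI; apply: (@measurable_snd _ _ R Omega) => //.
    exact: (usual_sub hF (ler0n _ n)).
  move=> /(smallest_sub (@sigma_algebra_measurable _ (R * Omega)%type)); exact.
rewrite -setI_bigcupl; congr (_ `&` _); apply/seteqP; split=> -[t w].
  move=> t0; exists (Num.truncn t).+1 => //; split=> //=; rewrite in_itv/= t0/=.
  by rewrite ltW// truncnS_gt.
by move=> [n _ [/=]]; rewrite in_itv/= => /andP[].
Qed.

Lemma measurable_at_time z (L : Omega -> \bar R) : measurable_fun setT L ->
  (forall w, (0 <= L w)%E) -> optional_process F z -> measurable_fun setT (at_time z L).
Proof.
move=> mL L0 oz _ B mB; rewrite setTI.
have mp : measurable_fun setT (fun w => (fine (L w), w)).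
  by apply: measurable_fun_pair => //; exact: measurableT_comp.
have := mp measurableT _ (optional_measurable (oz B mB)); congr measurable.
rewrite setTI; apply/seteqP; split=> w /=; rewrite /time_space/=; first by case.
by move=> Bw; split=> //; rewrite fine_ge0.
Qed.

End optional.

(** * Stieltjes measures of continuous distribution functions *)

(** The integral of a nonnegative function is a supremum over simple functions
below it, hence monotone without any measurability assumption. *)
Lemma ge0_le_integral_any d (T : measurableType d) (R : realType)
    (mu : {measure set T -> \bar R}) (f g : T -> \bar R) :
  (forall x, 0 <= f x)%E -> (forall x, f x <= g x)%E ->
  (\int[mu]_x f x <= \int[mu]_x g x)%E.
Proof.
move=> f0 fg; have g0 x : (0 <= g x)%E := le_trans (f0 x) (fg x).
rewrite !ge0_integralTE//; apply: ereal_sup_le => _ [h hf <-].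
by exists h => // x; exact: le_trans (fg x).
Qed.

Section stieltjes.
Context {R : realType} (f : cumulative R R).
Local Notation mu := (lebesgue_stieltjes_measure f).

Let nd : {homo f : x y / x <= y}.
Proof. by move=> x y; exact: cumulative_is_nondecreasing. Qed.

Lemma stieltjes_itvoc a b : a <= b -> mu `]a, b]%classic = (f b - f a)%:E.
Proof.
move=> ab; rewrite /lebesgue_stieltjes_measure /measure_extension measurable_mu_extE/=; last first.
  exact: is_ocitv.
by rewrite wlength_itv_bnd.
Qed.

(** Kept in [\bar R], as the limit may be infinite on a null set. *)
Definition total_mass : \bar R := lim ((f s)%:E @[s --> +oo]).

Lemma cvg_total_mass : (f s)%:E @[s --> +oo] --> total_mass.
Proof.
apply/cvg_ex; eexists; apply: nondecreasing_cvge => x y xy.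
by rewrite lee_fin nd.
Qed.

Lemma total_massE : total_mass = ereal_sup (range (EFin \o f)).
Proof.
apply/cvg_lim => //; apply: (@nondecreasing_cvge _ (EFin \o f)) => x y xy.
by rewrite lee_fin nd.
Qed.

Lemma total_mass_ge s : ((f s)%:E <= total_mass)%E.
Proof. by rewrite total_massE; apply: ereal_sup_ubound; exists s. Qed.

Lemma cvg_total_mass_nat : (f n%:R)%:E @[n --> \oo] --> total_mass.
Proof. by apply: cvg_comp cvg_total_mass; exact: cvgr_idn. Qed.

Lemma stieltjes_itvoy t : (mu `]t, +oo[%classic + (f t)%:E = total_mass)%E.
Proof.
have -> : `]t, +oo[%classic = \bigcup_n `]t, t + n%:R]%classic.
  apply/seteqP; split=> x /=; rewrite in_itv/= andbT.
    move=> tx; exists (Num.truncn (x - t)).+1 => //=; rewrite in_itv/= tx/=.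
    by rewrite -lerBlDl ltW// truncnS_gt.
  by move=> [n _ /=]; rewrite in_itv/= => /andP[].
have cv : mu `]t, t + n%:R]%classic @[n --> \oo] --> mu (\bigcup_n `]t, t + n%:R]%classic).
  apply: nondecreasing_cvg_mu.
  - by move=> n; exact: measurable_itv.
  - by apply: bigcupT_measurable => n; exact: measurable_itv.
  - move=> n m nm; apply/subsetPset => x /=; rewrite !in_itv/= => /andP[-> /le_trans]; apply.
    by rewrite lerD2l ler_nat.
have cv2 : (f (t + n%:R))%:E @[n --> \oo] --> total_mass.
  apply: cvg_comp cvg_total_mass => /=.
  apply/cvgryPge => r; near=> n; rewrite -lerBlDl.
  by near: n; move/cvgryPge: (@cvgr_idn R); exact.
apply/esym/(cvg_unique _ cv2) => //.
rewrite (_ : (fun n => _) = (fun n => mu `]t, (t + n%:R)%R]%classic + (f t)%:E)%E).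
  by apply: cvgeD => //; [rewrite fin_num_adde_defl|exact: cvg_cst].
by apply/funext => n; rewrite stieltjes_itvoc ?lerDl// -EFinD subrK.
Unshelve. all: by end_near. Qed.

(** Continuity, expressed by levels instead of times: a jump is an interval of
levels that the path skips, and rational levels are enough to detect it. The
clause [0 <= q] also excludes a jump at time 0, from the value 0 taken before. *)
Definition gapless := forall c e, 0 < c -> 0 < e -> (exists s, c <= f s) ->
  exists q, 0 <= q /\ c - e <= f q < c.

Hypothesis f_lt0 : forall t, t < 0 -> f t = 0.

Lemma cumulative_ge0 t : 0 <= f t.
Proof.
have [t0|t0] := ltP t 0; first by rewrite f_lt0.
by rewrite -(f_lt0 (ltrN10 R)) nd// (le_trans _ t0)// lerN10.
Qed.

Hypothesis fy : (total_mass < +oo)%E.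
Let a := fine total_mass.

Lemma total_mass_fin : total_mass = a%:E.
Proof.
rewrite /a fineK// ge0_fin_numE//.
by apply: le_trans (total_mass_ge 0); rewrite lee_fin cumulative_ge0.
Qed.

Lemma le_total_mass s : f s <= a.
Proof. by rewrite -lee_fin -total_mass_fin total_mass_ge. Qed.

Lemma stieltjes_itvoy_fin t : mu `]t, +oo[%classic = (a - f t)%:E.
Proof.
have := stieltjes_itvoy t; rewrite total_mass_fin EFinB => <-.
by rewrite addeK.
Qed.

Lemma approach_total_mass e : 0 < e -> exists2 q, 0 <= q & a - e < f q.
Proof.
move=> e0; have := cvg_total_mass_nat; rewrite total_mass_fin => /fine_cvgP[_].
move=> /cvgrPdist_lt/(_ e e0)[N _ /(_ N (leqnn _))] /= h.
exists N%:R => //; move: h; rewrite ger0_norm ?subr_ge0 ?le_total_mass// => h.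
by rewrite ltrBlDl -ltrBlDr.
Qed.

Hypothesis fg : gapless.

Lemma gapless0 : f 0 = 0.
Proof.
apply/eqP; rewrite eq_le cumulative_ge0 andbT leNgt; apply/negP => f0.
have [|q [q0]] := fg f0 f0; first by exists 0.
by rewrite ltNge (nd q0) andbF.
Qed.

Lemma stieltjes_itvcy : mu `[0, +oo[%classic = a%:E.
Proof.
apply/eqP; rewrite eq_le; apply/andP; split.
  have -> : a%:E = mu `]-1, +oo[%classic.
    by rewrite stieltjes_itvoy_fin f_lt0 ?subr0// ltrN10.
  apply: le_measure; rewrite ?inE; [exact: measurable_itv|exact: measurable_itv|].
  by move=> x /=; rewrite !in_itv/= !andbT; apply: lt_le_trans; exact: ltrN10.
have -> : a%:E = mu `]0, +oo[%classic.
  by rewrite stieltjes_itvoy_fin gapless0 subr0.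
apply: le_measure; rewrite ?inE; [exact: measurable_itv|exact: measurable_itv|].
by move=> x /=; rewrite !in_itv/= !andbT; exact: ltW.
Qed.

Lemma measurable_superlevel c : measurable [set s | c <= f s].
Proof.
have mf : measurable_fun setT f by apply: nondecreasing_measurable => //; exact: nd.
have := mf measurableT `[c, +oo[%classic (measurable_itv _).
rewrite setTI; congr measurable.
by apply/seteqP; split=> s /=; rewrite in_itv/= andbT.
Qed.

(** The image of the measure under [f] is Lebesgue measure on [[0, a]]: this is
where continuity of [f] matters. *)
Lemma stieltjes_superlevel c : 0 < c ->
  mu [set s | c <= f s] = (Num.max (a - c) 0)%:E.
Proof.
move=> c0; have mS := measurable_superlevel c.
have [[s cs]|nc] := pselect (exists s, c <= f s); last first.
  have ac : a <= c.
    apply/ler_addgt0Pr => e e0; have [q _ aq] := approach_total_mass e0.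
    have : ~ c <= f q by move=> cq; apply: nc; exists q.
    by move=> /negP; rewrite -ltNge => qc; rewrite ltW// -ltrBlDr (lt_trans aq).
  rewrite max_r ?subr_le0// (_ : [set _ | _] = set0) ?measure0//.
  by apply/seteqP; split=> // s cs; apply: nc; exists s.
have ca : c <= a := le_trans cs (le_total_mass s).
rewrite max_l ?subr_ge0//; apply/eqP; rewrite eq_le; apply/andP; split.
  apply/lee_addgt0Pr => e e0; have [|q [q0 /andP[cq qc]]] := fg c0 e0; first by exists s.
  rewrite -EFinD; apply: (@le_trans _ _ (mu `]q, +oo[%classic)).
    apply: le_measure; rewrite ?inE//.
    move=> x /= cx; rewrite in_itv/= andbT ltNge; apply/negP => /nd xq.
    by have := lt_le_trans qc (le_trans cx xq); rewrite ltxx.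
  by rewrite stieltjes_itvoy_fin lee_fin; lra.
apply/lee_subgt0Pr => e e0; rewrite -EFinB.
suff [q cq qc] : exists2 q, c <= f q & f q <= c + e.
  apply: (@le_trans _ _ (mu `]q, +oo[%classic)).
    by rewrite stieltjes_itvoy_fin lee_fin; lra.
  apply: le_measure; rewrite ?inE//.
  by move=> x /=; rewrite in_itv/= andbT => /ltW/nd; exact: le_trans.
have [se|se] := leP (f s) (c + e); first by exists s.
have [|||q [q0 /andP[h1 h2]]] := fg (c := c + e) (e := e) => //; first by rewrite addr_gt0.
  by exists s; exact: ltW.
by exists q; [move: h1; rewrite addrK|exact: ltW].
Qed.

End stieltjes.

(** * The duality between dA and L *)

Section dual_projection.
Context d (Omega : measurableType d) (R : realType) (P : probability Omega R).
Variables (F : R -> set (set Omega)) (L : Omega -> \bar R) (A : Omega -> cumulative R R).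
Hypotheses (hF : usual_filtration P F) (hL : honest_time P F L)
  (hdual : dual_optional_projection P F L A).

Local Notation OT := (g_sigma_algebraType (optional_trace F)).
Local Notation mu w := (lebesgue_stieltjes_measure (A w)).

Lemma honest_ge0 w : (0 <= L w)%E.
Proof.
have [Gamma _ ->] := honest_end hL; apply: ereal_sup_ubound; by left.
Qed.

Lemma optional_dual : optional_process F (fun t w => A w t).
Proof.
apply: optional_cadlag; first exact: (dual_adapted hdual).
by move=> w; exact: cadlag_cumulative.
Qed.

Lemma measurable_dual t : 0 <= t -> measurable_fun setT (fun w => A w t).
Proof.
by move=> t0; exact: (measurable_for_measurable hF t0 (dual_adapted hdual t0)).
Qed.

Lemma measurable_dual_at : measurable_fun setT (at_time (fun t w => A w t) L).
Proof.
exact: (measurable_at_time hF (honest_measurable hL) honest_ge0 optional_dual).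
Qed.

Lemma measurable_total_mass : measurable_fun setT (fun w => total_mass (A w)).
Proof.
apply: (@emeasurable_fun_cvg _ _ _ _ (fun n w => (A w n%:R)%:E)).
  by move=> n; apply/measurable_EFinP; exact: measurable_dual.
by move=> w _; exact: cvg_total_mass_nat.
Qed.

(** The duality formula for the indicator of [E]. Nothing is known of [E] at
negative times, hence the clause [0 <= t]. *)
Lemma dual_set (E : set (R * Omega)) : measurable (E : set OT) ->
  (\int[P]_w mu w [set t | (0 <= t)%R /\ E (t, w)])%E =
  P [set w | E (fine (L w), w)].
Proof.
move=> mE.
have oE : optional_process F (fun t w => \1_E (t, w)).
  apply/optional_processP; apply: (eq_measurable_fun (\1_E : OT -> R)).
    by move=> [t w].
  exact: measurable_indic.
have bE : exists K : R, forall t w, 0 <= t -> `|(\1_E (t, w) : R)| <= K.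
  by exists 1 => t w _; rewrite indicE; case: (_ \in _); rewrite ?normr1 ?normr0.
have := dual_integral hdual oE bE.
have mE' : measurable (time_space `&` E : set (R * Omega)).
  by apply: (optional_measurable hF); rewrite -measurable_OTE.
set I := (X in X = _ -> _); set J := (X in _ = X -> _) => IJ.
transitivity I.
  apply: eq_integral => w _.
  rewrite (_ : (fun x => _) = (fun t => (\1_(ysection E w) t)%:E)); last first.
    by apply/funext => t; rewrite !indicE mem_ysection.
  have mY : measurable (ysection (time_space `&` E) w) by exact: measurable_ysection.
  under eq_integral => t t0.
    rewrite (_ : (\1_(ysection E w) t) = \1_(ysection (time_space `&` E) w) t); last first.
      rewrite !indicE !mem_ysection in_setI (_ : (t, w) \in time_space)//.
      by move: t0; rewrite !inE /time_space /= in_itv/= andbT.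
    over.
  rewrite integral_indic//; congr (mu w _).
  apply/seteqP; split=> t /=.
    by move=> [t0 Et]; split; [apply/ysectionP|rewrite in_itv/= t0].
  by move=> [/ysectionP[_ Et]]; rewrite in_itv/= andbT.
rewrite IJ /J unlock /at_time.
have : measurable_fun setT (at_time (fun t w => \1_E (t, w) : R) L).
  exact: (measurable_at_time hF (honest_measurable hL) honest_ge0 oE).
move=> /(_ measurableT [set 1] (measurable_set1 _)); rewrite setTI.
rewrite (_ : _ @^-1` _ = [set w | E (fine (L w), w)]); last first.
  apply/seteqP; split=> w /=; rewrite /at_time indicE; last by move=> /mem_set ->.
  by case: (boolP (_ \in _)) => [/set_mem//|_ /eqP]; rewrite eq_sym oner_eq0.
move=> mS; rewrite -[X in _ = P X]setIT -integral_indic//.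
Qed.

Lemma measurable_at_set (E : set (R * Omega)) : measurable (E : set OT) ->
  measurable [set w | E (fine (L w), w)].
Proof.
move=> mE.
have mE' : measurable (time_space `&` E : set (R * Omega)).
  by apply: (optional_measurable hF); rewrite -measurable_OTE.
have mp : measurable_fun setT (fun w => (fine (L w), w)).
  apply: measurable_fun_pair => //; apply: measurableT_comp => //.
  exact: (honest_measurable hL).
have := mp measurableT _ mE'; rewrite setTI; congr measurable.
apply/seteqP; split=> w /=; first by case.
by move=> Ew; split=> //; rewrite /time_space/= fine_ge0// honest_ge0.
Qed.

Lemma measurable_stieltjes_itvoy (t : Omega -> R) :
  measurable_fun setT (fun w => A w (t w)) ->
  measurable_fun setT (fun w => mu w `]t w, +oo[%classic).
Proof.
move=> mt; rewrite (_ : (fun w => _) = (fun w => total_mass (A w) - (A w (t w))%:E)%E).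
  by apply: emeasurable_funB; [exact: measurable_total_mass|exact/measurable_EFinP].
by apply/funext => w; rewrite -(stieltjes_itvoy _ (t w)) addeK.
Qed.

(** The expected mass of [dA] is [P setT = 1]. *)
Lemma total_mass_lty : \forall w \ae P, (total_mass (A w) < +oo)%E.
Proof.
have mI : measurable_fun setT (fun w => mu w `]0%R, +oo[%classic).
  by apply: measurable_stieltjes_itvoy; exact: measurable_dual.
have iI : P.-integrable setT (fun w => mu w `]0%R, +oo[%classic).
  apply/integrableP; split=> //.
  under eq_integral do rewrite gee0_abs//.
  apply: (@le_lt_trans _ _ 1%E); last by rewrite ltry.
  have := dual_set (@measurableT _ OT); rewrite -[X in P X]/setT probability_setT => <-.
  apply: ge0_le_integral_any => // w; apply: le_measure; rewrite ?inE//.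
    rewrite (_ : [set _ | _] = `[0, +oo[%classic)//.
    by apply/seteqP; split=> t /=; rewrite in_itv/= andbT// => -[].
  by move=> t /=; rewrite in_itv/= andbT => /ltW.
have := integrable_ae measurableT iI; apply: filterS => w /(_ Logic.I).
by rewrite ge0_fin_numE// => fin; rewrite -(stieltjes_itvoy _ 0) lte_add_pinfty// ltry.
Qed.

End dual_projection.

(** * A stops growing at L *)

Section honest_support.
Context d (Omega : measurableType d) (R : realType) (P : probability Omega R).
Variables (F : R -> set (set Omega)) (L : Omega -> \bar R) (A : Omega -> cumulative R R).
Hypotheses (hF : usual_filtration P F) (hL : honest_time P F L)
  (hdual : dual_optional_projection P F L A).

Local Notation OT := (g_sigma_algebraType (optional_trace F)).
Local Notation mu w := (lebesgue_stieltjes_measure (A w)).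

Lemma honest_proj_measurable (Gamma : set (R * Omega)) p q :
  optional_set F Gamma -> 0 <= p -> p < q ->
  F q [set w | exists2 t, p < t < q & Gamma (t, w)].
Proof.
move=> OG p0 pq; have q0 : 0 <= q by rewrite (le_trans p0)// ltW.
have := measurable_projection (usual_sigma hF q0) (usual_sub hF q0) _ p q
  (optional_progressive hF q0 OG).
rewrite (_ : [set w | exists2 t, p < t < q & _] =
   [set w | exists2 t, p < t < q & ((`[0, q] `*` setT) `&` Gamma) (t, w)]); last first.
  apply/seteqP; split=> w [t /andP[pt tq]]; last by move=> [_ ?]; exists t => //; rewrite pt.
  move=> Gt; exists t; [by rewrite pt|split=> //; split=> //=].
  by rewrite in_itv/= (le_trans p0 (ltW pt)) ltW.
apply=> N /(usual_null hF) F0N.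
exact: (usual_nondecreasing hF _ q0).
Qed.

(** The times that neither belong to [Gamma] nor are limits from the left of
points of [Gamma]. Rational [q] with [ratr q <= s] reduce the condition at [s]
to countably many events that are known by time [s]. *)
Definition left_isolated (Gamma : set (R * Omega)) : set (R * Omega) :=
  [set sw | ~ Gamma sw /\ exists p : rat, [/\ 0 <= ratr p :> R, ratr p < sw.1 &
     ~ exists q : rat, [/\ ratr p < ratr q :> R, ratr q <= sw.1 &
         exists2 t, ratr p < t < ratr q & Gamma (t, sw.2)]]].

Lemma optional_left_isolated Gamma : optional_set F Gamma ->
  measurable (left_isolated Gamma : set OT).
Proof.
move=> OG; rewrite (_ : left_isolated Gamma = ~` Gamma `&` \bigcup_(p : rat)
   (if 0 <= ratr p :> R then [set sw | ratr p < sw.1 /\ setT sw.2] `\`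
      \bigcup_(q : rat) (if ratr p < ratr q :> R then
        [set sw | ratr q <= sw.1 /\ [set w | exists2 t, ratr p < t < ratr q & Gamma (t, w)] sw.2]
        else set0) else set0)).
  apply: measurableI.
    apply: measurableC; rewrite measurable_g_measurableTypeE.
      exact: optional_traceE.
    exact: sigma_algebra_optional_trace.
  apply: bigcupT_measurable_rat => p; case: ifP => // p0.
  apply: measurableD; first by apply: (optional_set_gt hF) => //; exact: (filtrationT hF).
  apply: bigcupT_measurable_rat => q; case: ifP => // pq.
  apply: (optional_set_step hF); first by rewrite (le_trans p0)// ltW.
  exact: honest_proj_measurable.
apply/seteqP; split=> -[s w] /=.
  move=> [nG [p [p0 ps np]]]; split=> //; exists p => //; rewrite p0; split=> //.
  by move=> [q _]; case: ifP => // pq [/= qs ex]; apply: np; exists q.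
move=> [nG [p _]]; case: ifP => // p0 [[/= ps _] nq]; split=> //.
exists p; split=> // -[q [pq qs ex]]; apply: nq; exists q => //.
by rewrite pq.
Qed.

Lemma left_isolated_after Gamma w s :
  end_of Gamma L -> (L w < s%:E)%E -> left_isolated Gamma (s, w).
Proof.
move=> endG Ls.
have GL t : Gamma (t, w) -> (t%:E <= L w)%E.
  by move=> Gt; rewrite endG; apply: ereal_sup_ubound; right; exists t.
have L0 := honest_ge0 hL w.
have Lfin : L w \is a fin_num by rewrite ge0_fin_numE// (lt_trans Ls)// ltry.
split=> [/GL|]; first by rewrite leNgt Ls.
have : fine (L w) < s by rewrite -lte_fin fineK.
move=> /rat_in_itvoo[p]; rewrite in_itv/= => /andP[Lp ps].
have Lp' : (L w < (ratr p)%:E)%E by rewrite -(fineK Lfin) lte_fin.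
exists p; split=> //; first by rewrite (le_trans _ (ltW Lp))// fine_ge0.
move=> [q [_ _ [t /andP[pt _] /GL]]]; rewrite leNgt => /negP; apply.
by rewrite (lt_trans Lp')// lte_fin.
Qed.

(** The supremum [L w] either belongs to the section of [Gamma] or is approached
by it from the left. *)
Lemma left_isolated_at Gamma w : end_of Gamma L -> (0 < L w < +oo)%E ->
  ~ left_isolated Gamma (fine (L w), w).
Proof.
move=> endG /andP[L0 Loo].
have Lfin : L w \is a fin_num by rewrite ge0_fin_numE// ltW.
move=> [nG [p [p0 /= pL nq]]]; apply: nq.
have : ((ratr p)%:E < L w)%E by rewrite -(fineK Lfin) lte_fin.
rewrite endG => /ereal_sup_gt[_ [->|[t Gt <-]]]; rewrite -?endG lte_fin => pt.
  by move: (le_lt_trans p0 pt); rewrite ltxx.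
have tL : t < fine (L w).
  rewrite lt_neqAle; apply/andP; split; first by apply/negP => /eqP tL; apply: nG; rewrite -tL.
  rewrite -lee_fin fineK// [X in (_ <= X)%E]endG.
  by apply: ereal_sup_ubound; right; exists t.
have /rat_in_itvoo[q] := tL; rewrite in_itv/= => /andP[tq qL].
by exists q; split; [exact: lt_trans tq|exact: ltW|exists t => //; rewrite pt].
Qed.

(** [L] avoids the left-isolated times, hence [dA] does not charge them; all times
after [L] are among them. *)
Lemma total_mass_honest : \forall w \ae P,
  total_mass (A w) = (A w (fine (L w)))%:E.
Proof.
have [Gamma OG endG] := honest_end hL.
have mE := optional_left_isolated OG.
have mL0 : measurable [set w | L w = 0%E].
  have := measurable_eqe measurableT (honest_measurable hL) (@measurable_cst _ _ _ _ setT 0%E).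
  by rewrite setTI.
have mLy : measurable [set w | L w = +oo%E].
  have := measurable_eqe measurableT (honest_measurable hL) (@measurable_cst _ _ _ _ setT +oo%E).
  by rewrite setTI.
have I0 : (\int[P]_w mu w [set t | (0 <= t)%R /\ left_isolated Gamma (t, w)] = 0)%E.
  rewrite (dual_set hF hL hdual mE).
  apply/eqP; rewrite eq_le measure_ge0 andbT.
  rewrite -[leRHS](_ : P ([set w | L w = 0%E] `|` [set w | L w = +oo%E]) = 0%E).
    apply: le_measure; rewrite ?inE; [exact: (measurable_at_set hF hL)|exact: measurableU|].
    move=> w /= Ew; apply: contrapT => /not_orP[L0 Loo].
    apply: (left_isolated_at endG _ Ew).
    rewrite lt_neqAle eq_sym (honest_ge0 hL) andbT lt_neqAle leey andbT.
    by apply/andP; split; apply/eqP.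
  by rewrite (measureU0 mL0 mLy (honest_neqy hL)); exact: (honest_neq0 hL).
have mI : measurable_fun setT (fun w => mu w `]fine (L w), +oo[%classic).
  by apply: (measurable_stieltjes_itvoy hF hdual); exact: (measurable_dual_at hF hL hdual).
have I1 : (\int[P]_w `|mu w `]fine (L w), +oo[%classic| = 0)%E.
  apply/eqP; rewrite eq_le integral_ge0// andbT -I0.
  under eq_integral do rewrite gee0_abs//.
  have L0 w := honest_ge0 hL w.
  have Ltop : \forall w \ae P, L w != +oo%E.
    exists [set w | L w = +oo%E]; split=> //; first exact: (honest_neqy hL).
    by move=> w /= /negP/negPn/eqP.
  rewrite [leLHS](_ : _ =
      \int[P]_w (if L w == +oo%E then 0 else mu w `]fine (L w), +oo[%classic))%E.
    apply: ge0_le_integral_any => [w|w]; first by case: ifP.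
    case: ifPn => // Loo; apply: le_measure; rewrite ?inE//.
      have := measurable_ysection w (optional_measurable hF
        (eq_ind _ id mE _ (measurable_OTE _ _))).
      congr measurable; apply/seteqP; split=> t.
        by move=> /ysectionP[].
      by move=> [t0 Et]; apply/ysectionP.
    have Lfin : L w \is a fin_num by rewrite ge0_fin_numE// lt_neqAle Loo leey.
    move=> t /=; rewrite in_itv/= andbT => Lt.
    split; first by rewrite (le_trans _ (ltW Lt))// fine_ge0.
    by apply: left_isolated_after => //; rewrite -(fineK Lfin) lte_fin.
  apply: ge0_ae_eq_integral => //.
  - apply: measurable_fun_ifT => //.
    apply: (measurable_fun_bool true); rewrite setTI.
    rewrite (_ : _ @^-1` _ = [set w | L w = +oo%E])//.
    by apply/seteqP; split=> w /= /eqP.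
  - by move=> w _; case: ifP.
  - by apply: filterS Ltop => w /= /negbTE ->.
have /(ae_eq_integral_abs _ measurableT mI) := I1.
apply: filterS => w /(_ Logic.I)/= h.
by rewrite -(stieltjes_itvoy _ (fine (L w))) h add0e.
Qed.

End honest_support.

(** * A has no jumps *)

Section avoids_stopping_times.
Context d (Omega : measurableType d) (R : realType) (P : probability Omega R).
Variables (F : R -> set (set Omega)) (L : Omega -> \bar R) (A : Omega -> cumulative R R).
Hypotheses (hF : usual_filtration P F) (hL : honest_time P F L) (hA : condition_A P F L)
  (hdual : dual_optional_projection P F L A).

Local Notation OT := (g_sigma_algebraType (optional_trace F)).
Local Notation mu w := (lebesgue_stieltjes_measure (A w)).

Definition passage (a : R) (w : Omega) : \bar R :=
  ereal_inf [set t%:E | t in [set t | 0 <= t /\ a <= A w t]].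

Lemma passage_le a w t : 0 <= t -> ((passage a w <= t%:E)%E <-> a <= A w t).
Proof.
move=> t0; split=> [Tt|aA]; last first.
  by apply: ereal_inf_lbound; exists t.
have aAu u : t < u -> a <= A w u.
  move=> tu; have : (passage a w < u%:E)%E by rewrite (le_lt_trans Tt)// lte_fin.
  move=> /ereal_inf_lt[_ [s [s0 aAs] <-]]; rewrite lte_fin => su.
  by rewrite (le_trans aAs)// (cumulative_is_nondecreasing (A w))// ltW.
apply: (cvgr_to_ge (cumulative_is_right_continuous (A w) t)).
by near=> u; apply: aAu; near: u; exact: nbhs_right_gt.
Unshelve. all: by end_near. Qed.

Lemma passage_ge0 a w : (0 <= passage a w)%E.
Proof. by apply: le_ereal_inf_tmp => _ [t [t0 _] <-]; rewrite lee_fin. Qed.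

Lemma stopping_time_passage a : stopping_time F (passage a).
Proof.
split=> [w|t t0]; first exact: passage_ge0.
rewrite (_ : [set w | _] = (fun w => A w t) @^-1` `[a, +oo[%classic).
  by apply: (dual_adapted hdual t0); exact: measurable_itv.
apply/seteqP; split=> w /=; rewrite in_itv/= andbT; first by move/(passage_le a w t0).
by move=> ?; apply/(passage_le a w t0).
Qed.

Lemma measurable_stopping_time (T : Omega -> \bar R) : stopping_time F T -> measurable_fun setT T.
Proof.
move=> [T0 FT]; apply: (measurability (@ErealGenOInfty.G R)).
  exact: ErealGenOInfty.measurableE.
move=> _ [_ [r ->] <-]; rewrite setTI.
have [r0|r0] := leP 0 r.
  rewrite (_ : _ @^-1` _ = ~` [set w | (T w <= r%:E)%E]).
    by apply: measurableC; apply: (usual_sub hF r0); exact: FT.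
  by apply/seteqP; split=> w /=; rewrite in_itv/= andbT ltNge => /negP.
rewrite (_ : _ @^-1` _ = setT)//; apply/seteqP; split=> // w _ /=.
by rewrite in_itv/= andbT (lt_le_trans _ (T0 w))// lte_fin.
Qed.

(** The graph of [passage a] (see [passage_graphE]), described with rational times
so that it is a countable combination of optional sets. *)
Definition passage_graph (a : R) : set (R * Omega) :=
  [set tw | a <= A tw.2 tw.1 /\
    forall q : rat, 0 <= ratr q :> R -> ratr q < tw.1 -> A tw.2 (ratr q) < a].

Lemma optional_passage_graph a : measurable (passage_graph a : set OT).
Proof.
rewrite (_ : passage_graph a = [set tw | a <= A tw.2 tw.1] `\`
   \bigcup_(q : rat) (if 0 <= ratr q :> R then
     [set tw | ratr q < tw.1 /\ [set w | a <= A w (ratr q)] tw.2] else set0)).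
  apply: measurableD.
    have /optional_processP := optional_dual hdual.
    move=> /(_ measurableT `[a, +oo[%classic (measurable_itv _)); rewrite setTI; congr measurable.
    by apply/seteqP; split=> tw /=; rewrite in_itv/= andbT.
  apply: bigcupT_measurable_rat => q; case: ifP => // q0.
  apply: (optional_set_gt hF) => //.
  have := dual_adapted hdual q0 (measurable_itv `[a, +oo[); congr (F _ _).
  by apply/seteqP; split=> tw /=; rewrite in_itv/= andbT.
apply/seteqP; split=> -[t w] /= [aA h]; split=> //.
  by move=> [q _]; case: ifP => // q0 [/= qt]; rewrite leNgt h.
by move=> q q0 qt; rewrite ltNge; apply/negP => aq; apply: h; exists q => //; rewrite q0.
Qed.

Lemma passage_graphE a t w : 0 <= t -> passage_graph a (t, w) -> passage a w = t%:E.
Proof.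
move=> t0 [/= aA h]; apply/eqP; rewrite eq_le; apply/andP; split.
  by apply/(passage_le a w t0).
apply: le_ereal_inf_tmp => _ [s [s0 aAs] <-]; rewrite lee_fin leNgt; apply/negP.
move=> /rat_in_itvoo[q]; rewrite in_itv/= => /andP[sq qt].
have := h q (le_trans s0 (ltW sq)) qt; rewrite ltNge => /negP; apply.
by rewrite (le_trans aAs)// (cumulative_is_nondecreasing (A w))// ltW.
Qed.

(** If [A] skips the levels between [a] and [b], it passes both at the same time
[T], and the atom of [dA] at [T] is the jump there. *)
Lemma jump_mass a b w : 0 < a -> a < b -> (exists s, b <= A w s) ->
  (forall q : rat, 0 <= ratr q :> R -> A w (ratr q) < a \/ b <= A w (ratr q)) ->
  ((b - a)%:E <= mu w [set t | (0 <= t)%R /\ passage_graph a (t, w)])%E.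
Proof.
move=> a0 ab [s bs] gap.
have nd : {homo A w : x y / x <= y} := fun x y => @cumulative_is_nondecreasing _ _ _ (A w) x y.
have b0 : 0 < b := lt_trans a0 ab.
have pos u : b <= A w u -> 0 <= u.
  move=> bu; rewrite leNgt; apply/negP => u0.
  by move: (lt_le_trans b0 bu); rewrite (dual_lt0 hdual)// ltxx.
have pfin : passage b w \is a fin_num.
  rewrite ge0_fin_numE ?passage_ge0//.
  by apply: (@le_lt_trans _ _ s%:E); [apply/(passage_le b w (pos _ bs))|rewrite ltry].
set T := fine (passage b w).
have T0 : 0 <= T by rewrite fine_ge0// passage_ge0.
have bT : b <= A w T by apply/(passage_le b w T0); rewrite /T fineK.
have bq q : 0 <= q -> q < T -> A w q < b.
  move=> q0 qT; rewrite ltNge; apply/negP => /(passage_le b w q0).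
  by rewrite -(fineK pfin) lee_fin -/T leNgt qT.
have aq x : x < T -> A w x < a.
  move=> /rat_in_itvoo[q]; rewrite in_itv/= => /andP[xq qT].
  apply: (@le_lt_trans _ _ (A w (ratr q))); first by rewrite nd// ltW.
  have [q0|q0] := leP 0 (ratr q : R); last by rewrite (dual_lt0 hdual).
  by have [//|] := gap q q0; rewrite leNgt bq.
have -> : [set t | (0 <= t)%R /\ passage_graph a (t, w)] = [set T].
  apply/seteqP; split=> t /=.
    move=> [t0 [/= aAt h]]; apply/eqP; rewrite eq_le; apply/andP; split; rewrite leNgt; apply/negP.
      move=> /rat_in_itvoo[q]; rewrite in_itv/= => /andP[Tq qt].
      have := h q (le_trans T0 (ltW Tq)) qt; rewrite ltNge => /negP; apply.
      by rewrite (le_trans (ltW ab))// (le_trans bT)// nd// ltW.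
    by move=> /aq; rewrite ltNge aAt.
  move=> ->; split=> //; split=> /=; first by rewrite (le_trans (ltW ab)).
  by move=> q _ /aq.
have -> : [set T] = \bigcap_n `]T - n.+1%:R^-1, T]%classic.
  apply/seteqP; split=> x /=.
    by move=> -> n _ /=; rewrite in_itv/= lexx andbT ltrBlDr ltrDl.
  move=> h; have := h 0%N Logic.I; rewrite /= in_itv/= => /andP[_ xT].
  apply/eqP; rewrite eq_le xT/= leNgt; apply/negP => xT'.
  have e0 : 0 < T - x by rewrite subr_gt0.
  have [N _ hN] := near_infty_natSinv_lt (PosNum e0).
  have := h N Logic.I; rewrite /= in_itv/= => /andP[h1 _].
  have := hN N (leqnn _) => /=; move: h1; set v := N.+1%:R^-1; lra.
have mB n : mu w `]T - n.+1%:R^-1, T]%classic = (A w T - A w (T - n.+1%:R^-1))%:E.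
  by rewrite stieltjes_itvoc// lerBlDr lerDl.
have cv : (mu w \o (fun n => `]T - n.+1%:R^-1, T]%classic)) @ \oo -->
    mu w (\bigcap_n `]T - n.+1%:R^-1, T]%classic).
  apply: nonincreasing_cvg_mu.
  - by rewrite [X in (X < _)%E](mB 0%N) ltry.
  - by move=> n; exact: measurable_itv.
  - by apply: bigcapT_measurable => n; exact: measurable_itv.
  - move=> n m nm; apply/subsetPset => x /=; rewrite !in_itv/= => /andP[h ->]; rewrite andbT.
    apply: le_lt_trans h; rewrite lerB// lef_pV2 ?posrE// ler_nat//.
apply: (cvge_to_ge cv); apply: nearW => n /=; rewrite mB lee_fin.
have := aq (T - n.+1%:R^-1); rewrite ltrBlDr ltrDl => /(_ (ltac:(by rewrite invr_gt0))).
lra.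
Qed.

(** A skipped interval of levels would make the expected mass of the graph of a
passage time positive. By duality that mass is the probability that [L] equals
this stopping time, which is zero by condition (A). *)
Lemma dual_gapless : \forall w \ae P, gapless (A w).
Proof.
have key (a b : R) : 0 < a -> a < b ->
   \forall w \ae P, ~ ((exists n : nat, b <= A w n%:R) /\
     forall q : rat, 0 <= ratr q :> R -> A w (ratr q) < a \/ b <= A w (ratr q)).
  move=> a0 ab; set E := [set w | (exists n : nat, b <= A w n%:R) /\
     forall q : rat, 0 <= ratr q :> R -> A w (ratr q) < a \/ b <= A w (ratr q)].
  have mle c t : 0 <= t -> measurable [set w | c <= A w t].
    move=> t0; have := measurable_dual hF hdual t0 measurableT (measurable_itv `[c, +oo[).
    rewrite setTI; congr measurable.
    by apply/seteqP; split=> w /=; rewrite in_itv/= andbT.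
  have mE : measurable E.
    rewrite (_ : E = (\bigcup_n [set w | b <= A w n%:R]) `\`
       \bigcup_(q : rat) (if 0 <= ratr q :> R then
         [set w | a <= A w (ratr q)] `\` [set w | b <= A w (ratr q)] else set0)).
      apply: measurableD; first by apply: bigcupT_measurable => n; exact: mle.
      apply: bigcupT_measurable_rat => q; case: ifP => // q0.
      by apply: measurableD; exact: mle.
    apply/seteqP; split=> w /=.
      move=> [[n bn] h]; split; first by exists n.
      move=> [q _]; case: ifP => // q0 [/= aq]; apply; have [|//] := h q q0.
      by rewrite ltNge aq.
    move=> [[n _ bn] h]; split; first by exists n.
    move=> q q0; have [|aq] := ltP (A w (ratr q)) a; first by left.
    right; apply: contrapT => nb; apply: h; exists q => //; rewrite q0.
    by split.
  have PE : P E = 0%E.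
    have mLT : measurable [set w | L w = passage a w].
      have := measurable_eqe measurableT (honest_measurable hL)
        (measurable_stopping_time (stopping_time_passage a)).
      by rewrite setTI.
    have mLy : measurable [set w | L w = +oo%E].
      have := measurable_eqe measurableT (honest_measurable hL) (@measurable_cst _ _ _ _ setT +oo%E).
      by rewrite setTI.
    have I0 : (\int[P]_w mu w [set t | (0 <= t)%R /\ passage_graph a (t, w)] = 0)%E.
      rewrite (dual_set hF hL hdual (optional_passage_graph a)).
      apply/eqP; rewrite eq_le measure_ge0 andbT.
      rewrite -[leRHS](_ : P ([set w | L w = passage a w] `|` [set w | L w = +oo%E]) = 0%E).
        apply: le_measure; rewrite ?inE; [|exact: measurableU|].
          by apply: (measurable_at_set hF hL); exact: optional_passage_graph.
        move=> w /= Gw; have [Ly|Ly] := eqVneq (L w) +oo%E; first by right.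
        have Lfin : L w \is a fin_num by rewrite ge0_fin_numE ?(honest_ge0 hL)// lt_neqAle Ly leey.
        left; rewrite (passage_graphE _ Gw) ?fine_ge0 ?(honest_ge0 hL)//.
        by rewrite fineK.
      rewrite (measureU0 mLT mLy (honest_neqy hL)); exact: hA (stopping_time_passage a).
    have ba : 0 < b - a by rewrite subr_gt0.
    have : ((b - a)%:E * P E <= 0)%E.
      rewrite -I0 -[X in P X]setIT -integral_indic// -ge0_integralZl_EFin//; last 2 first.
      - apply/measurable_EFinP; exact: measurable_indic.
      - exact: ltW.
      apply: ge0_le_integral_any => w; first by rewrite mule_ge0// lee_fin ltW.
      rewrite indicE; case: (boolP (w \in E)) => [/set_mem[[n bn] h]|_]; last by rewrite mule0.
      by rewrite mule1; apply: jump_mass => //; exists n%:R.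
    rewrite pmule_rle0// => PE; apply/eqP; rewrite eq_le PE/=; exact: measure_ge0.
  exists E; split=> // w /= nn; apply: contrapT => nE; exact: nn.
pose up n := odflt (0, 0) (unpickle n) : rat * rat.
have : \forall w \ae P, forall n, let a := ratr (up n).1 : R in let b := ratr (up n).2 : R in
   0 < a -> a < b -> ~ ((exists n : nat, b <= A w n%:R) /\
     forall q : rat, 0 <= ratr q :> R -> A w (ratr q) < a \/ b <= A w (ratr q)).
  apply: ae_foralln => n /=.
  have [a0|a0] := pselect (0 < ratr (up n).1 :> R); last by apply: aeW.
  have [ab|ab] := pselect (ratr (up n).1 < ratr (up n).2 :> R); last by apply: aeW.
  by apply: filterS (key _ _ a0 ab).
apply: filterS => w hw c e c0 e0 [s cs].
have : Num.max (c - e) 0 < c by rewrite gt_max c0 ltrBlDr ltrDl e0.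
move=> /rat_in_itvoo[a]; rewrite in_itv/= gt_max => /andP[/andP[ca a0] ac].
have /rat_in_itvoo[b] := ac; rewrite in_itv/= => /andP[ab bc].
have := hw (pickle (a, b)); rewrite /up pickleK/= => /(_ a0 ab) nE.
apply: contrapT => nq; apply: nE; split.
  exists (Num.truncn s).+1; rewrite (le_trans (ltW bc))// (le_trans cs)//.
  by rewrite (cumulative_is_nondecreasing (A w))// ltW// truncnS_gt.
move=> q q0; have [|aq] := ltP (A w (ratr q)) (ratr a); first by left.
have [|qb] := leP (ratr b) (A w (ratr q)); first by right.
exfalso; apply: nq; exists (ratr q); split=> //.
by rewrite (le_trans (ltW ca))// (lt_trans qb).
Qed.

End avoids_stopping_times.

(** * The remaining growth of A is exponential *)

(** The hypothesis is [g' = - g] in finite differences. Both [g] and the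
exponential decrease by the factor [1 - u] over a step [u], up to an error of
order [u ^+ 2]; the errors of [n] steps of length [x / n] add up to order
[1 / n]. *)
Lemma exp_decay (R : realType) (g : R -> R) :
  (forall x, 0 <= g x) ->
  (forall x y, 0 <= x -> x < y ->
    (y - x) * g y <= g x - g y /\ g x - g y <= (y - x) * g x) ->
  forall x, 0 <= x -> g x = expR (- x) * g 0.
Proof.
move=> g0 gP.
have g_le x : 0 <= x -> g x <= g 0.
  rewrite le_eqVlt => /predU1P[<-//|x0]; have [h _] := gP 0 x (lexx _) x0.
  by rewrite -subr_ge0 (le_trans _ h)// mulr_ge0// subr0 ltW.
have step x u : 0 <= x -> 0 < u -> `|g (x + u) - expR (- u) * g x| <= u ^+ 2 * g 0.
  move=> x0 u0; have [h1 h2] := gP x (x + u) x0 (ltac:(by rewrite ltrDl)).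
  move: h1 h2; rewrite addrAC subrr add0r => h1 h2.
  have e1 : 1 - u <= expR (- u) by exact: expR_ge1Dx.
  have e2 : expR (- u) * (1 + u) <= 1.
    by rewrite expRN mulrC ler_pdivrMr ?expR_gt0// mul1r expR_ge1Dx.
  have gx0 := g0 x; have gxu := g0 (x + u); have gx := g_le x x0.
  have hu : u ^+ 2 * g x <= u ^+ 2 * g 0 by rewrite ler_wpM2l// sqr_ge0.
  apply: le_trans hu; rewrite ler_norml; apply/andP; split.
    have : (1 + u) * (expR (- u) * g x) <= g x.
      by rewrite mulrCA mulrA ler_piMl// mulrC.
    have : expR (- u) * g x >= 0 by rewrite mulr_ge0// expR_ge0.
    set e := expR (- u) * g x => e0 h3.
    have : e * u <= g x * u by rewrite ler_pM2r//; nra.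
    nra.
  have : (1 - u) * g x <= expR (- u) * g x by rewrite ler_wpM2r.
  have : g (x + u) * u <= g x * u by rewrite ler_pM2r//; nra.
  nra.
have iter u k : 0 < u -> `|g (k%:R * u) - expR (- (k%:R * u)) * g 0| <= k%:R * (u ^+ 2 * g 0).
  move=> u0; elim: k => [|k IH]; first by rewrite !mul0r oppr0 expR0 mul1r subrr normr0.
  have ku0 : 0 <= k%:R * u by rewrite mulr_ge0// ltW.
  have := step (k%:R * u) u ku0 u0.
  rewrite -[k.+1]addn1 natrD mulrDl mul1r [X in _ -> _ <= X]mulrDl mul1r => h.
  rewrite (_ : _ - _ = expR (- u) * (g (k%:R * u) - expR (- (k%:R * u)) * g 0) +
     (g (k%:R * u + u) - expR (- u) * g (k%:R * u))); last first.
    by rewrite opprD expRD; ring.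
  apply: (le_trans (ler_normD _ _)); apply: lerD => //.
  rewrite normrM; apply: le_trans IH; rewrite ler_piMl// ger0_norm ?expR_ge0//.
  by rewrite -expR0 ler_expR oppr_le0 ltW.
move=> x; rewrite le_eqVlt => /predU1P[<-|x0]; first by rewrite oppr0 expR0 mul1r.
apply/eqP; rewrite -subr_eq0 -normr_le0; apply/ler_addgt0Pr => e e0; rewrite add0r.
have C0 : 0 <= x ^+ 2 * g 0 by rewrite mulr_ge0// sqr_ge0.
near \oo => n.
have n0 : 0 < n.+1%:R :> R by [].
have := iter (x / n.+1%:R) n.+1 (divr_gt0 x0 n0).
rewrite mulrCA divff ?gt_eqF// mulr1 => /le_trans; apply.
rewrite (_ : _ * _ = (x ^+ 2 * g 0) * n.+1%:R^-1); last by field; rewrite gt_eqF.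
apply: (@le_trans _ _ ((x ^+ 2 * g 0 + 1) * n.+1%:R^-1)).
  by rewrite ler_wpM2r// lerDl.
rewrite -ler_pdivlMl; last by rewrite (lt_le_trans ltr01)// lerDr.
rewrite ltW//; near: n; apply: (near_infty_natSinv_lt (PosNum (_ : 0 < _^-1 * e))).
by rewrite mulr_gt0// invr_gt0 (lt_le_trans ltr01)// lerDr.
Unshelve. all: by end_near. Qed.

Section exponential_law.
Context d (Omega : measurableType d) (R : realType) (P : probability Omega R).
Variables (F : R -> set (set Omega)) (L : Omega -> \bar R) (A : Omega -> cumulative R R).
Hypotheses (hF : usual_filtration P F) (hL : honest_time P F L) (hA : condition_A P F L)
  (hdual : dual_optional_projection P F L A).

Local Notation OT := (g_sigma_algebraType (optional_trace F)).
Local Notation mu w := (lebesgue_stieltjes_measure (A w)).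

(** One exceptional set for all the path properties that later arguments use. *)
Lemma dual_generic : \forall w \ae P,
  [/\ (total_mass (A w) < +oo)%E, gapless (A w),
      A_infty A w = A w (fine (L w)) & 0 < fine (L w)].
Proof.
have L0 : \forall w \ae P, L w <> 0%E.
  exists [set w | L w = 0%E]; split; [|exact: (honest_neq0 hL)|by move=> w /= /contrapT].
  have := measurable_eqe measurableT (honest_measurable hL) (@measurable_cst _ _ _ _ setT 0%E).
  by rewrite setTI.
have Ly : \forall w \ae P, L w <> +oo%E.
  exists [set w | L w = +oo%E]; split; [|exact: (honest_neqy hL)|by move=> w /= /contrapT].
  have := measurable_eqe measurableT (honest_measurable hL) (@measurable_cst _ _ _ _ setT +oo%E).
  by rewrite setTI.
have ty := total_mass_lty hF hL hdual; have tL := total_mass_honest hF hL hdual.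
have gA := dual_gapless hF hL hA hdual.
near=> w.
have L0w : L w <> 0%E by near: w.
have Lyw : L w <> +oo%E by near: w.
have tLw : total_mass (A w) = (A w (fine (L w)))%:E by near: w.
split; [by near: w|by near: w|by rewrite /A_infty -/(total_mass (A w)) tLw|].
rewrite fine_gt0// lt_neqAle eq_sym (honest_ge0 hL) andbT lt_neqAle leey andbT.
by apply/andP; split; apply/eqP.
Unshelve. all: by end_near. Qed.

Local Notation Ainf := (A_infty A).

Let Alt0 w t : t < 0 -> A w t = 0.
Proof. exact: (dual_lt0 hdual). Qed.

Lemma measurable_A_infty : measurable_fun setT Ainf.
Proof.
have : measurable_fun setT (fun w => fine (total_mass (A w))).
  by apply: measurableT_comp => //; exact: (measurable_total_mass hF hdual).
by [].
Qed.

Lemma filtration_complete : measure_is_complete P.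
Proof. by move=> N /(usual_null hF); exact: (usual_sub hF (lexx _)). Qed.

(** Completeness transfers the measurability of [g] to [f]. *)
Lemma ge0_ae_integral (f g : Omega -> \bar R) : measurable_fun setT g ->
  (forall w, 0 <= f w)%E -> (forall w, 0 <= g w)%E -> (\forall w \ae P, f w = g w) ->
  (\int[P]_w f w = \int[P]_w g w)%E.
Proof.
move=> mg f0 g0 fg.
have ae : ae_eq P setT g f by apply: filterS fg => w ->.
have mf : measurable_fun setT f.
  by apply: (ae_measurable_fun filtration_complete) ae mg.
apply: ge0_ae_eq_integral => //.
by apply: filterS fg => w ->.
Qed.

Lemma ae_eq_measure (X Y : set Omega) : measurable X -> measurable Y ->
  (\forall w \ae P, X w <-> Y w) -> P X = P Y.
Proof.
move=> mX mY XY; rewrite -[X in P X]setIT -[in RHS](setIT Y) -!integral_indic//.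
apply: ge0_ae_integral => //.
  by apply/measurable_EFinP; exact: measurable_indic.
apply: filterS XY => w h; rewrite !indicE.
by have -> : (w \in X) = (w \in Y) by apply/idP/idP; rewrite !inE => /h.
Qed.

Lemma le_ae_measure (X Y : set Omega) : measurable X -> measurable Y ->
  (\forall w \ae P, X w -> Y w) -> (P X <= P Y)%E.
Proof.
move=> mX mY XY; rewrite (@ae_eq_measure X (X `&` Y))//; last 2 first.
- exact: measurableI.
- by apply: filterS XY => w h; split=> [Xw|[]//]; split=> //; exact: h.
by apply: le_measure; rewrite ?inE//; exact: measurableI.
Qed.

Section conditional.
Variables (t : R) (B : set Omega).
Hypotheses (t0 : 0 <= t) (FB : F t B).

Let Y w := Ainf w - A w t.
Let mB : measurable B := usual_sub hF t0 FB.

Let mY : measurable_fun setT Y.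
Proof.
apply: measurable_funB; first exact: measurable_A_infty.
exact: (measurable_dual hF hdual).
Qed.

Let mYge x : measurable [set w | x <= Y w].
Proof.
have := mY measurableT (measurable_itv `[x, +oo[); rewrite setTI; congr measurable.
by apply/seteqP; split=> w /=; rewrite in_itv/= andbT.
Qed.

Let mYgt x : measurable [set w | x < Y w].
Proof.
have := mY measurableT (measurable_itv `]x, +oo[); rewrite setTI; congr measurable.
by apply/seteqP; split=> w /=; rewrite in_itv/= andbT.
Qed.

Let mLgt : measurable [set w | t < fine (L w)].
Proof.
have mL : measurable_fun setT (fun w => fine (L w)).
  by apply: measurableT_comp => //; exact: (honest_measurable hL).
have := mL measurableT _ (measurable_itv `]t, +oo[); rewrite setTI; congr measurable.
by apply/seteqP; split=> w /=; rewrite in_itv/= andbT.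
Qed.

(** The integral of [excess x] is, as a function of [x], an antiderivative of
minus the tail of [Y] on [B]; the duality formula identifies it with that tail. *)
Let excess x w := \1_B w * Num.max (Y w - x) 0.

Let mexcess x : measurable_fun setT (EFin \o excess x).
Proof.
apply/measurable_EFinP; apply: measurable_funM; first exact: measurable_indic.
by apply: measurable_maxr => //; apply: measurable_funB.
Qed.

Let excess_ge0 x w : 0 <= excess x w.
Proof. by rewrite /excess mulr_ge0// le_max lexx orbT. Qed.

(** The value at time [t] enters as a process that is adapted: it is revealed at
[t], and 0 before. *)
Let optional_A_ge x : measurable
  ([set sw | x <= A sw.2 sw.1 - (if t <= sw.1 then A sw.2 t else 0)] : set OT).
Proof.
have o1 : measurable_fun setT (fun sw : OT => A sw.2 sw.1).
  by have /optional_processP := optional_dual hdual.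
have o2 : measurable_fun setT (fun sw : OT => if t <= sw.1 then A sw.2 t else 0).
  have := optional_step hF t0 (dual_adapted hdual t0).
  by move=> /optional_processP.
have := measurable_funB o1 o2 measurableT (measurable_itv `[x, +oo[).
rewrite setTI; congr measurable.
by apply/seteqP; split=> w /=; rewrite in_itv/= andbT.
Qed.

(** The mass that [dA] gives to the times at which [A] has grown by [x] since [t]
is [(Y - x)^+], and [L] is such a time exactly when [x <= Y], as
[A_L = A_infty]. *)
Let integral_excess x : 0 < x ->
  (\int[P]_w (excess x w)%:E)%E = P (B `&` [set w | x <= Y w]).
Proof.
move=> x0; set E := [set sw : R * Omega | t <= sw.1 /\ B sw.2] `&`
  [set sw | x <= A sw.2 sw.1 - (if t <= sw.1 then A sw.2 t else 0)].
have mE : measurable (E : set OT).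
  by apply: measurableI; [exact: (optional_set_step hF)|exact: optional_A_ge].
transitivity (\int[P]_w mu w [set s | (0 <= s)%R /\ E (s, w)])%E.
  apply/esym; apply: ge0_ae_integral; [exact: mexcess|by []|by move=> w; rewrite lee_fin|].
  apply: filterS dual_generic => w [ty gw _ _].
  rewrite /excess indicE; case: (boolP (w \in B)) => [/set_mem|/negP] Bw.
    rewrite mul1r /Y -addrA -opprD -stieltjes_superlevel//; last 2 first.
    - exact: Alt0.
    - by rewrite ltr_wpDl// (cumulative_ge0 (@Alt0 w)).
    congr (mu w _); apply/seteqP; split=> s /=.
      by move=> [s0 [[ts _]]] /=; rewrite ts lerBrDl.
    move=> h; have ts : t <= s.
      rewrite leNgt; apply/negP => /ltW /(@cumulative_is_nondecreasing _ _ _ (A w)) st.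
      by move: (le_trans h st); rewrite gerDl leNgt x0.
    by split; [exact: le_trans ts|split=> //=; rewrite ts lerBrDl].
  rewrite mul0r (_ : [set _ | _] = set0) ?measure0//.
  by apply/seteqP; split=> // s [_ [[_ /mem_set]]].
rewrite (dual_set hF hL hdual mE); apply: ae_eq_measure.
- exact: (measurable_at_set hF hL).
- exact: measurableI.
apply: filterS dual_generic => w [ty gw AL _].
split=> /=; rewrite /Y AL; first by move=> [[/= -> Bw]].
move=> [Bw xY]; have tL : t <= fine (L w).
  rewrite leNgt; apply/negP => /ltW /(@cumulative_is_nondecreasing _ _ _ (A w)) st.
  by move: (lt_le_trans x0 xY); rewrite subr_gt0 ltNge st.
by split=> //=; rewrite tL.
Qed.

(** At [x = 0] the growth condition is void and the times after [t] are taken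
instead. *)
Let integral_excess0 :
  (\int[P]_w (excess 0 w)%:E)%E = P (B `&` [set w | t < fine (L w)]).
Proof.
set E := [set sw : R * Omega | t < sw.1 /\ B sw.2].
have mE : measurable (E : set OT) by exact: (optional_set_gt hF).
transitivity (\int[P]_w mu w [set s | (0 <= s)%R /\ E (s, w)])%E.
  apply/esym; apply: ge0_ae_integral; [exact: mexcess|by []|by move=> w; rewrite lee_fin|].
  apply: filterS dual_generic => w [ty gw _ _].
  rewrite /excess indicE; case: (boolP (w \in B)) => [/set_mem|/negP] Bw.
    rewrite mul1r subr0 max_l; last first.
      by rewrite subr_ge0 (le_total_mass (@Alt0 w)).
    rewrite -(stieltjes_itvoy_fin (@Alt0 w))//.
    congr (mu w _); apply/seteqP; split=> s /=; rewrite in_itv/= andbT; first by move=> [_ []].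
    by move=> ts; split; [rewrite (le_trans t0)// ltW|split].
  rewrite mul0r (_ : [set _ | _] = set0) ?measure0//.
  by apply/seteqP; split=> // s [_ [_ /mem_set]].
rewrite (dual_set hF hL hdual mE); congr (P _).
by apply/seteqP; split=> w /= [].
Qed.

(** Pointwise, [(Y - x)^+ - (Y - y)^+] lies between [y - x] times the indicators
of [{y <= Y}] and [{x < Y}]. *)
Let excess_sub x y : 0 <= x -> x < y ->
  ((y - x)%:E * P (B `&` [set w | (y <= Y w)%R]) + \int[P]_w (excess y w)%:E <=
     \int[P]_w (excess x w)%:E)%E /\
  (\int[P]_w (excess x w)%:E <=
     (y - x)%:E * P (B `&` [set w | (x < Y w)%R]) + \int[P]_w (excess y w)%:E)%E.
Proof.
move=> x0 xy; have yx : 0 <= y - x by rewrite subr_ge0 ltW.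
have intE (C : set Omega) : measurable C ->
  ((y - x)%:E * P C + \int[P]_w (excess y w)%:E =
   \int[P]_w ((y - x)%:E * (\1_C w)%:E + (excess y w)%:E))%E.
  move=> mC; rewrite ge0_integralD//; last 4 first.
  - by move=> w _; rewrite mule_ge0// lee_fin.
  - by apply: emeasurable_funM => //; apply/measurable_EFinP; exact: measurable_indic.
  - by move=> w _; rewrite lee_fin.
  - exact: mexcess.
  rewrite ge0_integralZl_EFin//; first by rewrite integral_indic// setIT.
  by apply/measurable_EFinP; exact: measurable_indic.
rewrite !intE; [|exact: measurableI|exact: measurableI].
split; apply: ge0_le_integral_any => w.
- by rewrite adde_ge0// ?mule_ge0// lee_fin.
- rewrite -EFinM -EFinD lee_fin /excess !indicE in_setI.
  case: (boolP (w \in B)) => Bw /=; last by rewrite mulr0 !mul0r addr0.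
  rewrite !mul1r; case: (boolP (w \in _)) => [|/negP]; rewrite inE/=.
    by move=> yY; rewrite mulr1 !max_l; lra.
  by move=> /negP; rewrite -ltNge mulr0 add0r => Yy; rewrite max_r ?le_max ?lexx ?orbT//; lra.
- by rewrite lee_fin.
- rewrite -EFinM -EFinD lee_fin /excess !indicE in_setI.
  case: (boolP (w \in B)) => Bw /=; last by rewrite mulr0 !mul0r addr0.
  rewrite !mul1r; case: (boolP (w \in _)) => [|/negP]; rewrite inE/=.
    move=> xY; rewrite mulr1 ge_max addr_ge0 ?le_max ?lexx ?orbT// andbT -lerBlDl le_max.
    by apply/orP; left; lra.
  move=> /negP; rewrite -leNgt mulr0 add0r => Yx; rewrite !max_r//; lra.
Qed.

(** Combining [integral_excess] and [excess_sub], [exp_decay] applies to the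
integral [g] of the excess. At 0, [g] is the probability of [B] and [{t < L}],
only an upper bound for that of [B] and [{0 < Y}]; equality comes from letting
[u] decrease to 0 in [P [u <= Y ; B] = g u = exp(-u) g 0]. *)
Lemma remaining_growth_exponential z : 0 < z ->
  P (B `&` [set w | z <= Y w]) = ((expR (- z))%:E * P (B `&` [set w | (0 < Y w)%R]))%E.
Proof.
pose g x := fine (\int[P]_w (excess x w)%:E)%E.
have gE x : 0 <= x -> (\int[P]_w (excess x w)%:E)%E = (g x)%:E.
  rewrite le_eqVlt => /predU1P[<-|x0]; rewrite /g ?integral_excess0 ?integral_excess//.
    by rewrite fineK// fin_num_measure//; exact: measurableI.
  by rewrite fineK// fin_num_measure//; exact: measurableI.
have g0 x : 0 <= g x by rewrite fine_ge0// integral_ge0// => w _; rewrite lee_fin.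
have PYL : (P (B `&` [set w | (0 < Y w)%R]) <= (g 0)%:E)%E.
  rewrite -gE// integral_excess0; apply: le_ae_measure; [exact: measurableI|exact: measurableI|].
  apply: filterS dual_generic => w [ty gw AL _] [Bw]; rewrite /Y/= AL => Y0; split=> //=.
  rewrite ltNge; apply/negP => /(@cumulative_is_nondecreasing _ _ _ (A w)) st.
  by move: Y0; rewrite subr_gt0 ltNge st.
have PY x : 0 <= x -> (P (B `&` [set w | (x < Y w)%R]) <= (g x)%:E)%E.
  rewrite le_eqVlt => /predU1P[<-//|x0]; rewrite -gE ?(ltW x0)// integral_excess//.
  apply: le_measure; rewrite ?inE; [exact: measurableI|exact: measurableI|].
  by move=> w [Bw] /= /ltW.
have gexp : forall x, 0 <= x -> g x = expR (- x) * g 0.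
  apply: exp_decay => // x y x0 xy.
  have y0 : 0 < y := le_lt_trans x0 xy.
  have [h1 h2] := excess_sub x0 xy; split.
    move: h1; rewrite -integral_excess// !gE ?(ltW y0)// -EFinM -EFinD lee_fin; lra.
  have yx : 0 <= y - x by rewrite subr_ge0 ltW.
  have : ((g x)%:E <= (y - x)%:E * (g x)%:E + (g y)%:E)%E.
    rewrite -[leLHS]gE//; apply: (le_trans h2); rewrite gE ?(ltW y0)// leeD2r// lee_wpmul2l//.
    exact: PY.
  by rewrite -EFinM -EFinD lee_fin; lra.
move=> z0; rewrite -integral_excess// gE ?(ltW z0)// (gexp z (ltW z0)) EFinM; congr (_ * _)%E.
apply/eqP; rewrite eq_le PYL andbT; apply/lee_subgt0Pr => e e0.
have g1 : 0 < g 0 + 1 by rewrite ltr_wpDl.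
set u := e / (g 0 + 1).
have u0 : 0 < u by rewrite divr_gt0.
apply: (@le_trans _ _ (P (B `&` [set w | u <= Y w]))).
  rewrite -integral_excess// gE ?(ltW u0)// (gexp u (ltW u0)) -EFinB lee_fin.
  have h : 1 - u <= expR (- u) by exact: expR_ge1Dx.
  apply: le_trans (ler_wpM2r (g0 0) h).
  rewrite mulrBl mul1r lerD2l lerN2 /u mulrAC ler_pdivrMr//.
  by rewrite ler_pM2l// lerDl.
apply: le_measure; rewrite ?inE; [exact: measurableI|exact: measurableI|].
by move=> w [Bw] /= uY; split=> //=; exact: lt_le_trans uY.
Qed.

End conditional.

End exponential_law.

(** * Densities and the exponential law *)

(** The proofs [p0] and [mp] are arguments so that the measure structure can be
inferred. *)
Definition mdensity d (T : measurableType d) (R : realType)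
    (mu : {measure set T -> \bar R}) (p : T -> R)
    (p0 : forall x, 0 <= p x) (mp : measurable_fun setT p) : set T -> \bar R :=
  fun V => (\int[mu]_(x in V) (p x)%:E)%E.

Section mdensity.
Local Open Scope ereal_scope.
Context d (T : measurableType d) (R : realType) (mu : {measure set T -> \bar R}).
Variables (p : T -> R) (p0 : forall x, (0 <= p x)%R) (mp : measurable_fun setT p).

Local Notation nu := (mdensity mu p0 mp).

Let nu0 : nu set0 = 0. Proof. by rewrite /mdensity integral_set0. Qed.

Let nu_ge0 V : 0 <= nu V. Proof. by apply: integral_ge0 => x _; rewrite lee_fin. Qed.

Let nu_sigma_additive : semi_sigma_additive nu.
Proof.
move=> /= V mV tV mUV; rewrite /mdensity; apply: cvg_toP.
  apply: ereal_nondecreasing_is_cvgn => m n mn.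
  by apply: lee_sum_nneg_natr => // k _ _; apply: integral_ge0 => x _; rewrite lee_fin.
rewrite ge0_integral_bigcup//.
  by apply: measurable_funTS; exact/measurable_EFinP.
by move=> x _; rewrite lee_fin.
Qed.

HB.instance Definition _ := isMeasure.Build _ _ _ nu nu0 nu_ge0 nu_sigma_additive.

Import HBNNSimple.

Let integral_mdensity_nnsfun (h : {nnsfun T >-> R}) :
  \int[nu]_x (h x)%:E = \int[mu]_x ((h x)%:E * (p x)%:E).
Proof.
pose level r x : \bar R := (r * \1_(h @^-1` [set r]) x)%:E.
have mind r : measurable_fun setT (\1_(h @^-1` [set r]) : T -> R).
  exact: measurable_indic.
have mp' : measurable_fun setT (EFin \o p) by exact/measurable_EFinP.
have level_ge0 r x : 0 <= level r x by exact: nnfun_muleindic_ge0.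
have hE x : (h x)%:E * (p x)%:E = \sum_(r \in range h) (level r x * (p x)%:E).
  by rewrite {1}fimfunE -fsumEFin// ge0_mule_fsuml// => r; exact: level_ge0.
under [RHS]eq_integral do rewrite hE.
rewrite integralT_nnsfun sintegralE [RHS]ge0_integral_fsum//; last 2 first.
- move=> r; apply: emeasurable_funM => //; apply/measurable_EFinP.
  exact: measurable_funM.
- by move=> r x _; rewrite mule_ge0// lee_fin.
apply: eq_fsbigr => r /[!inE] -[y _ hy]; have r0 : (0 <= r)%R by rewrite -hy.
rewrite /mdensity -ge0_integralZl_EFin//; last 2 first.
- by move=> x _; rewrite lee_fin.
- exact: measurable_funTS.
rewrite [LHS]integral_mkcond; apply: eq_integral => x _; rewrite patchE /level indicE.
by case: ifP => _; rewrite ?mulr1// mulr0 mul0e.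
Qed.

Lemma ge0_integral_mdensity (f : T -> \bar R) : measurable_fun setT f ->
  (forall x, 0 <= f x) -> \int[nu]_x f x = \int[mu]_x (f x * (p x)%:E).
Proof.
move=> mf f0; pose h := nnsfun_approx measurableT mf.
have mh n : measurable_fun setT (fun x => (h n x)%:E) by exact/measurable_EFinP.
have nd x : nondecreasing_seq (fun n => (h n x)%:E).
  by move=> m n mn; rewrite lee_fin; exact/lefP/nd_nnsfun_approx.
have hf x : (h n x)%:E @[n --> \oo] --> f x by exact: cvg_nnsfun_approx.
have hpf x : (h n x)%:E * (p x)%:E @[n --> \oo] --> f x * (p x)%:E.
  by apply: cvgeZr.
have nu_cvg : \int[nu]_x (h n x)%:E @[n --> \oo] --> \int[nu]_x f x.
  rewrite (_ : f = fun x => limn (fun n => (h n x)%:E)); last first.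
    by apply/funext => x; apply/esym/cvg_lim => //; exact: hf.
  by apply: cvg_monotone_convergence => // n x _; rewrite lee_fin.
have mu_cvg : \int[mu]_x ((h n x)%:E * (p x)%:E) @[n --> \oo] -->
    \int[mu]_x (f x * (p x)%:E).
  under eq_integral do rewrite -(cvg_lim (@ereal_hausdorff R) (hpf _)).
  apply: cvg_monotone_convergence => // [n|n x _|x _ m n mn].
  - by apply: emeasurable_funM => //; exact/measurable_EFinP.
  - by rewrite mule_ge0// lee_fin.
  - by rewrite lee_wpmul2r ?lee_fin//; exact: nd.
have e n := integral_mdensity_nnsfun (h n).
by apply: (cvg_unique _ nu_cvg) => //; rewrite (funext e).
Qed.

End mdensity.

Section exp_law.
Context {R : realType}.
Local Notation leb := (@lebesgue_measure R).

Definition exp_law : probability (measurableTypeR R) R :=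
  exponential_distribution_exponential_prob__canonical__probability_measure_Probability (@ltr01 R).

Lemma exp_law_itvcy (x : R) : 0 <= x -> exp_law `[x, +oo[%classic = (expR (- x))%:E.
Proof.
move=> x0; rewrite -[LHS]/(\int[leb]_(y in `[x, +oo[) (exponential_pdf 1 y)%:E)%E.
rewrite (@ge0_continuous_FTC2y _ _ (fun y => - expR (- y)) _ 0).
- by rewrite EFinN oppeK add0e.
- by move=> y xy; rewrite exponential_pdf_ge0.
- apply: (@continuous_subspaceW R^o _ _ [set` `[0, +oo[%R]).
    by move=> y /=; rewrite !in_itv/= !andbT; exact: le_trans.
  exact: within_continuous_exponential_pdf.
- by rewrite -oppr0; apply: cvgN; exact: cvgr_expR.
- by move=> y _; exact: ex_derive.
- apply: cvg_at_right_filter; apply: cvgN.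
  by apply: continuous_comp; [exact: opp_continuous|exact: continuous_expR].
- move=> y; rewrite in_itv/= andbT => xy.
  rewrite -derive1_exponential_pdf ?in_itv/= ?andbT ?(le_lt_trans x0)//.
  by congr (derive1 _ y); apply/funext => z; rewrite mulN1r.
Qed.

Lemma ge0_integral_exp_law (f : R -> \bar R) : measurable_fun setT f ->
  (forall y, 0 <= f y)%E ->
  (\int[exp_law]_y f y = \int[leb]_(y in `[0%R, +oo[) (f y * (expR (- y))%:E))%E.
Proof.
move=> mf f0.
have p0 y : (0 <= exponential_pdf 1 y :> R) by rewrite exponential_pdf_ge0.
have mp : measurable_fun setT (EFin \o (exponential_pdf (1 : R))).
  by apply/measurable_EFinP; exact: measurable_exponential_pdf.
have mp' := @measurable_exponential_pdf R 1.
rewrite (eq_measure_integral (mdensity leb p0 mp'))//.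
rewrite ge0_integral_mdensity// [RHS]integral_mkcond; apply: eq_integral => y _.
rewrite patchE mem_setE; case: ifPn => y0.
  rewrite exponential_pdfE; last by move: y0; rewrite in_itv/= andbT.
  by rewrite mul1r mulN1r.
rewrite lt0_exponential_pdf ?mule0//.
by move: y0; rewrite in_itv/= andbT -ltNge.
Qed.

End exp_law.

(** Translation invariance of Lebesgue measure, which equals its image under the
shift. *)
Lemma integral_shift (R : realType) (f : R -> \bar R) (a : R) : measurable_fun setT f ->
  (@lebesgue_measure R).-integrable `[a, +oo[ f ->
  (\int[lebesgue_measure]_(x in `[a, +oo[) f x =
   \int[lebesgue_measure]_(x in `[0%R, +oo[) f (a + x)%R)%E.
Proof.
move=> mf intf; pose shift (x : R) : measurableTypeR R := x - a.
have mshift : measurable_fun setT shift by apply: measurable_funB.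
have shiftE A : measurable A -> lebesgue_measure A = pushforward lebesgue_measure shift A.
  apply: lebesgue_measure_unique => _ [[b c] _ <-] /=.
  rewrite -[RHS]/(lebesgue_measure (shift @^-1` `]b, c]%classic)).
  rewrite (_ : shift @^-1` _ = `]b + a, c + a]%classic).
    rewrite !lebesgue_measure_itv/= !lte_fin ltrD2r; case: ifPn => // _.
    by rewrite -!EFinB; congr EFin; ring.
  by apply/seteqP; split=> x /=; rewrite !in_itv/= /shift ltrBrDr lerBlDr.
have preE : shift @^-1` `[0, +oo[%classic = `[a, +oo[%classic.
  by apply/seteqP; split=> x /=; rewrite !in_itv/= !andbT /shift subr_ge0.
have mfa : measurable_fun setT (fun x : R => f (a + x)).
  by apply: measurableT_comp => //; exact: measurable_funD.
rewrite [RHS](eq_measure_integral (pushforward lebesgue_measure shift)); last first.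
  by move=> A mA _; exact: shiftE.
have compE : (fun x : R => f (a + x)) \o shift = f.
  by apply/funext => x; rewrite /= /shift addrC subrK.
have := @integral_pushforward _ _ (measurableTypeR R) (measurableTypeR R) R shift mshift
  (@lebesgue_measure R) `[0, +oo[%classic (fun x : R => f (a + x)).
rewrite preE compE => /(_ mfa intf) ->//.
Qed.

(** * The transform phi_hat *)

Lemma continuous_max0 (R : realType) : continuous (fun y : R => Num.max y 0).
Proof. by move=> y; apply: continuous_max; [exact: cvg_id|exact: cvg_cst]. Qed.

Section phi_hat.
Context {R : realType} (phi : R -> R).
Local Notation leb := (@lebesgue_measure R).
Hypothesis phi_cont : {within `[0, +oo[, continuous phi}.
Hypothesis phi_int :
  (\int[leb]_(x in `[0%R, +oo[) (`|phi x| * expR (- x))%:E < +oo)%E.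

(** Extending [phi] by a constant keeps continuity and gives a function that is
measurable on the whole line. *)
Definition half_ext (x : R) : R := phi (Num.max x 0).

Lemma half_extE x : 0 <= x -> half_ext x = phi x.
Proof. by move=> x0; rewrite /half_ext max_l. Qed.

Lemma continuous_half_ext : continuous half_ext.
Proof.
move=> x; rewrite /half_ext.
have mx : Num.max x 0 \in `[0, +oo[ by rewrite in_itv/= le_max lexx orbT.
have /subspace_continuousP/(_ _ mx) h := phi_cont.
apply: cvg_comp h => U; rewrite /within/= => hU.
have cmax := @continuous_max0 R x.
have : \forall y \near x, Num.max y 0 \in `[0, +oo[ -> U (Num.max y 0) := cmax _ hU.
apply: (@filterS _ (nbhs x)) => y; apply.
by rewrite /= in_itv/= le_max lexx orbT.
Qed.

Lemma measurable_half_ext : measurable_fun setT half_ext.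
Proof. by apply: continuous_measurable_fun; exact: continuous_half_ext. Qed.

Let g (x : R) := expR (- x) * half_ext x.

Let mexpN : measurable_fun setT (fun x : R => expR (- x)).
Proof. by apply: measurableT_comp => //; exact: measurable_expR. Qed.

Let mg : measurable_fun setT g.
Proof. by apply: measurable_funM => //; exact: measurable_half_ext. Qed.

Lemma integrable_weighted a : 0 <= a -> leb.-integrable `[a, +oo[ (EFin \o g).
Proof.
move=> a0.
suff: leb.-integrable `[0, +oo[ (EFin \o g).
  apply: integrableS => // x /=; rewrite !in_itv/= !andbT; exact: le_trans.
apply/integrableP; split; first by apply/measurable_EFinP; exact: measurable_funTS.
apply: le_lt_trans phi_int; apply: ge0_le_integral => //.
- by apply/measurableT_comp => //; apply/measurable_EFinP; exact: measurable_funTS.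
- apply/measurable_EFinP; apply: measurable_funM; last exact: measurable_funTS.
  apply: measurableT_comp => //.
  apply: (@eq_measurable_fun _ _ _ _ _ half_ext).
    by move=> x; rewrite inE/= in_itv/= andbT => /half_extE.
  exact: measurable_funTS measurable_half_ext.
- move=> x; rewrite /= in_itv/= andbT => x0.
  by rewrite /g normrM ger0_norm ?expR_ge0// mulrC half_extE.
Qed.

Lemma phi_hatE a : 0 <= a ->
  phi_hat phi a = expR a * \int[leb]_(y in `[a, +oo[) g y.
Proof.
move=> a0; congr (_ * _); apply: eq_Rintegral => y; rewrite inE/= in_itv/= andbT => ay.
by rewrite /g half_extE// (le_trans a0).
Qed.

(** A continuous factor times the tail of the integral of a continuous integrable
function. *)
Lemma phi_hat_continuous : continuous (fun a : R => phi_hat phi (Num.max a 0)).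
Proof.
pose K (a : R) := \int[leb]_(y in `[0, a]) g y.
have KE a : 0 <= a -> phi_hat phi a = expR a * (\int[leb]_(y in `[0, +oo[) g y - K a).
  move=> a0; rewrite phi_hatE//; congr (_ * _); rewrite /K Rintegral_itvB//.
    rewrite Rintegral_itv_obnd_cbnd//.
    apply: integrableS (integrable_weighted a0) => // y /=.
    by rewrite !in_itv/= !andbT => /ltW.
  exact: integrable_weighted.
have cK b : 0 <= b -> {within `[0, b], continuous K}.
  move=> b0; apply: parameterized_integral_continuous => //.
  apply: integrableS (integrable_weighted (lexx 0)) => //.
  by move=> y /=; rewrite !in_itv/= andbT => /andP[].
move=> x; rewrite (_ : (fun a => _) = (fun a : R =>
    expR (Num.max a 0) * (\int[leb]_(y in `[0, +oo[) g y - K (Num.max a 0)))); last first.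
  by apply/funext => a; rewrite KE// le_max lexx orbT.
have cmax := @continuous_max0 R.
apply: cvgM.
  exact: (cvg_comp _ _ (cmax x) (@continuous_expR R _)).
apply: cvgB; first exact: cvg_cst.
pose b := Num.max x 0 + 1.
have b0 : 0 <= b by rewrite addr_ge0// le_max lexx orbT.
have mx : Num.max x 0 \in `[0, b].
  by rewrite in_itv/= le_max lexx orbT/= lerDl.
have /subspace_continuousP/(_ _ mx) h := cK b b0.
apply: cvg_comp h => U; rewrite /within/= => hU.
have cU : \forall y \near x, Num.max y 0 \in `[0, b] -> U (Num.max y 0) := cmax x _ hU.
have mxb : Num.max x 0 < b by rewrite ltrDl.
have xb : \forall y \near x, Num.max y 0 < b := cmax x [set z | z < b] (lt_nbhsl mxb).
apply: (@filterS2 _ (nbhs x) _ _ _ _ _ xb cU) => y yb; apply.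
by rewrite /= in_itv/= le_max lexx orbT/= ltW.
Qed.

Lemma phi_hat_shift a : 0 <= a ->
  phi_hat phi a = \int[leb]_(x in `[0, +oo[) (expR (- x) * phi (a + x)).
Proof.
move=> a0; rewrite phi_hatE//.
transitivity (\int[leb]_(x in `[0, +oo[) (expR (- x) * half_ext (a + x))); last first.
  apply: eq_Rintegral => x; rewrite inE/= in_itv/= andbT => x0.
  by rewrite half_extE// addr_ge0.
rewrite /Rintegral -[expR a]/(fine (expR a)%:E) -fineM//; last first.
  exact: (integrable_fin_num _ (integrable_weighted a0)).
congr fine; rewrite -integralZl//; last exact: integrable_weighted.
under eq_integral => x _ do rewrite -EFinM /g mulrA -expRD.
rewrite (@integral_shift _ (fun x => (expR (a - x) * half_ext x)%:E)).
- by apply: eq_integral => x _; rewrite opprD addrA subrr add0r.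
- apply/measurable_EFinP; apply: measurable_funM; last exact: measurable_half_ext.
  by apply: measurableT_comp => //; exact: measurable_funB.
have : leb.-integrable `[a, +oo[ (fun x => (expR a)%:E * (EFin \o g) x)%E.
  by apply: integrableZl => //; exact: integrable_weighted.
apply: eq_integrable => // x _.
by rewrite -EFinM /= /g mulrA -expRD.
Qed.

Hypothesis phi_ge0 : forall x, 0 <= x -> 0 <= phi x.

(** How [phi_hat] enters: [phi_hat phi a] is the mean of [phi (a + Z)] for an
exponential variable [Z]. *)
Lemma integral_exp_law_half_ext a : 0 <= a ->
  (\int[exp_law]_y (half_ext (a + y))%:E = (phi_hat phi a)%:E)%E.
Proof.
move=> a0; have h0 x : 0 <= half_ext x by rewrite phi_ge0// le_max lexx orbT.
have mshift : measurable_fun setT (fun y : R => half_ext (a + y)).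
  by apply: measurableT_comp; [exact: measurable_half_ext|exact: measurable_funD].
rewrite ge0_integral_exp_law; [|exact/measurable_EFinP|by move=> y; rewrite lee_fin].
rewrite phi_hatE// /Rintegral -[expR a]/(fine (expR a)%:E) -fineM//; last first.
  exact: (integrable_fin_num _ (integrable_weighted a0)).
rewrite fineK; last first.
  by rewrite fin_numM//; exact: (integrable_fin_num _ (integrable_weighted a0)).
rewrite -integralZl//; last exact: integrable_weighted.
under [RHS]eq_integral => x _ do rewrite -EFinM /g mulrA -expRD.
rewrite [RHS](@integral_shift _ (fun x => (expR (a - x) * half_ext x)%:E)).
- by apply: eq_integral => x _; rewrite -EFinM opprD addrA subrr add0r mulrC.
- apply/measurable_EFinP; apply: measurable_funM; last exact: measurable_half_ext.
  by apply: measurableT_comp => //; exact: measurable_funB.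
have : leb.-integrable `[a, +oo[ (fun x => (expR a)%:E * (EFin \o g) x)%E.
  by apply: integrableZl => //; exact: integrable_weighted.
apply: eq_integrable => // x _.
by rewrite -EFinM /= /g mulrA -expRD.
Qed.

End phi_hat.

(** Tonelli-type arguments need a nonnegative function. Both parts of [phi]
satisfy the hypotheses made on [phi], and [phi_hat] is the difference of their
transforms. *)
Section positive_part.
Context {R : realType} (phi : R -> R).
Hypothesis phi_cont : {within `[0, +oo[, continuous phi}.
Hypothesis phi_int :
  (\int[lebesgue_measure]_(x in `[0%R, +oo[) (`|phi x| * expR (- x))%:E < +oo)%E.

Definition pos_part x := Num.max (phi x) 0.

Lemma continuous_pos_part : {within `[0, +oo[, continuous pos_part}.
Proof.
apply/subspace_continuousP => x x0.
have /subspace_continuousP/(_ x x0) h := phi_cont.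
exact: (cvg_comp _ _ h (@continuous_max0 R (phi x))).
Qed.

Lemma measurable_weighted_norm (f : R -> R) : {within `[0, +oo[, continuous f} ->
  measurable_fun (`[0, +oo[%classic : set R) (fun x => (`|f x| * expR (- x))%:E).
Proof.
move=> cf; apply/measurable_EFinP; apply: measurable_funM.
  apply: measurableT_comp => //.
  by apply: subspace_continuous_measurable_fun => //; exact: measurable_itv.
apply: measurable_funTS; apply: measurableT_comp => //; exact: measurable_expR.
Qed.

Lemma pos_part_int :
  (\int[lebesgue_measure]_(x in `[0%R, +oo[) (`|pos_part x| * expR (- x))%:E < +oo)%E.
Proof.
apply: le_lt_trans phi_int; apply: ge0_le_integral => //.
- by apply: measurable_weighted_norm; exact: continuous_pos_part.
- exact: measurable_weighted_norm.
- move=> x _; rewrite lee_fin ler_wpM2r// ?expR_ge0// /pos_part.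
  have [x0|x0] := leP (phi x) 0; last by [].
  by rewrite normr0.
Qed.

End positive_part.

Section signed.
Context {R : realType} (phi : R -> R).
Hypothesis phi_cont : {within `[0, +oo[, continuous phi}.
Hypothesis phi_int :
  (\int[lebesgue_measure]_(x in `[0%R, +oo[) (`|phi x| * expR (- x))%:E < +oo)%E.

Lemma continuous_opp_within : {within `[0, +oo[, continuous (\- phi)}.
Proof.
apply/subspace_continuousP => x x0.
have /subspace_continuousP/(_ x x0) h := phi_cont.
exact: (cvgN h).
Qed.

Lemma opp_int :
  (\int[lebesgue_measure]_(x in `[0%R, +oo[) (`|(\- phi) x| * expR (- x))%:E < +oo)%E.
Proof.
by apply: le_lt_trans phi_int; under eq_integral do rewrite normrN.
Qed.

Lemma phi_hat_pos_part a : 0 <= a ->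
  phi_hat phi a = phi_hat (pos_part phi) a - phi_hat (pos_part (\- phi)) a.
Proof.
move=> a0; rewrite !phi_hatE//.
have := integrable_weighted (continuous_pos_part phi_cont) (pos_part_int phi_cont phi_int) a0.
have := integrable_weighted (continuous_pos_part continuous_opp_within)
  (pos_part_int continuous_opp_within opp_int) a0.
move=> in_ ip; rewrite -mulrBr -RintegralB//; congr (_ * _).
apply: eq_Rintegral => x _; rewrite -mulrBr; congr (_ * _).
rewrite /half_ext /pos_part /=; set p := phi _; have [p0|p0] := leP p 0.
  by rewrite max_l ?oppr_ge0// sub0r opprK.
by rewrite max_r ?subr0// oppr_le0 ltW.
Qed.

End signed.

(** * Integrating out the remaining growth *)

(** The law of [(X, Y)] is the product of the law of [X] with [nu], since they
agree on rectangles; then Tonelli. *)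
Lemma integral_independent d (T : measurableType d) (R : realType)
    (Q : {finite_measure set T -> \bar R}) (X Y : T -> measurableTypeR R)
    (nu : probability (measurableTypeR R) R)
    (f : measurableTypeR R * measurableTypeR R -> \bar R) :
  measurable_fun setT X -> measurable_fun setT Y ->
  (forall A B, measurable A -> measurable B ->
     Q (X @^-1` A `&` Y @^-1` B) = Q (X @^-1` A) * nu B)%E ->
  measurable_fun setT f -> (forall z, 0 <= f z)%E ->
  (\int[Q]_w f (X w, Y w) = \int[Q]_w \int[nu]_y f (X w, y))%E.
Proof.
move=> mX mY XY mf f0.
pose m1 : {measure set (measurableTypeR R) -> \bar R} :=
  measure_function_pushforward__canonical__measure_function_Measure Q mX.
have fin1 : fin_num_fun m1.
  move=> A mA; rewrite /m1/= /pushforward; apply: fin_num_measure.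
  by rewrite -[X in measurable X]setTI; exact (mX measurableT _ mA).
pose m1f : {finite_measure set (measurableTypeR R) -> \bar R} :=
  HB.pack (Measure.sort m1) (Measure_isFinite.Build _ _ _ (Measure.sort m1) fin1).
have mXY : measurable_fun setT (fun w => (X w, Y w)) by exact: measurable_fun_pair.
pose m' : {measure set (measurableTypeR R * measurableTypeR R) -> \bar R} :=
  measure_function_pushforward__canonical__measure_function_Measure Q mXY.
have prodE A : measurable A -> (m1f \x nu)%E A = m' A.
  apply: product_measure_unique => A1 A2 mA1 mA2.
  exact: XY.
transitivity (\int[m']_z f z)%E.
  by rewrite (ge0_integral_pushforward mXY)// => z _.
rewrite (eq_measure_integral (m1f \x nu)%E); last by move=> A mA _; exact/esym/prodE.
rewrite fubini_tonelli1// /fubini_F.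
rewrite -[LHS]/(\int[pushforward Q X]_x \int[nu]_y f (x, y))%E.
rewrite (ge0_integral_pushforward mX)//.
  exact: measurable_fun_fubini_tonelli_F.
by move=> x _; exact: integral_ge0.
Qed.

Lemma ge0_integral_mrestr d (T : measurableType d) (R : realType)
    (mu : {measure set T -> \bar R}) (C : set T) (mC : measurable C) (f : T -> \bar R) :
  measurable_fun setT f -> (forall x, 0 <= f x)%E ->
  (\int[mrestr mu mC]_x f x = \int[mu]_(x in C) f x)%E.
Proof.
move=> mf f0.
have p0 x : (0 <= \1_C x :> R)%R by [].
have mp : measurable_fun setT (\1_C : T -> R) by exact: measurable_indic.
rewrite [LHS](eq_measure_integral (mdensity mu p0 mp)); last first.
  move=> A mA _; rewrite -[RHS]/(\int[mu]_(x in A) (\1_C x)%:E)%E integral_indic//.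
  by rewrite setIC.
rewrite ge0_integral_mdensity// [RHS]integral_mkcond; apply: eq_integral => x _.
by rewrite patchE indicE; case: ifP => _; rewrite ?mule1 ?mule0.
Qed.

Section remaining_growth.
Context d (Omega : measurableType d) (R : realType) (P : probability Omega R).
Variables (F : R -> set (set Omega)) (L : Omega -> \bar R) (A : Omega -> cumulative R R).
Hypotheses (hF : usual_filtration P F) (hL : honest_time P F L) (hA : condition_A P F L)
  (hdual : dual_optional_projection P F L A).
Variables (t : R) (t0 : 0 <= t).

Let Y w := A_infty A w - A w t.

Let mA_t : measurable_fun setT (fun w => A w t).
Proof. exact: (measurable_dual hF hdual). Qed.

Let mY : measurable_fun setT Y.
Proof. by apply: measurable_funB; [exact: (measurable_A_infty hF hdual)|]. Qed.

Lemma measurable_growing : measurable [set w | 0 < Y w].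
Proof.
have := mY measurableT (measurable_itv `]0, +oo[); rewrite setTI; congr measurable.
by apply/seteqP; split=> w /=; rewrite in_itv/= andbT.
Qed.

(** The half-lines [[x, +oo[] are stable under intersection and generate the Borel
sets; [remaining_growth_exponential] compares the two measures on them for
[x > 0], and for [x <= 0] both sides have full mass. *)
Lemma remaining_growth_law (B : set Omega) (V : set R) : F t B -> measurable V ->
  P (B `&` [set w | 0 < Y w] `&` (Y @^-1` V)) =
  (P (B `&` [set w | (0 < Y w)%R]) * exp_law V)%E.
Proof.
move=> FB mV; have mB : measurable B := usual_sub hF t0 FB.
set C := B `&` _; have mC : measurable C by apply: measurableI => //; exact: measurable_growing.
pose m1 : {measure set (measurableTypeR R) -> \bar R} :=
  measure_function_pushforward__canonical__measure_function_Measure (mrestr P mC)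
    (mY : measurable_fun setT (Y : Omega -> measurableTypeR R)).
have PC0 : 0 <= fine (P C) by rewrite fine_ge0.
have PCE : (fine (P C))%:E = P C by rewrite fineK// fin_num_measure.
pose m2 : {measure set (measurableTypeR R) -> \bar R} := mscale (NngNum PC0) exp_law.
have m1E W : m1 W = P ((Y @^-1` W) `&` C) by [].
have m2E W : m2 W = (P C * exp_law W)%E by rewrite -PCE.
rewrite -m2E setIC -m1E.
apply: (@measure_unique _ R (measurableTypeR R) (@RGenCInfty.G R)
  (fun n => `[(- n%:R)%R, +oo[%classic) _ _ _ _ m1 m2) => //.
- exact: RGenCInfty.measurableE.
- move=> _ _ [x ->] [y ->]; exists (Num.max x y).
  by apply/seteqP; split=> z /=; rewrite !in_itv/= !andbT ge_max => /andP.
- by move=> n; exists (- n%:R).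
- apply/seteqP; split=> // x _; exists (Num.truncn `|x|).+1 => //=.
  rewrite in_itv/= andbT lerNl (le_trans (ler_norm _))// normrN ltW//.
  by rewrite truncnS_gt.
- move=> _ [x ->]; rewrite m1E m2E.
  have [x0|x0] := ltP 0 x.
    rewrite exp_law_itvcy ?ltW// muleC -(remaining_growth_exponential hF hL hA hdual t0 FB x0).
    congr (P _); apply/seteqP; split=> w /=; rewrite in_itv/= andbT.
      by move=> [xY []].
    by move=> [Bw xY]; split=> //; split=> //; exact: lt_le_trans xY.
  rewrite [X in (_ * X)%E](_ : _ = 1%E).
    rewrite mule1; congr (P _); apply/seteqP; split=> w /=; rewrite in_itv/= andbT; first by case.
    by move=> [Bw Y0]; split=> //; rewrite (le_trans x0)// ltW.
  apply/eqP; rewrite eq_le; apply/andP; split; first exact: probability_le1.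
  rewrite (_ : 1%E = exp_law `[0, +oo[%classic); last by rewrite exp_law_itvcy// oppr0 expR0.
  apply: le_measure; rewrite ?inE; [exact: measurable_itv|exact: measurable_itv|].
  by move=> z /=; rewrite !in_itv/= !andbT; exact: le_trans.
- move=> n; rewrite m1E ltey_eq fin_num_measure//; apply: measurableI => //.
  by rewrite -[X in measurable X]setTI; apply: mY.
Qed.

(** [remaining_growth_law] for [B] intersected with an event about [A_t] says that
[A_t] and [Y] are independent under [P] restricted to [B] and [{0 < Y}]. *)
Lemma integral_remaining_growth (B : set Omega) (f : R * R -> \bar R) : F t B ->
  measurable_fun setT f -> (forall z, 0 <= f z)%E ->
  (\int[P]_(w in B `&` [set w | (0 < Y w)%R]) f (A w t, Y w) =
   \int[P]_(w in B `&` [set w | (0 < Y w)%R]) \int[exp_law]_y f (A w t, y))%E.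
Proof.
move=> FB mf f0; have mB : measurable B := usual_sub hF t0 FB.
set C := B `&` _; have mC : measurable C by apply: measurableI => //; exact: measurable_growing.
have := @integral_independent _ Omega R (mrestr P mC) (fun w => A w t) Y exp_law f mA_t mY _ mf f0.
rewrite !ge0_integral_mrestr//.
- apply=> A1 A2 mA1 mA2; rewrite /mrestr.
  have FB' : F t (B `&` ((fun w => A w t) @^-1` A1)).
    have := @measurableI _ (g_sigma_algebraType (F t)) B ((fun w => A w t) @^-1` A1).
    rewrite !(measurable_filtrationE hF)//; apply=> //.
    exact: (dual_adapted hdual).
  have := remaining_growth_law FB' mA2.
  have E1 : ((fun w => A w t) @^-1` A1 `&` Y @^-1` A2) `&` C =
      B `&` ((fun w => A w t) @^-1` A1) `&` [set w | 0 < Y w] `&` Y @^-1` A2.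
    by rewrite /C; apply/seteqP; split=> w /=; tauto.
  have E2 : ((fun w => A w t) @^-1` A1) `&` C =
      B `&` ((fun w => A w t) @^-1` A1) `&` [set w | 0 < Y w].
    by rewrite /C; apply/seteqP; split=> w /=; tauto.
  by rewrite -E1 -E2.
- have mI : measurable_fun setT (fun a : measurableTypeR R => \int[exp_law]_y f (a, y))%E.
    exact: measurable_fun_fubini_tonelli_F.
  exact: (measurableT_comp mI mA_t).
- by move=> w; exact: integral_ge0.
- by apply: measurableT_comp => //; exact: measurable_fun_pair.
Qed.

End remaining_growth.

(** * Riemann sums *)

Section riemann.
Context {R : realType} (f : cumulative R R).
Hypotheses (f_lt0 : forall t, t < 0 -> f t = 0) (fy : (total_mass f < +oo)%E)
  (fg : gapless f).
Local Notation mu := (lebesgue_stieltjes_measure f).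

Definition grid_cell (n k : nat) : set R :=
  `[0, +oo[%classic `&` `](k%:R - 1) / n.+1%:R, k%:R / n.+1%:R]%classic.

(** The integrand is evaluated at the right end of each cell, a time at which the
increment of [f] over the cell is already known. *)
Definition grid_sum (n : nat) (x : R -> R) : \bar R :=
  (\sum_(k <oo) (x (k%:R / n.+1%:R) *
     (f (k%:R / n.+1%:R) - f ((k%:R - 1) / n.+1%:R)))%R%:E)%E.

Lemma grid_cellP n k s : grid_cell n k s <-> 0 <= s /\ grid_index n s = k.
Proof.
rewrite /grid_cell /= !in_itv/= andbT; split=> [[s0]|[s0 <-]].
  by rewrite -grid_indexE// => /eqP.
by rewrite -grid_indexE.
Qed.

Lemma bigcup_grid_cell n : \bigcup_k grid_cell n k = `[0, +oo[%classic.
Proof.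
apply/seteqP; split=> s /=; first by move=> [k _ []].
move=> s0; exists (grid_index n s) => //; apply/grid_cellP; split=> //.
by move: s0; rewrite in_itv/= andbT.
Qed.

Lemma trivIset_grid_cell n : trivIset setT (grid_cell n).
Proof. by move=> i j _ _ [s [/grid_cellP[_ <-] /grid_cellP[_ <-]]]. Qed.

Lemma measurable_grid_cell n k : measurable (grid_cell n k).
Proof. exact: measurableI. Qed.

Lemma stieltjes_grid_cell n k :
  mu (grid_cell n k) = (f (k%:R / n.+1%:R) - f ((k%:R - 1) / n.+1%:R))%:E.
Proof.
have n0 : 0 < n.+1%:R :> R by [].
have le : (k%:R - 1) / n.+1%:R <= k%:R / n.+1%:R :> R.
  by rewrite ler_pM2r ?invr_gt0// gerDl lerN10.
have mu_le : (mu (grid_cell n k) <= mu `]((k%:R - 1) / n.+1%:R)%R, (k%:R / n.+1%:R)%R]%classic)%E.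
  apply: le_measure; rewrite ?inE; [exact: measurable_grid_cell|exact: measurable_itv|].
  exact: subIsetr.
case: k => [|k] in le mu_le *.
  move: mu_le; rewrite stieltjes_itvoc// mul0r (gapless0 f_lt0 fg) (_ : f ((0 - 1) / _) = 0).
    by rewrite subr0 => h; apply/eqP; rewrite eq_le h measure_ge0.
  by apply: f_lt0; rewrite sub0r mulN1r oppr_lt0 invr_gt0.
rewrite -stieltjes_itvoc//; congr (mu _); apply/setIidr => s /=.
rewrite !in_itv/= andbT => /andP[h _]; apply: le_trans (ltW h).
by rewrite divr_ge0// -[k.+1]addn1 natrD addrK.
Qed.

(** The sum is the integral of the discretized integrand, which is constant on
every cell. *)
Lemma grid_sumE n (x : R -> R) : (forall s, 0 <= x s) ->
  measurable_fun (`[0, +oo[%classic : set R) (fun s => (x (grid n s))%:E) /\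
  grid_sum n x = (\int[mu]_(s in `[0%R, +oo[) (x (grid n s))%:E)%E.
Proof.
move=> x0.
have cell k s : grid_cell n k s -> x (grid n s) = x (k%:R / n.+1%:R).
  by move=> /grid_cellP[_ <-].
have mx : measurable_fun (\bigcup_k grid_cell n k) (fun s => (x (grid n s))%:E).
  apply/measurable_fun_bigcup => k; first exact: measurable_grid_cell.
  apply: (@eq_measurable_fun _ _ _ _ _ (cst (x (k%:R / n.+1%:R))%:E)); last exact: measurable_cst.
  by move=> s; rewrite inE => /cell ->.
split; first by rewrite -(bigcup_grid_cell n).
rewrite -(bigcup_grid_cell n) ge0_integral_bigcup//; last 3 first.
- by move=> k; exact: measurable_grid_cell.
- by move=> s _; rewrite lee_fin.
- exact: trivIset_grid_cell.
apply: eq_eseriesr => k _.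
rewrite EFinM -stieltjes_grid_cell -integral_cst; last exact: measurable_grid_cell.
by apply: eq_integral => s; rewrite inE => /cell ->.
Qed.

Lemma grid_sum_ge0 n (x : R -> R) : (forall s, 0 <= x s) -> (0 <= grid_sum n x)%E.
Proof.
move=> x0; apply: nneseries_ge0 => k _ _; rewrite lee_fin mulr_ge0// subr_ge0.
apply: (cumulative_is_nondecreasing f).
by rewrite ler_pM2r ?invr_gt0// gerDl lerN10.
Qed.

Lemma grid_sum_le n (x : R -> R) : (forall s, 0 <= x s <= 1) ->
  (grid_sum n x <= (fine (total_mass f))%:E)%E.
Proof.
move=> x01; have x0 s : 0 <= x s by case/andP: (x01 s).
rewrite (grid_sumE n x0).2 -(stieltjes_itvcy f_lt0 fy fg).
rewrite -[leRHS]mul1e -integral_cst//.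
apply: ge0_le_integral => //.
- by move=> s _; rewrite lee_fin.
- exact: (grid_sumE n x0).1.
- by move=> s _; rewrite lee_fin; case/andP: (x01 (grid n s)).
Qed.

Lemma cvg_grid_sum (x : R -> R) : (forall s, 0 <= x s <= 1) ->
  (forall s, 0 <= s -> x (grid n s) @[n --> \oo] --> x s) ->
  grid_sum n x @[n --> \oo] --> (\int[mu]_(s in `[0%R, +oo[) (x s)%:E)%E.
Proof.
move=> x01 xr; have x0 s : 0 <= x s by case/andP: (x01 s).
under eq_fun do rewrite (grid_sumE _ x0).2.
apply: (@dominated_cvg _ _ _ mu `[0, +oo[%classic _ (fun n s => (x (grid n s))%:E)
  (fun s => (x s)%:E) (cst 1%E)).
- exact: measurable_itv.
- by move=> n; exact: (grid_sumE n x0).1.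
- move=> s; rewrite /= in_itv/= andbT => s0.
  by apply: cvg_EFin; [exact: nearW|exact: xr].
- by [].
- apply/integrableP; split; first exact: measurable_cst.
  under eq_integral do rewrite /= normr1.
  rewrite integral_cst; last exact: measurable_itv.
  by rewrite mul1e [X in (X < _)%E](stieltjes_itvcy f_lt0 fy fg) ltry.
- by move=> n s _; rewrite lee_fin ger0_norm//; case/andP: (x01 (grid n s)).
Qed.

End riemann.

(** [U] and [V] are densities of two measures on [G], which the hypothesis orders;
[W] is integrated against them. *)
Lemma weighted_le d (Omega : measurableType d) (R : realType) (P : probability Omega R)
    (G : set (set Omega)) (U V W : Omega -> R) :
  sigma_algebra setT G -> G `<=` measurable ->
  measurable_fun setT U -> measurable_fun setT V -> measurable_for G W ->
  (forall w, 0 <= U w) -> (forall w, 0 <= V w) -> (forall w, 0 <= W w) ->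
  (forall B, G B -> \int[P]_(w in B) (U w)%:E <= \int[P]_(w in B) (V w)%:E)%E ->
  (\int[P]_w (U w * W w)%:E <= \int[P]_w (V w * W w)%:E)%E.
Proof.
move=> sG GM mU mV mW U0 V0 W0 UV.
pose id' : Omega -> g_sigma_algebraType G := id.
have GE B : measurable (B : set (g_sigma_algebraType G)) = G B.
  by rewrite measurable_g_measurableTypeE.
have mid : measurable_fun setT id'.
  by move=> _ B; rewrite GE setTI => /GM.
have mW' : measurable_fun setT (W : g_sigma_algebraType G -> R).
  by move=> _ B mB; rewrite GE setTI; exact: mW.
pose nu (X : Omega -> R) (X0 : forall w, 0 <= X w) (mX : measurable_fun setT X) :
    {measure set (g_sigma_algebraType G) -> \bar R} :=
  measure_function_pushforward__canonical__measure_function_Measure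
    (mdensity P X0 mX) mid.
have nuE X X0 mX : (\int[P]_w (X w * W w)%:E = \int[nu X X0 mX]_w (W w)%:E)%E.
  rewrite (ge0_integral_pushforward mid)//; last 2 first.
  - by apply/measurable_EFinP.
  - by move=> w _; rewrite lee_fin.
  rewrite ge0_integral_mdensity//.
  - by apply: eq_integral => w _; rewrite EFinM muleC.
  - apply/measurable_EFinP => _ B mB; rewrite setTI; apply: GM; exact: mW.
rewrite (nuE U U0 mU) (nuE V V0 mV); apply: ge0_le_measure_integral => //.
- by move=> B; rewrite GE => GB; exact: UV.
- exact/measurable_EFinP.
Qed.

(** * Conditional expectations of phi A_infty *)

Section terminal_value.
Context d (Omega : measurableType d) (R : realType) (P : probability Omega R).
Variables (F : R -> set (set Omega)) (L : Omega -> \bar R) (A : Omega -> cumulative R R).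
Hypotheses (hF : usual_filtration P F) (hL : honest_time P F L) (hA : condition_A P F L)
  (hdual : dual_optional_projection P F L A).

Lemma dual_ge0 w t : 0 <= A w t.
Proof. by apply: cumulative_ge0 => u; exact: (dual_lt0 hdual). Qed.

Lemma A_infty_ge0 w : 0 <= A_infty A w.
Proof.
apply: fine_ge0; apply: le_trans (total_mass_ge (A w) 0).
by rewrite lee_fin dual_ge0.
Qed.

Let growing t := [set w | 0 < A_infty A w - A w t].

Lemma integral_growing_ge0 (phi : R -> R) t B :
  {within `[0, +oo[, continuous phi} ->
  (\int[lebesgue_measure]_(x in `[0%R, +oo[) (`|phi x| * expR (- x))%:E < +oo)%E ->
  (forall x, 0 <= x -> 0 <= phi x) -> 0 <= t -> F t B ->
  (\int[P]_(w in B `&` growing t) (half_ext phi (A_infty A w))%:E =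
   \int[P]_(w in B `&` growing t) (phi_hat phi (A w t))%:E)%E.
Proof.
move=> cphi iphi phi0 t0 FB.
have h0 x : 0 <= half_ext phi x by rewrite phi0// le_max lexx orbT.
pose f (z : R * R) := (half_ext phi (z.1 + z.2))%:E.
have mf : measurable_fun setT f.
  apply/measurable_EFinP; apply: measurableT_comp; first exact: measurable_half_ext.
  by apply: measurable_funD; [exact: measurable_fst|exact: measurable_snd].
have := integral_remaining_growth hF hL hA hdual t0 FB mf (fun z => h0 _).
rewrite /f/= => IE; transitivity (\int[P]_(w in B `&` growing t)
    (half_ext phi (A w t + (A_infty A w - A w t)))%:E)%E.
  by apply: eq_integral => w _; rewrite addrC subrK.
rewrite IE; apply: eq_integral => w _.
by rewrite integral_exp_law_half_ext// dual_ge0.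
Qed.

Lemma phi_hat_ge0 (phi : R -> R) a : (forall x, 0 <= x -> 0 <= phi x) -> 0 <= a ->
  0 <= phi_hat phi a.
Proof.
move=> phi0 a0; rewrite /phi_hat mulr_ge0 ?expR_ge0//.
apply: Rintegral_ge0 => y; rewrite /= in_itv/= andbT => ay.
by rewrite mulr_ge0 ?expR_ge0// phi0// (le_trans a0).
Qed.

Lemma measurable_for_phi_hat (phi : R -> R) t :
  {within `[0, +oo[, continuous phi} ->
  (\int[lebesgue_measure]_(x in `[0%R, +oo[) (`|phi x| * expR (- x))%:E < +oo)%E ->
  0 <= t -> measurable_for (F t) (fun w => phi_hat phi (A w t)).
Proof.
move=> cphi iphi t0; apply/(measurable_forP hF _ t0).
apply: (@eq_measurable_fun _ _ (g_sigma_algebraType (F t)) _ _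
  (fun w => phi_hat phi (Num.max (A w t) 0))).
  by move=> w _; rewrite max_l// dual_ge0.
apply: (@measurableT_comp _ _ _ _ _ _ (fun a : R => phi_hat phi (Num.max a 0))).
  by apply: continuous_measurable_fun; exact: phi_hat_continuous.
by apply/(measurable_forP hF _ t0); exact: (dual_adapted hdual).
Qed.

Section continuous_function.
Variable phi : R -> R.
Hypothesis phi_cont : {within `[0, +oo[, continuous phi}.
Hypothesis phi_int :
  (\int[lebesgue_measure]_(x in `[0%R, +oo[) (`|phi x| * expR (- x))%:E < +oo)%E.

Let absphi x := `|phi x|.

Let cabs : {within `[0, +oo[, continuous absphi}.
Proof.
apply/subspace_continuousP => x x0.
have /subspace_continuousP/(_ x x0) h := phi_cont.
exact: (cvg_norm h).
Qed.

Let iabs :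
  (\int[lebesgue_measure]_(x in `[0%R, +oo[) (`|absphi x| * expR (- x))%:E < +oo)%E.
Proof. by under eq_integral do rewrite normr_id. Qed.

Lemma measurable_phi_A_infty : measurable_fun setT (fun w => half_ext phi (A_infty A w)).
Proof.
apply: measurableT_comp; first exact: measurable_half_ext.
exact: (measurable_A_infty hF hdual).
Qed.

(** At time 0, [A] vanishes: where [A] grows at all, [|phi| A_infty] has the same
integral as the constant [phi_hat |phi| 0]; elsewhere it is [|phi| 0]. *)
Lemma integrable_phi_A_infty :
  P.-integrable setT (fun w => (half_ext phi (A_infty A w))%:E).
Proof.
apply/integrableP; split; first by apply/measurable_EFinP; exact: measurable_phi_A_infty.
have mg : measurable (growing 0) := measurable_growing hF hdual (lexx 0).
have h0 x : 0 <= half_ext absphi x by rewrite /half_ext normr_ge0.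
have mabs : measurable_fun setT (fun w => (half_ext absphi (A_infty A w))%:E).
  apply/measurable_EFinP; apply: measurableT_comp; first exact: measurable_half_ext.
  exact: (measurable_A_infty hF hdual).
rewrite [X in (X < _)%E](_ : _ = \int[P]_(w in growing 0 `|` ~` growing 0)
    (half_ext absphi (A_infty A w))%:E)%E; last first.
  by rewrite setUv; apply: eq_integral.
rewrite ge0_integral_setU//; last 4 first.
- exact: measurableC.
- by rewrite setUv.
- by move=> w _; rewrite lee_fin.
- by apply/disj_setPCl.
have gen := dual_generic hF hL hA hdual.
have lt0 w := fun t => @dual_lt0 _ _ _ _ _ _ _ hdual w t.
apply: lte_add_pinfty.
  rewrite -[X in integral _ X](setTI (growing 0)) integral_growing_ge0//; last 2 first.
  - by move=> x _; exact: normr_ge0.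
  - exact: (filtrationT hF).
  rewrite setTI (@ge0_ae_eq_integral _ _ _ P (growing 0) _ (cst (phi_hat absphi 0)%:E)).
  - by rewrite integral_cst// ltey_eq fin_numM// fin_num_measure.
  - exact: mg.
  - apply/measurable_EFinP; apply: measurable_funTS.
    exact: (measurable_for_measurable hF (lexx 0) (measurable_for_phi_hat cabs iabs (lexx 0))).
  - exact: measurable_cst.
  - move=> w _; rewrite lee_fin; apply: phi_hat_ge0 => // [x _|].
      exact: normr_ge0.
    exact: dual_ge0.
  - move=> w _; rewrite lee_fin; apply: phi_hat_ge0 => // x _; exact: normr_ge0.
  - apply: filterS gen => w [_ gw _ _] _ /=.
    by rewrite (gapless0 (@lt0 w) gw).
rewrite (@ge0_ae_eq_integral _ _ _ P (~` growing 0) _ (cst (absphi 0)%:E)).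
- rewrite integral_cst; last exact: measurableC.
  by rewrite ltey_eq fin_numM// fin_num_measure//; exact: measurableC.
- exact: measurableC.
- exact: measurable_funTS.
- exact: measurable_cst.
- by move=> w _; rewrite lee_fin.
- by move=> w _; rewrite lee_fin /absphi.
apply: filterS gen => w [_ gw _ _] /= /negP; rewrite (gapless0 (@lt0 w) gw) subr0 -leNgt => A0.
have -> : A_infty A w = 0 by apply/eqP; rewrite eq_le A0 A_infty_ge0.
by rewrite /half_ext maxxx.
Qed.

End continuous_function.

Let intS (f : Omega -> \bar R) C : measurable C -> P.-integrable setT f -> P.-integrable C f.
Proof. by move=> mC h; apply: integrableS h. Qed.

Section signed_function.
Variable phi : R -> R.
Hypothesis phi_cont : {within `[0, +oo[, continuous phi}.
Hypothesis phi_int :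
  (\int[lebesgue_measure]_(x in `[0%R, +oo[) (`|phi x| * expR (- x))%:E < +oo)%E.

Let cp := continuous_pos_part phi_cont.
Let ip := pos_part_int phi_cont phi_int.
Let cn := continuous_pos_part (continuous_opp_within phi_cont).
Let in_ := pos_part_int (continuous_opp_within phi_cont) (opp_int phi_int).

Let xi (f : R -> R) w := half_ext f (A_infty A w).
Let psi (f : R -> R) t w := phi_hat f (A w t).

Let mC t B : 0 <= t -> F t B -> measurable (B `&` growing t).
Proof.
move=> t0 FB; apply: measurableI; first exact: (usual_sub hF t0).
exact: (measurable_growing hF hdual).
Qed.

Let integrable_psi_ge0 (f : R -> R) t B :
  {within `[0, +oo[, continuous f} ->
  (\int[lebesgue_measure]_(x in `[0%R, +oo[) (`|f x| * expR (- x))%:E < +oo)%E ->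
  (forall x, 0 <= x -> 0 <= f x) -> 0 <= t -> F t B ->
  P.-integrable (B `&` growing t) (EFin \o psi f t).
Proof.
move=> cf if_ f0 t0 FB; apply/integrableP; split.
  apply/measurable_EFinP; apply: measurable_funTS.
  exact: (measurable_for_measurable hF t0 (measurable_for_phi_hat cf if_ t0)).
under eq_integral => w _.
  rewrite /= ger0_norm; last by apply: phi_hat_ge0 => //; exact: dual_ge0.
  over.
rewrite -integral_growing_ge0//.
rewrite ltey_eq integrable_fin_num//; first exact: mC.
exact: (intS (mC t0 FB) (integrable_phi_A_infty cf if_)).
Qed.

Let pos_ge0 (f : R -> R) x : 0 <= x -> 0 <= pos_part f x.
Proof. by move=> _; rewrite /pos_part le_max lexx orbT. Qed.

Let xiE w : xi phi w = xi (pos_part phi) w - xi (pos_part (\- phi)) w.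
Proof.
rewrite /xi /half_ext /pos_part /=; set p := phi _; have [p0|p0] := leP p 0.
  by rewrite max_l ?oppr_ge0// sub0r opprK.
by rewrite max_r ?subr0// oppr_le0 ltW.
Qed.

Let psiE t w : psi phi t w = psi (pos_part phi) t w - psi (pos_part (\- phi)) t w.
Proof. by rewrite /psi phi_hat_pos_part// dual_ge0. Qed.

Lemma Rintegral_growing t B : 0 <= t -> F t B ->
  \int[P]_(w in B `&` growing t) xi phi w = \int[P]_(w in B `&` growing t) psi phi t w.
Proof.
move=> t0 FB; have mCB := mC t0 FB.
have hp := integrable_psi_ge0 cp ip (@pos_ge0 phi) t0 FB.
have hn := integrable_psi_ge0 cn in_ (@pos_ge0 (\- phi)) t0 FB.
have xp := intS mCB (integrable_phi_A_infty cp ip).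
have xn := intS mCB (integrable_phi_A_infty cn in_).
transitivity (\int[P]_(w in B `&` growing t) (xi (pos_part phi) w - xi (pos_part (\- phi)) w)).
  by apply: eq_Rintegral => w _; exact: xiE.
transitivity (\int[P]_(w in B `&` growing t)
    (psi (pos_part phi) t w - psi (pos_part (\- phi)) t w)); last first.
  by apply: eq_Rintegral => w _; rewrite -psiE.
rewrite !RintegralB//; congr (_ - _); congr fine.
- by apply: integral_growing_ge0 => // x x0; exact: pos_ge0.
- by apply: integral_growing_ge0 => // x x0; exact: pos_ge0.
Qed.

(** Where [A] still grows after [t], [M] and [phi_hat phi A_t] have equal
integrals. Where it does not, [A_infty = A_t], so that [phi A_infty] and
[phi_hat phi A_t] are both bounded by [k]. *)
Lemma cond_expectation_growing t B (M : Omega -> R) (m k : R) :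
  0 <= t -> 0 <= k -> F t B -> (forall w, B w -> A w t <= m) ->
  (forall a, 0 <= a <= m -> `|phi a| <= k /\ `|phi_hat phi a| <= k) ->
  cond_expectation P (F t) (phi \o A_infty A) M ->
  P.-integrable B (EFin \o (fun w => M w - phi_hat phi (A w t))) /\
  `|\int[P]_(w in B) (M w - phi_hat phi (A w t))| <= 2 * k * fine (P (B `\` growing t)).
Proof.
move=> t0 k0 FB Bm mk [_ mM iM IM].
have mB : measurable B := usual_sub hF t0 FB.
have mCB := mC t0 FB.
have mg : measurable (growing t) := measurable_growing hF hdual t0.
have mD : measurable (B `\` growing t) by exact: measurableD.
have BE : B = (B `&` growing t) `|` (B `\` growing t) by rewrite setUIDK.
have dj : [disjoint B `&` growing t & B `\` growing t].
  by apply/disj_setPS => w [[_ gw] [_]].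
have mpsi : measurable_fun setT (psi phi t).
  exact: (measurable_for_measurable hF t0 (measurable_for_phi_hat phi_cont phi_int t0)).
have ixi C : measurable C -> P.-integrable C (EFin \o xi phi).
  by move=> mC'; exact: (intS mC' (integrable_phi_A_infty phi_cont phi_int)).
have ipsiB : P.-integrable B (EFin \o psi phi t).
  apply: measurable_bounded_integrable => //.
  - by rewrite (le_lt_trans (probability_le1 P mB))// ltry.
  - exact: measurable_funTS.
  exists k; split; first exact: num_real.
  move=> y ky w Bw /=; apply: (le_trans _ (ltW ky)).
  by apply: (mk _ _).2; rewrite dual_ge0 Bm.
have ipsiD : P.-integrable (B `\` growing t) (EFin \o psi phi t).
  by apply: integrableS ipsiB => //; exact: subDsetl.
have iMB : P.-integrable B (EFin \o M) by exact: (intS mB iM).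
have MB : \int[P]_(w in B) M w = \int[P]_(w in B) xi phi w.
  rewrite /Rintegral IM//; congr fine; apply: eq_integral => w _.
  by rewrite /xi half_extE// A_infty_ge0.
split; first by have := integrableB mB iMB ipsiB; apply: eq_integrable.
rewrite RintegralB// MB {1 2}BE !Rintegral_setU//; last 2 first.
- by rewrite -BE.
- by rewrite -BE; exact: ixi.
rewrite Rintegral_growing// opprD addrACA subrr add0r -RintegralB//; last exact: ixi.
have iD : P.-integrable (B `\` growing t) (EFin \o (fun w => xi phi w - psi phi t w)).
  have := integrableB mD (ixi _ mD) ipsiD; apply: eq_integrable => //.
apply: (le_trans (le_normr_Rintegral mD iD)).
have iDn := integrable_norm iD.
rewrite -[2 * k]/(fine ((2 * k)%:E)) -fineM//; last by rewrite fin_num_measure.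
rewrite -integral_cst//; apply: fine_le.
- exact: (integrable_fin_num mD iDn).
- by rewrite integral_cst// fin_numM// fin_num_measure.
apply: ae_ge0_le_integral => //.
- exact: (measurable_int P).
- by move=> w _; rewrite lee_fin mulr_ge0.
apply: filterS (dual_generic hF hL hA hdual) => w [ty gw AL _] [Bw /negP].
rewrite -leNgt subr_le0 => AA; rewrite lee_fin.
have AE : A_infty A w = A w t.
  apply/eqP; rewrite eq_le AA /A_infty.
  by apply: le_total_mass => // u; exact: (dual_lt0 hdual).
have Am : 0 <= A w t <= m by rewrite dual_ge0 Bm.
have [h1 h2] := mk _ Am.
rewrite /xi /psi half_extE ?A_infty_ge0// AE (le_trans (ler_normB _ _))//.
by rewrite mulr2n mulrDl mul1r lerD.
Qed.

End signed_function.

End terminal_value.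

(** * The value of the martingale at L *)

Section value_at_L.
Context d (Omega : measurableType d) (R : realType) (P : probability Omega R).
Variables (F : R -> set (set Omega)) (L : Omega -> \bar R) (A : Omega -> cumulative R R).
Hypotheses (hF : usual_filtration P F) (hL : honest_time P F L) (hA : condition_A P F L)
  (hdual : dual_optional_projection P F L A).
Variable phi : R -> R.
Hypothesis phi_cont : {within `[0, +oo[, continuous phi}.
Hypothesis phi_int :
  (\int[lebesgue_measure]_(x in `[0%R, +oo[) (`|phi x| * expR (- x))%:E < +oo)%E.
Variable M : R -> Omega -> R.
Hypotheses (M_cadlag : forall w, cadlag (M ^~ w))
  (M_cond : forall t, 0 <= t -> cond_expectation P (F t) (phi \o A_infty A) (M t)).

Let psi (a : R) := phi_hat phi (Num.max a 0).

Let psi_cont : continuous psi := phi_hat_continuous phi_cont phi_int.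

Let psiE w t : psi (A w t) = phi_hat phi (A w t).
Proof. by rewrite /psi max_l// (dual_ge0 hdual). Qed.

(** Restricts attention to the times when [A] is at most [m], where [phi] and
[phi_hat phi] are bounded. *)
Definition cutoff (m a : R) := Num.max (Num.min (m - a) 1) 0.

Lemma cutoff01 m a : 0 <= cutoff m a <= 1.
Proof. by rewrite /cutoff le_max lexx orbT/= ge_max ler01 andbT ge_min lexx orbT. Qed.

Lemma cutoff_eq0 m a : m <= a -> cutoff m a = 0.
Proof. by move=> ma; rewrite /cutoff max_r// ge_min subr_le0 ma. Qed.

Lemma cutoff_eq1 m a : a + 1 <= m -> cutoff m a = 1.
Proof.
move=> am; rewrite /cutoff min_r; last by rewrite lerBrDl.
by rewrite max_l.
Qed.

Lemma continuous_cutoff m : continuous (cutoff m).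
Proof.
move=> a; apply: (@continuous_max R R^o (fun a => Num.min (m - a) 1) (fun=> 0)).
  apply: (@continuous_min R R^o (fun a => m - a) (fun=> 1)); last exact: cvg_cst.
  by apply: cvgB; [exact: cvg_cst|exact: cvg_id].
exact: cvg_cst.
Qed.

(** Bounded and right-continuous, so that the Riemann sums of [H m] converge and
the duality formula applies to it. *)
Let H (m t : R) (w : Omega) := cutoff m (A w t) * Num.min `|M t w - psi (A w t)| 1.

Let H01 m t w : 0 <= H m t w <= 1.
Proof.
have /andP[c0 c1] := cutoff01 m (A w t).
have m0 : 0 <= Num.min `|M t w - psi (A w t)| 1 by rewrite le_min normr_ge0 ler01.
rewrite /H mulr_ge0//= -[leRHS]mulr1 ler_pM// ge_min lexx orbT//.
Qed.

Let M_optional : optional_process F M.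
Proof.
by apply: optional_cadlag => // t t0; have [] := M_cond t0.
Qed.

Let H_comp d' (T : measurableType d') (a x : T -> R) m :
  measurable_fun setT a -> measurable_fun setT x ->
  measurable_fun setT (fun z => cutoff m (a z) * Num.min `|x z - psi (a z)| 1).
Proof.
move=> ma mx; apply: measurable_funM.
  apply: (measurableT_comp _ ma).
  by apply: continuous_measurable_fun; exact: continuous_cutoff.
apply: measurable_minr => //; apply: measurableT_comp => //.
apply: measurable_funB => //; apply: (measurableT_comp _ ma).
exact: continuous_measurable_fun.
Qed.

Let H_optional m : optional_process F (H m).
Proof.
apply/optional_processP; apply: H_comp.
  by have /optional_processP := optional_dual hdual.
by have /optional_processP := M_optional.
Qed.

Let mH m t : 0 <= t -> measurable_fun setT (H m t).
Proof.
move=> t0; apply: H_comp; first exact: (measurable_dual hF hdual).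
by apply: (measurable_for_measurable hF t0); have [] := M_cond t0.
Qed.

Let H_grid m w s : 0 <= s -> H m (grid n s) w @[n --> \oo] --> H m s w.
Proof.
move=> s0; apply: (@cvg_grid _ (fun u => H m u w)) => //.
have cA := cumulative_is_right_continuous (A w) s.
have cM := (M_cadlag w).1 s s0.
apply: cvgM.
  exact: (cvg_comp _ _ cA (@continuous_cutoff m (A w s))).
have cc : M u w - psi (A w u) @[u --> s^'+] --> M s w - psi (A w s).
  by apply: cvgB => //; exact: (cvg_comp _ _ cA (@psi_cont (A w s))).
have cmin : continuous (fun x : R => Num.min `|x| 1).
  move=> x; apply: (@continuous_min R R^o (fun x => `|x|) (fun=> 1)); last exact: cvg_cst.
  exact: norm_continuous.
exact: (cvg_comp _ _ cc (@cmin _)).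
Qed.

Let growing t := [set w | 0 < A_infty A w - A w t].

Let bound m : 0 <= m -> exists2 k, 0 <= k &
  forall a, 0 <= a <= m -> `|phi a| <= k /\ `|phi_hat phi a| <= k.
Proof.
move=> m0.
have bnd (f : R -> R) : continuous f -> exists k, forall a, 0 <= a <= m -> `|f a| <= k.
  move=> cf; have [|c _ hc] := @EVT_max R (fun a => `|f a|) 0 m m0.
    apply: continuous_subspaceT => x; apply: continuous_comp; first exact: cf.
    exact: norm_continuous.
  by exists `|f c| => a am; apply: hc; rewrite in_itv.
have [k1 h1] := bnd _ (continuous_half_ext phi_cont).
have [k2 h2] := bnd _ psi_cont.
exists (Num.max k1 k2).
  by rewrite le_max (le_trans (normr_ge0 _) (h1 0 _))// lexx.
move=> a /[dup] am /andP[a0 _]; rewrite !le_max.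
have := h1 a am; rewrite half_extE// => ->.
by have := h2 a am; rewrite /psi max_l// => ->; rewrite orbT.
Qed.

(** The sign of [M_t - phi_hat phi A_t] is known at time [t]: the absolute value
is integrated by applying [cond_expectation_growing] to the part of [B] where
the difference is nonnegative and to the part where it is negative. *)
Let H_le m k t B : 0 <= t -> 0 <= k ->
  (forall a, 0 <= a <= m -> `|phi a| <= k /\ `|phi_hat phi a| <= k) -> F t B ->
  (\int[P]_(w in B) (H m t w)%:E <=
   \int[P]_(w in B) (2 * k * \1_(~` growing t) w)%:E)%E.
Proof.
move=> t0 k0 mk FB.
have mg : measurable (growing t) := measurable_growing hF hdual t0.
have mB : measurable B := usual_sub hF t0 FB.
pose f w := M t w - phi_hat phi (A w t).
have mf : measurable_for (F t) f.
  apply/(measurable_forP hF _ t0); apply: measurable_funB.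
    by apply/(measurable_forP hF _ t0); have [] := M_cond t0.
  by apply/(measurable_forP hF _ t0); exact: (measurable_for_phi_hat hF hdual).
have sI X Z : F t X -> F t Z -> F t (X `&` Z).
  by rewrite -!(measurable_filtrationE hF _ t0); exact: measurableI.
pose Bm := B `&` [set w | A w t <= m].
have FBm : F t Bm.
  apply: sI => //; have := dual_adapted hdual t0 (measurable_itv `]-oo, m]).
  by congr (F t _); apply/seteqP; split=> w /=; rewrite in_itv.
have Fp : F t (Bm `&` [set w | 0 <= f w]).
  apply: sI => //; have := mf _ (measurable_itv `[0, +oo[).
  by congr (F t _); apply/seteqP; split=> w /=; rewrite in_itv/= andbT.
have Fn : F t (Bm `&` [set w | f w < 0]).
  apply: sI => //; have := mf _ (measurable_itv `]-oo, 0[).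
  by congr (F t _); apply/seteqP; split=> w /=; rewrite in_itv.
set Bp := Bm `&` _ in Fp; set Bn := Bm `&` _ in Fn.
have mp : measurable Bp := usual_sub hF t0 Fp.
have mn : measurable Bn := usual_sub hF t0 Fn.
have mm : measurable Bm := usual_sub hF t0 FBm.
have [ip lep] := cond_expectation_growing hF hL hA hdual phi_cont phi_int t0 k0 Fp
  (fun w (Bw : Bp w) => Bw.1.2) mk (M_cond t0).
have [in_ len] := cond_expectation_growing hF hL hA hdual phi_cont phi_int t0 k0 Fn
  (fun w (Bw : Bn w) => Bw.1.2) mk (M_cond t0).
have mft : measurable_fun setT f := measurable_for_measurable hF t0 mf.
have mnf : measurable_fun setT (fun w => (`|f w|)%:E).
  by apply/measurable_EFinP; exact: measurableT_comp.
have BmE : Bm = Bp `|` Bn.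
  apply/seteqP; split=> w; last by case=> -[].
  by move=> Bw; have [f0|f0] := leP 0 (f w); [left|right].
apply: (@le_trans _ _ (\int[P]_(w in Bm) (`|f w|)%:E)%E).
  rewrite integral_mkcond [leRHS]integral_mkcond.
  apply: ge0_le_integral_any => w; rewrite !patchE.
    by case: ifP => // _; rewrite lee_fin; case/andP: (H01 m t w).
  case: (boolP (w \in B)) => [/set_mem Bw|Bw]; last first.
    by case: ifP => // _; rewrite lee_fin.
  have [Am|Am] := leP (A w t) m.
    rewrite ifT; last by apply/mem_set.
    rewrite lee_fin /H psiE -[leRHS]mul1r; apply: ler_pM.
    - by case/andP: (cutoff01 m (A w t)).
    - by rewrite le_min normr_ge0 ler01.
    - by case/andP: (cutoff01 m (A w t)).
    - by rewrite ge_min lexx.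
  rewrite ifF; last by apply/negbTE/negP => /set_mem[_ /=]; rewrite leNgt Am.
  by rewrite /H cutoff_eq0 ?mul0r// ltW.
have djs : [disjoint Bp & Bn].
  by apply/disj_setPS => w [[_ /= f0] [_ /=]]; rewrite ltNge f0.
rewrite BmE ge0_integral_setU//; last by rewrite -BmE; exact: measurable_funTS.
have absE C : measurable C -> P.-integrable C (EFin \o f) ->
    (forall w, C w -> 0 <= f w) \/ (forall w, C w -> f w < 0) ->
    (\int[P]_(w in C) (`|f w|)%:E = (`|\int[P]_(w in C) f w|)%:E)%E.
  move=> mC iC [s|s].
    rewrite ger0_norm ?Rintegral_ge0// /Rintegral fineK; last exact: integrable_fin_num.
    by apply: eq_integral => w; rewrite inE => /s f0; rewrite ger0_norm.
  rewrite -normrN -[X in `|X|]mulN1r -RintegralZl//.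
  rewrite ger0_norm; last first.
    by apply: Rintegral_ge0 => w /s f0; rewrite mulN1r oppr_ge0 ltW.
  rewrite /Rintegral fineK; last first.
    apply: integrable_fin_num => //.
    by have := integrableZl mC (-1) iC; apply: eq_integrable.
  by apply: eq_integral => w; rewrite inE => /s f0; rewrite ltr0_norm// mulN1r.
rewrite !absE//; [|by right => w []|by left => w []].
apply: (@le_trans _ _ ((2 * k)%:E * (P (Bp `\` growing t) + P (Bn `\` growing t)))%E).
  have e X : measurable X -> P X = (fine (P X))%:E.
    by move=> mX; rewrite fineK// fin_num_measure.
  rewrite [in leRHS](e _ (measurableD mp mg)) [in leRHS](e _ (measurableD mn mg)).
  by rewrite -!EFinD -EFinM lee_fin mulrDr lerD.
have -> : (\int[P]_(w in B) (2 * k * \1_(~` growing t) w)%:E = (2 * k)%:E * P (B `\` growing t))%E.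
  under eq_integral do rewrite EFinM.
  rewrite ge0_integralZl_EFin//; last 2 first.
  - by apply/measurable_EFinP; apply: measurable_indic; exact: measurableC.
  - exact: mulr_ge0.
  have mgC := measurableC mg.
  by rewrite integral_indic// setIC -setDE.
rewrite lee_wpmul2l//; first by rewrite lee_fin mulr_ge0.
rewrite -measureU; [|exact: measurableD|exact: measurableD|]; last first.
  apply/disj_set2P/disj_setPS => w [[Bpw _] [Bnw _]].
  by have /disj_setPS := djs; apply; split; eassumption.
apply: le_measure; rewrite ?inE; [by apply: measurableU; exact: measurableD|exact: measurableD|].
by move=> w [[[[Bw _] _] gw]|[[[Bw _] _] gw]].
Qed.

Let step (n k : nat) w := A w (k%:R / n.+1%:R) - A w ((k%:R - 1) / n.+1%:R).

Let step_ge0 n k w : 0 <= step n k w.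
Proof.
rewrite subr_ge0 (cumulative_is_nondecreasing (A w))//.
by rewrite ler_pM2r ?invr_gt0// gerDl lerN10.
Qed.

Let time_ge0 n k : 0 <= k%:R / n.+1%:R :> R. Proof. by rewrite divr_ge0. Qed.

Let step_measurable n k : measurable_for (F (k%:R / n.+1%:R)) (step n k).
Proof.
have t0 := time_ge0 n k.
apply/(measurable_forP hF _ t0); apply: measurable_funB.
  by apply/(measurable_forP hF _ t0); exact: (dual_adapted hdual).
apply/(measurable_forP hF _ t0).
have [s0|s0] := leP 0 ((k%:R - 1) / n.+1%:R : R).
  apply: (measurable_for_le hF s0); last exact: (dual_adapted hdual).
  by rewrite ler_pM2r ?invr_gt0// gerDl lerN10.
rewrite (_ : (fun w => _) = cst 0); last by apply/funext => w; exact: (dual_lt0 hdual).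
by apply/(measurable_forP hF _ t0); exact: measurable_cst.
Qed.

Let mstep n k : measurable_fun setT (step n k).
Proof. exact: (measurable_for_measurable hF (time_ge0 n k) (@step_measurable n k)). Qed.

Let stopped t w : R := \1_(~` growing t) w.

Let mstopped t : 0 <= t -> measurable_fun setT (stopped t).
Proof.
move=> t0; apply: measurable_indic; apply: measurableC.
exact: (measurable_growing hF hdual).
Qed.

Let integral_grid_sum (X : R -> Omega -> R) n :
  (forall t, 0 <= t -> measurable_fun setT (X t)) -> (forall t w, 0 <= X t w) ->
  measurable_fun setT (fun w => grid_sum (A w) n (X ^~ w)) /\
  (\int[P]_w grid_sum (A w) n (X ^~ w) =
   \sum_(k <oo) \int[P]_w (X (k%:R / n.+1%:R)%R w * step n k w)%:E)%E.
Proof.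
move=> mX X0.
have mk k : measurable_fun setT (fun w => (X (k%:R / n.+1%:R) w * step n k w)%:E).
  by apply/measurable_EFinP; apply: measurable_funM => //; exact: mX.
have k0 k w : setT w -> (0 <= (X (k%:R / n.+1%:R)%R w * step n k w)%:E)%E.
  by move=> _; rewrite lee_fin mulr_ge0.
split; last exact: integral_nneseries.
by apply: ge0_emeasurable_sum => // k w _ _; exact: k0.
Qed.

(** The increments of [A] are measurable at the right end of their cell, so they
may weight the inequality [H_le] for that time. *)
Let grid_estimate m k n : 0 <= k ->
  (forall a, 0 <= a <= m -> `|phi a| <= k /\ `|phi_hat phi a| <= k) ->
  (\int[P]_w grid_sum (A w) n (H m ^~ w) <=
   \int[P]_w ((2 * k)%:E * grid_sum (A w) n (stopped ^~ w)))%E.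
Proof.
move=> k0 mk.
have s0 t w : 0 <= stopped t w by [].
have H0 t w : 0 <= H m t w by case/andP: (H01 m t w).
have [ms es] := integral_grid_sum n mstopped s0.
have [mh eh] := integral_grid_sum n (@mH m) H0.
have k20 : 0 <= 2 * k by rewrite mulr_ge0.
rewrite ge0_integralZl_EFin//; last first.
  by move=> w _; exact: grid_sum_ge0.
rewrite es eh -nneseriesZl//; last first.
  by move=> j _; apply: integral_ge0 => w _; rewrite lee_fin mulr_ge0.
apply: lee_nneseries => j *.
  by apply: integral_ge0 => w _; rewrite lee_fin mulr_ge0.
have t0 := time_ge0 n j.
rewrite -ge0_integralZl_EFin//; last 2 first.
- by move=> w _; rewrite lee_fin mulr_ge0.
- by apply/measurable_EFinP; apply: measurable_funM => //; exact: mstopped.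
have -> : (\int[P]_w ((2 * k)%:E * (stopped (j%:R / n.+1%:R)%R w * step n j w)%:E) =
  \int[P]_w ((2 * k * stopped (j%:R / n.+1%:R)%R w)%R * step n j w)%:E)%E.
  by apply: eq_integral => w _; rewrite -EFinM mulrA.
apply: (weighted_le (usual_sigma hF t0) (usual_sub hF t0)) => //.
- exact: mH.
- by apply: measurable_funM => //; exact: mstopped.
- by move=> w; rewrite mulr_ge0.
- by move=> B FB; exact: H_le.
Qed.

Let lt0 w t : t < 0 -> A w t = 0. Proof. exact: (dual_lt0 hdual). Qed.

Let generic := dual_generic hF hL hA hdual.

Let integrable_A_infty : P.-integrable setT (EFin \o A_infty A).
Proof.
have mA : measurable_fun setT (EFin \o A_infty A).
  by apply/measurable_EFinP; exact: (measurable_A_infty hF hdual).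
apply/integrableP; split=> //.
under eq_integral do rewrite /= ger0_norm ?(A_infty_ge0 hdual)//.
have := dual_set hF hL hdual (@measurableT _ (g_sigma_algebraType (optional_trace F))).
rewrite -[X in P X]/setT probability_setT (ge0_ae_integral hF mA)//.
- by move=> ->; rewrite ltry.
- by move=> w; rewrite lee_fin (A_infty_ge0 hdual).
apply: filterS generic => w [ty gw _ _].
transitivity (lebesgue_stieltjes_measure (A w) `[0%R, +oo[%classic); last first.
  exact: (stieltjes_itvcy (@lt0 w) ty gw).
congr (lebesgue_stieltjes_measure (A w) _).
by apply/seteqP; split=> t /=; rewrite in_itv/= andbT => // -[].
Qed.

(** The sums are dominated by [A_infty], which has mean 1. *)
Let cvg_integral_grid_sum (X : R -> Omega -> R) (I : Omega -> \bar R) :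
  (forall t, 0 <= t -> measurable_fun setT (X t)) -> (forall t w, 0 <= X t w <= 1) ->
  (forall w s, 0 <= s -> X (grid n s) w @[n --> \oo] --> X s w) ->
  (forall w, I w = \int[lebesgue_stieltjes_measure (A w)]_(s in `[0%R, +oo[) (X s w)%:E)%E ->
  (\int[P]_w grid_sum (A w) n (X ^~ w))%E @[n --> \oo] --> (\int[P]_w I w)%E.
Proof.
move=> mX X01 Xr IE.
have X0 t w : 0 <= X t w by case/andP: (X01 t w).
have mS n := (integral_grid_sum n mX X0).1.
have cv : \forall w \ae P, grid_sum (A w) n (X ^~ w) @[n --> \oo] --> I w.
  apply: filterS generic => w [ty gw _ _]; rewrite IE.
  by apply: (cvg_grid_sum (@lt0 w)) => // s; exact: Xr.
have mI : measurable_fun setT I.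
  apply: (ae_measurable_fun (filtration_complete hF)
    (f := fun w => limn_esup (fun n => grid_sum (A w) n (X ^~ w)))).
    apply: filterS cv => w cw _; apply/esym.
    by have [] := cvg_limn_einf_sup cw.
  exact: measurable_fun_limn_esup.
have cvT : {ae P, forall w, setT w -> grid_sum (A w) n (X ^~ w) @[n --> \oo] --> I w}.
  by apply: filterS cv.
have bdT : {ae P, forall w n, setT w -> (`|grid_sum (A w) n (X ^~ w)| <= (EFin \o A_infty A) w)%E}.
  apply: filterS generic => w [ty gw _ _] n _.
  rewrite gee0_abs; last exact: grid_sum_ge0.
  exact: (grid_sum_le (@lt0 w)).
by have [] := dominated_convergence measurableT mS mI cvT integrable_A_infty bdT.
Qed.

Let cvg_stopped w s : 0 <= s -> stopped (grid n s) w @[n --> \oo] --> stopped s w.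
Proof.
move=> s0.
have stE u : stopped u w = if A_infty A w <= A w u then 1 else 0.
  rewrite /stopped indicE /growing in_setC; case: (boolP (w \in _)) => [|/negP].
    by rewrite inE/= subr_gt0 ltNge => /negbTE ->.
  by rewrite inE/= subr_gt0 ltNge => /negP/negPn ->.
rewrite stE; case: ifPn => h.
  apply: cvg_near_cst; apply: nearW => n; rewrite stE ifT// (le_trans h)//.
  by apply: (cumulative_is_nondecreasing (A w)); exact: grid_ge.
have cA := cvg_grid s0 (cumulative_is_right_continuous (A w) s).
apply: cvg_near_cst; near=> n; rewrite stE ifF//; apply/negbTE; rewrite -ltNge.
near: n; apply: (cvgr_lt _ cA); by rewrite ltNge.
Unshelve. all: by end_near. Qed.

(** As [A] is continuous, [dA] does not charge the times at which the final value
is attained. *)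
Let stieltjes_stopped : \forall w \ae P,
  (\int[lebesgue_stieltjes_measure (A w)]_(s in `[0%R, +oo[) (stopped s w)%:E = 0)%E.
Proof.
apply: filterS generic => w [ty gw _ _].
have stE : (fun s => (stopped s w)%:E) = (fun s => (\1_[set s | A_infty A w <= A w s] s)%:E).
  apply/funext => s; rewrite /stopped !indicE.
  suff -> : (w \in ~` growing s) = (s \in [set s | A_infty A w <= A w s]) by [].
  apply/idP/idP => /set_mem /=; rewrite /growing/= => h; apply/mem_set => /=.
    by rewrite leNgt -subr_gt0; apply/negP.
  by rewrite subr_gt0 ltNge h.
rewrite stE.
have mset : measurable [set s | A_infty A w <= A w s] by exact: measurable_superlevel.
rewrite integral_indic//.
apply/eqP; rewrite eq_le measure_ge0 andbT.
have [A0|A0] := leP (A_infty A w) 0.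
  apply: (@le_trans _ _ (lebesgue_stieltjes_measure (A w) `[0%R, +oo[%classic)).
    by apply: le_measure; rewrite ?inE//; exact: measurableI.
  by rewrite (stieltjes_itvcy (@lt0 w) ty gw) lee_fin.
apply: (@le_trans _ _ (lebesgue_stieltjes_measure (A w) [set s | A_infty A w <= A w s])).
  by apply: le_measure; rewrite ?inE//; exact: measurableI.
rewrite (stieltjes_superlevel (@lt0 w) ty gw A0) subrr maxxx//.
Qed.

(** Letting the grid refine in [grid_estimate], the mean of the integral of [H m]
against [dA] is at most [2 * k] times that of [stopped], which is 0. By duality
it is also the mean of [H m] at [L]. *)
Let H_at_L m : 0 <= m -> \forall w \ae P, H m (fine (L w)) w = 0.
Proof.
move=> m0; have [k k0 mk] := bound m0.
have s01 t w : 0 <= stopped t w <= 1.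
  by rewrite /stopped indicE; case: (_ \in _); rewrite ?lexx ?ler01.
have cH := cvg_integral_grid_sum (@mH m) (@H01 m) (@H_grid m) (fun=> erefl).
have cS := cvg_integral_grid_sum mstopped s01 cvg_stopped (fun=> erefl).
have I0 : (\int[P]_w \int[lebesgue_stieltjes_measure (A w)]_(s in `[0%R, +oo[)
    (stopped s w)%:E = 0)%E.
  rewrite (ge0_ae_integral hF (g := cst 0%E))//; first by rewrite integral0.
  by move=> w; apply: integral_ge0 => s _; rewrite lee_fin.
have IH0 : (\int[P]_w \int[lebesgue_stieltjes_measure (A w)]_(s in `[0%R, +oo[) (H m s w)%:E = 0)%E.
  apply/eqP; rewrite eq_le; apply/andP; split; last first.
    apply: integral_ge0 => w _; apply: integral_ge0 => s _; rewrite lee_fin.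
    by case/andP: (H01 m s w).
  have cS2 : ((2 * k)%:E * \int[P]_w grid_sum (A w) n (stopped ^~ w))%E @[n --> \oo] -->
      ((2 * k)%:E * 0)%E.
    by rewrite -[X in _ --> (_ * X)%E]I0; apply: cvgeZl.
  rewrite mule0 in cS2.
  rewrite -[leLHS](cvg_lim _ cH)// -[leRHS](cvg_lim _ cS2)//.
  apply: lee_lim; [exact: cvgP cH|exact: cvgP cS2|].
  apply: nearW => n; have := grid_estimate n k0 mk.
  have k20 : 0 <= 2 * k by rewrite mulr_ge0.
  have mS := (integral_grid_sum n mstopped (fun t w => proj1 (andP (s01 t w)))).1.
  by rewrite ge0_integralZl_EFin// => w _; exact: grid_sum_ge0.
have bH : exists K : R, forall t w, 0 <= t -> `|H m t w| <= K.
  by exists 1 => t w _; rewrite ger0_norm; case/andP: (H01 m t w).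
have := dual_integral hdual (H_optional m) bH.
rewrite IH0 unlock => /esym EL.
have mHL : measurable_fun setT (EFin \o at_time (H m) L).
  apply/measurable_EFinP.
  exact: (measurable_at_time hF (honest_measurable hL) (honest_ge0 hL) (H_optional m)).
have EL' : (\int[P]_w `|(EFin \o at_time (H m) L) w| = 0)%E.
  rewrite -EL; apply: eq_integral => w _.
  by rewrite /= ger0_norm//; case/andP: (H01 m (fine (L w)) w).
have /(ae_eq_integral_abs _ measurableT mHL) := EL'.
by apply: filterS => w /(_ Logic.I) [].
Qed.

(** For integers [m] beyond [A_L + 1] the cutoff equals 1 at [L], and [H m] there
is the capped difference. *)
Lemma martingale_at_honest : \forall w \ae P,
  at_time M L w = phi_hat phi (at_time (fun t w => A w t) L w).
Proof.
have := ae_foralln (fun n => H_at_L (ler0n R n)).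
apply: filterS => w h; rewrite /at_time.
set l := fine (L w) in h *.
have := h (Num.truncn (A w l + 1)).+1.
rewrite /H cutoff_eq1 ?mul1r; last by rewrite ltW// truncnS_gt.
move=> hmin.
have : `|M l w - psi (A w l)| <= 0.
  have [h1|h1] := leP `|M l w - psi (A w l)| 1; move: hmin; rewrite ?(min_l h1)//.
    by move=> ->.
  by rewrite min_r ?(ltW h1)// => /eqP; rewrite oner_eq0.
by rewrite normr_le0 subr_eq0 psiE => /eqP.
Qed.

End value_at_L.

(** * Conditioning on the past of L *)

Section terminal_at_L.
Context d (Omega : measurableType d) (R : realType) (P : probability Omega R).
Variables (F : R -> set (set Omega)) (L : Omega -> \bar R) (A : Omega -> cumulative R R).
Hypotheses (hF : usual_filtration P F) (hL : honest_time P F L) (hA : condition_A P F L)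
  (hdual : dual_optional_projection P F L A).

Lemma sigma_at_measurable E : sigma_at F L E -> measurable E.
Proof.
have S_sub : sigma_at F L `<=` measurable.
  apply: smallest_sub; first exact: sigma_algebra_measurable.
  move=> _ [z [B [oz mB ->]]].
  have := measurable_at_time hF (honest_measurable hL) (honest_ge0 hL) oz.
  by move=> /(_ measurableT B mB); rewrite setTI.
exact: S_sub.
Qed.

(** Since [A_infty A = A_L] almost surely, conditioning on [F_L] has no effect
on functions of [A_infty A]. *)
Lemma cond_expectation_at_honest (phi : R -> R) :
  {within `[0, +oo[, continuous phi} ->
  (\int[lebesgue_measure]_(x in `[0%R, +oo[) (`|phi x| * expR (- x))%:E < +oo)%E ->
  cond_expectation P (sigma_at F L) (phi \o A_infty A)
    (phi \o at_time (fun t w => A w t) L).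
Proof.
move=> phi_cont phi_int; set A_L := at_time _ L.
have mphi := measurable_half_ext phi_cont.
have phiE t w : phi (A w t) = half_ext phi (A w t).
  by rewrite half_extE// (dual_ge0 hdual).
have intX : P.-integrable setT (EFin \o (phi \o A_infty A)).
  have := integrable_phi_A_infty hF hL hA hdual phi_cont phi_int.
  apply: eq_integrable => // w _ /=.
  by rewrite half_extE// (A_infty_ge0 hdual).
have mY : measurable_fun setT (phi \o A_L).
  apply: (eq_measurable_fun (half_ext phi \o A_L)).
    by move=> w _; rewrite /= /A_L /at_time phiE.
  by apply: measurableT_comp => //; exact: (measurable_dual_at hF hL hdual).
have XY : \forall w \ae P, phi (A_infty A w) = phi (A_L w).
  by apply: filterS (dual_generic hF hL hA hdual) => w [_ _ -> _].
have aeXY E : ae_eq P E (EFin \o (phi \o A_infty A)) (EFin \o (phi \o A_L)).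
  by apply: filterS XY => w /= -> _.
have mY' : measurable_fun setT (EFin \o (phi \o A_L)) by exact/measurable_EFinP.
split=> //.
- move=> B mB; apply: sub_sigma_algebra.
  exists (fun t w => phi (A w t)), B; split=> //.
  apply/optional_processP.
  apply: (eq_measurable_fun
    (fun tw : g_sigma_algebraType (optional_trace F) => half_ext phi (A tw.2 tw.1))).
    by move=> tw _; rewrite phiE.
  apply: measurableT_comp => //.
  by have /optional_processP := optional_dual hdual.
- have /integrableP[_ Xlty] := intX; apply/integrableP; split=> //.
  rewrite (ge0_ae_integral hF (g := fun w => `|(phi (A_infty A w))%:E|%E))//.
  + by apply: measurableT_comp => //; exact: (measurable_int P intX).
  + by apply: filterS XY => w /= ->.
- move=> E /sigma_at_measurable mE; apply/esym; apply: ae_eq_integral => //.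
  + by apply: measurable_funTS; exact: (measurable_int P intX).
  + exact: measurable_funTS.
Qed.

End terminal_at_L.

Theorem proposition5p6 (R : realType) (d : measure_display)
    (Omega : measurableType d) (P : probability Omega R)
    (F : R -> set (set Omega)) (hF : usual_filtration P F)
    (L : Omega -> \bar R) (hL : honest_time P F L) (hA : condition_A P F L)
    (A : Omega -> cumulative R R) (hdual : dual_optional_projection P F L A)
    (phi : R -> R) (phi_cont : {within `[0, +oo[, continuous phi})
    (phi_int : (\int[lebesgue_measure]_(x in `[0%R, +oo[)
                  (`|phi x| * expR (- x))%:E < +oo)%E)
    (xphi_int : (\int[lebesgue_measure]_(x in `[0%R, +oo[)
                   (x * `|phi x| * expR (- x))%:E < +oo)%E) :
  let A_L := at_time (fun t w => A w t) L in
  (forall M : R -> Omega -> R,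
     (forall w, cadlag (M ^~ w)) ->
     (forall t, 0 <= t ->
        cond_expectation P (F t) (phi \o A_infty A) (M t)) ->
     \forall w \ae P,
       [/\ at_time M L w =
             expR (A_L w) * \int[lebesgue_measure]_(x in `[A_L w, +oo[)
                              (expR (- x) * phi x),
           expR (A_L w) * \int[lebesgue_measure]_(x in `[A_L w, +oo[)
                              (expR (- x) * phi x) =
             \int[lebesgue_measure]_(x in `[0, +oo[)
               (expR (- x) * phi (A_L w + x)) &
           \int[lebesgue_measure]_(x in `[0, +oo[)
             (expR (- x) * phi (A_L w + x)) = phi_hat phi (A_L w)])
  /\ cond_expectation P (sigma_at F L) (phi \o A_infty A) (phi \o A_L).
Proof.
move=> A_L; split; last exact: cond_expectation_at_honest.
have shift w := phi_hat_shift phi_cont phi_int (dual_ge0 hdual w (fine (L w))).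
move=> M M_cadlag M_cond.
have := martingale_at_honest hF hL hA hdual phi_cont phi_int M_cadlag M_cond.
by apply: filterS => w ->; split; rewrite -/(phi_hat phi (A_L w)) ?shift.
Qed.
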